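(* Let $X,Y,A,B,F,V,\psi,\chi$ be as in the context. Suppose in addition that $A$ is an entire function for which there are constants $C,\lambda>0$ with $|A(\theta)|<C\exp(\lambda|\theta|)$ for all $\theta\in\mathbb C$. Suppose that the zeroes of $F$ with strictly positive real part, listed with multiplicity, have an enumeration $\{z_n,\overline{z}_n : 0<n<\infty\}$ such that, as $n\to\infty$, $\Re z_n=o(n^{1/2})$ and $\Im z_n=2\pi\alpha^{-1}n+\beta+o(1)$, where $\alpha>0$ and $\beta$ are real constants. Then $\chi$ is given by $$\chi(\theta)=\chi_0\exp\{\alpha\theta/2\}\prod_{k=1}^{\infty}\Big(1-\frac{2\,\Re(z_k)\,\theta}{z_k\overline{z}_k}+\frac{\theta^2}{z_k\overline{z}_k}\Big)$$ for a constant $\chi_0$.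
   Context: $X\ge 0$ (interarrival time) and $Y\ge0$ (service time) are independent random variables with $E[Y]<E[X]$, at least one of which is non-lattice; $U=Y-X$. Their Laplace transforms are $A(\theta)=E[\exp(-\theta X)]$ and $B(\theta)=E[\exp(-\theta Y)]$, both assumed analytic in a strip $\{\theta:-\epsilon<\Re\theta<\epsilon\}$ with $\epsilon>0$. Put $F(\theta)=B(\theta)A(-\theta)-1$ (continued analytically where possible). $V\ge 0$ is the steady-state unfinished workload just prior to an arrival, i.e. $V$ has the unique distribution such that $V$ and $(V+U)^+$ are equal in law, with $V$ and $U$ independent in the second expression; $\psi(\theta)=E[\exp(-\theta V)]$. Known factorization (W. L. Smith): $F(\theta)=\theta\chi(\theta)/\psi(\theta)$, where for some $\epsilon_1>0$ the function $\chi$ is analytic and non-vanishing on $\{\Re\theta<\epsilon_1\}$, $\psi$ is analytic and non-vanishing on $\{\Re\theta>-\epsilon_1\}$, the zeroes of $\chi$ coincide with all the zeroes of $F$ of positive real part, and the poles of $\psi$ coincide with the zeroes of $F$ of negative real part. The function $\chi$ is thus determined by $\chi=F\psi/\theta$ and analytic continuation. *)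

(* Defs.v *)
From mathcomp Require Export all_boot all_order all_algebra.
From mathcomp Require Export all_classical all_reals all_analysis.

Set Implicit Arguments.
Unset Strict Implicit.
Unset Printing Implicit Defensive.

Export Order.TTheory GRing.Theory Num.Theory.
Export numFieldNormedType.Exports.
(* After [Num.Theory], so that [Re] and [Im] are the projections R[i] -> R. *)
From mathcomp Require Export complex.

#[global] Open Scope classical_set_scope.
#[global] Open Scope ring_scope.

(* These notions are used with K = R[i].  Stating them over an abstract number
   field gives access to the library's topology and derivative, which are not
   declared on R[i] itself. *)
Section analysis.
Variable K : numFieldType.

(* Only used with [D] open, where differentiability over K = R[i] is
   analyticity. *)
Definition analytic_on (D : set K) (f : K -> K) : Prop :=
  forall s, D s -> derivable f s 1.

Definition region (D : set K) : Prop := open D /\ connected D.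

(* [f] has a zero of order exactly [m] at [w]; [m = 0] means [f w <> 0]. *)
Definition zero_of_order (f : K -> K) (w : K) (m : nat) : Prop :=
  exists g : K -> K,
    [/\ \forall s \near w, derivable g s 1,
        g w != 0
      & \forall s \near w, f s = (s - w) ^+ m * g s].

Definition pole (f : K -> K) (w : K) : Prop :=
  (\forall s \near w^', derivable f s 1) /\
  (forall M : K, 0 < M -> \forall s \near w^', M < `|f s|).

(* The product of the u k over k >= 1 converges to p. *)
Definition infinite_product (u : nat -> K) (p : K) : Prop :=
  \prod_(1 <= k < n.+1) u k @[n --> \oo] --> p.

End analysis.

Definition cexp (R : realType) (s : R[i]) : R[i] :=
  Complex (expR (Re s) * cos (Im s)) (expR (Re s) * sin (Im s)).

Section probability.
Context d (T : measurableType d) (R : realType) (P : probability T R).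

Definition independent (f g : T -> R) : Prop :=
  forall E G : set R, measurable E -> measurable G ->
    P (f @^-1` E `&` g @^-1` G) = (P (f @^-1` E) * P (g @^-1` G))%E.

Definition equal_in_law (f g : T -> R) : Prop :=
  forall E : set R, measurable E -> P (f @^-1` E) = P (g @^-1` E).

(* Lattice in Feller's sense: the lattice may be shifted (an arithmetic law is
   the case a = 0); in particular constants are lattice. *)
Definition lattice (f : T -> R) : Prop :=
  exists a h : R, 0 < h /\ {ae P, forall w, exists k : int, f w = a + k%:~R * h}.

Definition cintegrable (f : T -> R[i]) : Prop :=
  P.-integrable [set: T] (fun w => (Re (f w))%:E) /\
  P.-integrable [set: T] (fun w => (Im (f w))%:E).

Definition cexpectation (f : T -> R[i]) : R[i] :=
  Complex (fine 'E_P[fun w => Re (f w)]) (fine 'E_P[fun w => Im (f w)]).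

Definition laplace (X : T -> R) (s : R[i]) : R[i] :=
  cexpectation (fun w => cexp (- s * ((X w)%:C)%C)).

(* [cexpectation] is a junk value when the integral diverges, hence the
   separate integrability clause. *)
Definition laplace_analytic_in_strip (X : T -> R) (eps : R) : Prop :=
  (forall s : R[i], - eps < Re s < eps ->
     cintegrable (fun w => cexp (- s * ((X w)%:C)%C))) /\
  analytic_on [set s : R[i] | - eps < Re s < eps] (laplace X).

(* [Phi] is an analytic continuation, to the region [D], of the Laplace
   transform of [X], the latter being analytic on Re s > -eps. *)
Definition laplace_continuation (X : T -> R) (eps : R) (D : set R[i])
    (Phi : R[i] -> R[i]) : Prop :=
  [/\ region D,
      [set s : R[i] | - eps < Re s] `<=` D,
      analytic_on D Phi
    & forall s : R[i], - eps < Re s -> Phi s = laplace X s].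

End probability.

Definition Ffun (R : realType) (A B : R[i] -> R[i]) (s : R[i]) : R[i] :=
  B s * A (- s) - 1.

(* Smith's factorization F(s) = s chi(s) / psi(s).  [D] is the region to which
   F has been continued; it contains the closed right half-plane.  [psi] is
   meromorphic on [D], its value at a pole being irrelevant. *)
Record smith_factorization (R : realType) (D : set R[i])
    (F psi chi : R[i] -> R[i]) (eps1 : R) : Prop := SmithFactorization {
  smith_eps1 : 0 < eps1;
  smith_chi_analytic : analytic_on [set s : R[i] | Re s < eps1] chi;
  smith_chi_neq0 : forall s : R[i], Re s < eps1 -> chi s != 0;
  smith_psi_analytic : analytic_on [set s : R[i] | - eps1 < Re s] psi;
  smith_psi_neq0 : forall s : R[i], - eps1 < Re s -> psi s != 0;
  smith_eq : forall s : R[i], D s -> ~ pole psi s -> F s = s * chi s / psi s;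
  smith_chi_zeros : forall s : R[i], chi s = 0 <-> 0 < Re s /\ F s = 0;
  smith_psi_poles : forall s : R[i], D s ->
    (pole psi s <-> Re s < 0 /\ F s = 0)
}.

(* The entries of the list z_1, conj z_1, z_2, conj z_2, ... are indexed by
   pairs (n, b) with 0 < n; the value z 0 is not used. *)
Definition listed_zero (R : realType) (z : nat -> R[i]) (p : nat * bool) : R[i] :=
  if p.2 then ((z p.1)^*)%C else z p.1.

Definition enumerates_right_zeros (R : realType) (F : R[i] -> R[i])
    (z : nat -> R[i]) : Prop :=
  (forall n : nat, (0 < n)%N -> 0 < Re (z n)) /\
  (forall w : R[i], 0 < Re w -> exists m : nat,
     zero_of_order F w m /\
     ([set p : nat * bool | (0 < p.1)%N /\ listed_zero z p = w] #= `I_m)%card).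

Definition quadratic_factor (R : realType) (w s : R[i]) : R[i] :=
  1 - 2 * ((Re w)%:C)%C * s / (w * (w^*)%C) + s ^+ 2 / (w * (w^*)%C).

(* Main.v *)
Require Import Defs.
From HB Require Import structures.
From mathcomp Require Import measurable_realfun.
From mathcomp Require Import ring lra zify.

(** Let [W] be the idle time [(V + Y - X)^-], so that [0 <= W <= X], and let
    [G s] be the expectation of [exp (s W)].  On the imaginary axis, where all
    variables are bounded, Lindley's equation and independence give
    [F psi = G - 1], that is [s chi s = G s - 1].  Both sides are analytic on a
    half-plane [Re s < e] with [e > 0], hence agree there ([idle_identity]); in
    particular [s chi s] is bounded for [Re s <= 0].  For [Re s > 0] one has
    [s chi s = F s psi s], where [psi] and [B] are bounded and [A (- s)] is
    [O (exp (lambda |s|))].  So [chi] is entire of exponential type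
    ([chi_entire], [chi_growth]), and [chi (- t) = (1 - G (- t)) / t] is
    comparable with [1 / t] as the real [t] tends to infinity.

    Divide [f = chi / chi 0] by the factors of the first [N] pairs of zeros.
    Since [|z_k|] is comparable with [k], the quotient is entire, of size
    [exp (O N)] on a disc of radius proportional to [N], and has no zero on a
    smaller such disc; there its logarithm is [O N], so by Borel-Caratheodory
    it is linear up to [O (|s|^2 / N)] ([log_linear_part]).  Hence
    [Q_N s * exp (s c_N)] tends to [f s], where [Q_N] is the partial product and
    [c_N = f' 0 + \sum_(k <= N) 2 Re z_k / |z_k|^2] ([hadamard_limit]).  The
    numbers [c_N] are real, and converge to some [c] because
    [Re z_k = o (sqrt k)].

    It remains to find [c].  At [s = - t] the factors of [Q_N] are
    [1 + a_k t + b_k t^2] with [a_k] summable and [b_k] asymptotic to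
    [q^2 / k^2], [q = alpha / (2 pi)], so the logarithm of the full product is
    [pi q t + o (t)], as for the product of the hyperbolic sine.  As [f (- t)]
    decays only like [1 / t], this forces [c = pi q = alpha / 2]
    ([exponent_eq]); the factor [exp (c s)] moves to the other side
    ([product_formula]).

    Analytic functions are only known to be differentiable.  Goursat's lemma
    for triangles ([tri_goursat]) gives primitives on discs ([primitive_disc]),
    also with one exceptional point, whence Cauchy's formula
    ([cauchy_formula]), on which the rest of the complex analysis is based. *)

Set Implicit Arguments.
Unset Strict Implicit.
Unset Printing Implicit Defensive.

(** * Complex numbers and their modulus *)

Section complex_numbers.
Variable R : realType.
Implicit Types (x y : R) (z w : R[i]).

Definition cmod z : R := Normc.normc z.

Lemma ReD z w : Re (z + w) = Re z + Re w. Proof. by case: z w => [a b] []. Qed.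
Lemma ImD z w : Im (z + w) = Im z + Im w. Proof. by case: z w => [a b] []. Qed.
Lemma ReN z : Re (- z) = - Re z. Proof. by case: z. Qed.
Lemma ImN z : Im (- z) = - Im z. Proof. by case: z. Qed.
Lemma ReB z w : Re (z - w) = Re z - Re w. Proof. by rewrite ReD ReN. Qed.
Lemma ImB z w : Im (z - w) = Im z - Im w. Proof. by rewrite ImD ImN. Qed.
Lemma ReM z w : Re (z * w) = Re z * Re w - Im z * Im w.
Proof. by case: z w => [a b] []. Qed.
Lemma ImM z w : Im (z * w) = Re z * Im w + Im z * Re w.
Proof. by case: z w => [a b] []. Qed.
Lemma ReZ x z : Re (x%:C%C * z) = x * Re z.
Proof. by rewrite ReM /= mul0r subr0. Qed.
Lemma ImZ x z : Im (x%:C%C * z) = x * Im z.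
Proof. by rewrite ImM /= mul0r addr0. Qed.
Lemma Re_conj z : Re z^*%C = Re z. Proof. by case: z. Qed.
Lemma Im_conj z : Im z^*%C = - Im z. Proof. by case: z. Qed.

Lemma complexP z w : Re z = Re w -> Im z = Im w -> z = w.
Proof. by case: z w => [a b] [c d] /= -> ->. Qed.

Lemma cmodE z : cmod z = Num.sqrt (Re z ^+ 2 + Im z ^+ 2). Proof. by case: z. Qed.
Lemma normc_cmod z : `|z| = (cmod z)%:C%C. Proof. by rewrite normc_def cmodE. Qed.
Lemma cmod_ge0 z : 0 <= cmod z. Proof. by rewrite cmodE sqrtr_ge0. Qed.
Lemma cmod0 : cmod 0 = 0. Proof. exact: Normc.normc0. Qed.
Lemma cmod1 : cmod 1 = 1. Proof. exact: Normc.normc1. Qed.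
Lemma cmodM z w : cmod (z * w) = cmod z * cmod w. Proof. exact: Normc.normcM. Qed.
Lemma cmodV z : cmod z^-1 = (cmod z)^-1. Proof. exact: Normc.normcV. Qed.
Lemma cmodN z : cmod (- z) = cmod z. Proof. exact: normcN. Qed.
Lemma cmodX z n : cmod (z ^+ n) = cmod z ^+ n.
Proof. by elim: n => [|n IH]; rewrite ?expr0 ?cmod1// !exprS cmodM IH. Qed.
Lemma cmod_eq0 z : (cmod z == 0) = (z == 0).
Proof.
by apply/eqP/eqP => [/Normc.eq0_normc//|->]; rewrite cmod0.
Qed.
Lemma cmod_gt0 z : (0 < cmod z) = (z != 0).
Proof. by rewrite lt_neqAle cmod_ge0 andbT eq_sym cmod_eq0. Qed.
Lemma cmodD z w : cmod (z + w) <= cmod z + cmod w. Proof. exact: le_normcD. Qed.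
Lemma cmodB z w : cmod (z - w) <= cmod z + cmod w.
Proof. by rewrite -(cmodN w) cmodD. Qed.
Lemma cmod_distC z w : cmod (z - w) = cmod (w - z).
Proof. by rewrite -cmodN opprB. Qed.
Lemma cmodB_ge z w : cmod z - cmod w <= cmod (z - w).
Proof. by rewrite lerBlDr -{1}(subrK w z) cmodD. Qed.
Lemma cmod_real x : cmod x%:C%C = `|x|.
Proof. by rewrite cmodE /= expr0n addr0 sqrtr_sqr. Qed.
Lemma cmod_Re z : `|Re z| <= cmod z.
Proof. by rewrite cmodE -sqrtr_sqr ler_sqrt ?lerDl ?sqr_ge0// addr_ge0 ?sqr_ge0. Qed.
Lemma cmod_Im z : `|Im z| <= cmod z.
Proof. by rewrite cmodE -sqrtr_sqr ler_sqrt ?lerDr ?sqr_ge0// addr_ge0 ?sqr_ge0. Qed.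
Lemma Re_le_cmod z : Re z <= cmod z. Proof. exact: le_trans (ler_norm _) (cmod_Re z). Qed.
Lemma cmod_conj z : cmod z^*%C = cmod z.
Proof. by rewrite !cmodE Re_conj Im_conj sqrrN. Qed.
Lemma sqr_cmod z : cmod z ^+ 2 = Re z ^+ 2 + Im z ^+ 2.
Proof. by rewrite cmodE sqr_sqrtr// addr_ge0 ?sqr_ge0. Qed.
Lemma cmod_le_ReIm z : cmod z <= `|Re z| + `|Im z|.
Proof.
have h : 0 <= `|Re z| + `|Im z| by rewrite addr_ge0.
rewrite -(@ler_pXn2r _ 2) ?nnegrE ?cmod_ge0// sqr_cmod sqrrD !real_normK ?num_real//.
by rewrite lerD2r lerDl mulrn_wge0// mulr_ge0.
Qed.
Lemma mul_conj_cmod z : z * z^*%C = (cmod z ^+ 2)%:C%C.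
Proof. by apply: complexP; rewrite ?ReM ?ImM Re_conj Im_conj ?sqr_cmod /=; ring. Qed.
Lemma RtoCD x y : (x + y)%:C%C = x%:C%C + y%:C%C :> R[i]. Proof. exact: rmorphD. Qed.
Lemma RtoCM x y : (x * y)%:C%C = x%:C%C * y%:C%C :> R[i]. Proof. exact: rmorphM. Qed.
Lemma RtoCB x y : (x - y)%:C%C = x%:C%C - y%:C%C :> R[i]. Proof. exact: rmorphB. Qed.
Lemma RtoCN x : (- x)%:C%C = - x%:C%C :> R[i]. Proof. exact: rmorphN. Qed.
Lemma RtoC_nat n : n%:R%:C%C = n%:R :> R[i]. Proof. exact: rmorph_nat. Qed.
Lemma cmod_nat n : cmod n%:R = n%:R.
Proof.
have -> : (n%:R : R[i]) = (n%:R)%:C%C by exact: esym (RtoC_nat n).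
by rewrite cmod_real ger0_norm.
Qed.
Lemma RtoCX x n : (x ^+ n)%:C%C = x%:C%C ^+ n :> R[i]. Proof. exact: rmorphXn. Qed.
Lemma RtoC1 : 1%:C%C = 1 :> R[i]. Proof. exact: rmorph1. Qed.
Lemma RtoCV x : (x^-1)%:C%C = (x%:C%C)^-1 :> R[i]. Proof. exact: fmorphV. Qed.

End complex_numbers.

(** * Differentiability over the complex numbers *)

Section complex_derivative.
Variable R : realType.
Implicit Types (f g : R[i] -> R[i]) (s l : R[i]).

Definition ccont f s := forall e : R, 0 < e -> exists d : R, 0 < d /\
  forall h, cmod h < d -> cmod (f (s + h) - f s) <= e.

(** Little-o form of the complex derivative: no division by the increment, and
    only real bounds. *)
Definition cder f s l := forall e : R, 0 < e -> exists d : R, 0 < d /\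
  forall h, cmod h < d -> cmod (f (s + h) - f s - h * l) <= e * cmod h.

Definition cdiff f s := exists l, cder f s l.

Lemma minr_gt0 (a b : R) : 0 < a -> 0 < b -> 0 < Num.min a b.
Proof. by move=> a0 b0; rewrite lt_min a0. Qed.

Lemma cder_lipschitz f s l : cder f s l -> exists d : R, 0 < d /\
  forall h, cmod h < d -> cmod (f (s + h) - f s) <= (cmod l + 1) * cmod h.
Proof.
move=> /(_ 1 ltr01) [d [d0 H]]; exists d; split=> // h /H hd.
rewrite -(subrK (h * l) (f (s + h) - f s)) (le_trans (cmodD _ _))//.
by rewrite mulrDl addrC cmodM (mulrC (cmod l)) lerD2l.
Qed.

Lemma cder_cont f s l : cder f s l -> ccont f s.
Proof.
move=> /cder_lipschitz [d [d0 H]] e e0.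
have l0 : 0 < cmod l + 1 by rewrite ltr_wpDl ?cmod_ge0.
exists (Num.min d (e / (cmod l + 1))); split; first by rewrite minr_gt0// divr_gt0.
move=> h; rewrite lt_min => /andP[hd he]; rewrite (le_trans (H _ hd))//.
by rewrite mulrC -ler_pdivlMr// ltW.
Qed.

Lemma cdiff_cont f s : cdiff f s -> ccont f s.
Proof. by case=> l /cder_cont. Qed.

Lemma cder_near f g s l (d : R) : 0 < d ->
  (forall h, cmod h < d -> g (s + h) = f (s + h)) -> cder f s l -> cder g s l.
Proof.
move=> d0 fg H e e0; have [d' [d'0 H']] := H e e0.
exists (Num.min d d'); split; first by rewrite minr_gt0.
move=> h; rewrite lt_min => /andP[hd hd'].
have fgs : g s = f s by have := fg 0; rewrite cmod0 addr0; apply.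
by rewrite fgs fg//; exact: H'.
Qed.

Lemma cder_ext f g s l : f =1 g -> cder f s l -> cder g s l.
Proof. by move=> fg; apply: (cder_near ltr01) => h _; rewrite fg. Qed.

Lemma cder_cst (c : R[i]) s : cder (fun=> c) s 0.
Proof.
move=> e e0; exists 1; split=> // h _.
by rewrite subrr mulr0 subr0 cmod0 mulr_ge0 ?(ltW e0) ?cmod_ge0.
Qed.

Lemma cder_id s : cder (fun x => x) s 1.
Proof.
move=> e e0; exists 1; split=> // h _.
have -> : s + h - s - h * 1 = 0 by ring.
by rewrite cmod0 mulr_ge0 ?(ltW e0) ?cmod_ge0.
Qed.

Lemma cderD f g s l m : cder f s l -> cder g s m -> cder (fun x => f x + g x) s (l + m).
Proof.
move=> F G e e0; have e20 : 0 < e / 2 by rewrite divr_gt0.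
have [d1 [d10 H1]] := F _ e20; have [d2 [d20 H2]] := G _ e20.
exists (Num.min d1 d2); split; first by rewrite minr_gt0.
move=> h; rewrite lt_min => /andP[hd1 hd2].
have -> : f (s + h) + g (s + h) - (f s + g s) - h * (l + m) =
  (f (s + h) - f s - h * l) + (g (s + h) - g s - h * m) by ring.
rewrite (le_trans (cmodD _ _))// (le_trans (lerD (H1 _ hd1) (H2 _ hd2)))//.
by rewrite -mulrDl -splitr.
Qed.

Lemma cder_comp f g s l m : cder f s l -> cder g (f s) m ->
  cder (fun x => g (f x)) s (l * m).
Proof.
move=> F G e e0; have [dl [dl0 L]] := cder_lipschitz F.
have pos (a : R[i]) : 0 < cmod a + 1 by rewrite ltr_wpDl ?cmod_ge0.
have [d1 [d10 H1]] := F _ (divr_gt0 (divr_gt0 e0 (ltr0n R 2)) (pos m)).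
have [d2 [d20 H2]] := G _ (divr_gt0 (divr_gt0 e0 (ltr0n R 2)) (pos l)).
exists (Num.min (Num.min dl d1) (d2 / (cmod l + 1))); split.
  by rewrite !minr_gt0// divr_gt0.
move=> h; rewrite !lt_min => /andP[/andP[hdl hd1] hd2].
have k_le := L _ hdl; set k := f (s + h) - f s in k_le.
have kd : cmod k < d2 by rewrite (le_lt_trans k_le)// mulrC -ltr_pdivlMr.
have -> : g (f (s + h)) - g (f s) - h * (l * m) =
  (g (f s + k) - g (f s) - k * m) + (f (s + h) - f s - h * l) * m.
  by rewrite (_ : f s + k = f (s + h)) /k; [ring | rewrite addrC subrK].
rewrite (splitr e) [leRHS]mulrDl (le_trans (cmodD _ _))// lerD//.
  rewrite (le_trans (H2 _ kd))// mulrAC ler_pdivrMr// -[leRHS]mulrA ler_wpM2l ?divr_ge0 ?(ltW e0)//.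
  by rewrite mulrC.
rewrite cmodM (le_trans (ler_wpM2r (cmod_ge0 _) (H1 _ hd1)))//.
rewrite mulrAC ler_wpM2r ?cmod_ge0// mulrAC ler_pdivrMr// ler_wpM2l ?divr_ge0 ?(ltW e0)//.
by rewrite lerDl.
Qed.

Lemma cderZ (c : R[i]) f s l : cder f s l -> cder (fun x => c * f x) s (c * l).
Proof.
move=> F; rewrite mulrC; apply: (cder_comp F (g := fun x => c * x)) => e e0.
exists 1; split=> // h _.
have -> : c * (f s + h) - c * f s - h * c = 0 by ring.
by rewrite cmod0 mulr_ge0 ?(ltW e0) ?cmod_ge0.
Qed.

Lemma cderN f s l : cder f s l -> cder (fun x => - f x) s (- l).
Proof.
move=> /(cderZ (-1)); rewrite mulN1r; apply: cder_ext => x.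
by rewrite mulN1r.
Qed.

Lemma cderB f g s l m : cder f s l -> cder g s m -> cder (fun x => f x - g x) s (l - m).
Proof. by move=> F /cderN; exact: cderD. Qed.

Lemma cder_sqr s : cder (fun x => x * x) s (2 * s).
Proof.
move=> e e0; exists e; split=> // h he.
have -> : (s + h) * (s + h) - s * s - h * (2 * s) = h * h by ring.
by rewrite cmodM ler_wpM2r ?cmod_ge0// ltW.
Qed.

Lemma cderM f g s l m : cder f s l -> cder g s m ->
  cder (fun x => f x * g x) s (l * g s + f s * m).
Proof.
move=> F G; have sq h k : cder h s k -> cder (fun x => h x * h x) s (k * (2 * h s)).
  by move=> H; exact: (cder_comp H (cder_sqr _)).
have H := cderZ 4^-1 (cderB (sq _ _ (cderD F G)) (sq _ _ (cderB F G))).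
have E : 4^-1 * ((l + m) * (2 * (f s + g s)) - (l - m) * (2 * (f s - g s))) =
  l * g s + f s * m by field.
by rewrite E in H; apply: cder_ext H => x; field.
Qed.

Lemma cderVid s : s != 0 -> cder (fun x => x^-1) s (- (s ^- 2)).
Proof.
move=> s0 e e0; have ms0 : 0 < cmod s by rewrite cmod_gt0.
exists (Num.min (cmod s / 2) (e * cmod s ^+ 3 / 2)); split.
  by rewrite minr_gt0 ?divr_gt0 ?mulr_gt0 ?exprn_gt0.
move=> h; rewrite lt_min => /andP[h1 h2].
have sh : cmod s / 2 <= cmod (s + h).
  have := cmodB_ge s (- h); rewrite opprK cmodN => /(le_trans _); apply.
  by move: h1; lra.
have sh0 : 0 < cmod (s + h) by rewrite (lt_le_trans _ sh)// divr_gt0.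
have shn : s + h != 0 by rewrite -cmod_gt0.
have -> : (s + h)^-1 - s^-1 - h * - s ^- 2 = h * (h / (s ^+ 2 * (s + h))).
  by field; rewrite s0 shn.
rewrite cmodM mulrC ler_wpM2r ?cmod_ge0// cmodM cmodV cmodM cmodX.
rewrite ler_pdivrMr ?mulr_gt0 ?exprn_gt0// (le_trans (ltW h2))//.
have -> : e * cmod s ^+ 3 / 2 = e * (cmod s ^+ 2 * (cmod s / 2)) by field.
by rewrite ler_wpM2l ?(ltW e0)// ler_wpM2l// exprn_ge0// ltW.
Qed.

Lemma cderV f s l : f s != 0 -> cder f s l -> cder (fun x => (f x)^-1) s (- l / f s ^+ 2).
Proof.
move=> fs0 F; have := cder_comp F (cderVid fs0).
by rewrite mulrN mulNr.
Qed.

Lemma cder_unique f s l m : cder f s l -> cder f s m -> l = m.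
Proof.
move=> F G; apply/eqP; rewrite -subr_eq0 -cmod_eq0; apply/negPn/negP => nz.
have c0 : 0 < cmod (l - m) by rewrite lt_neqAle eq_sym nz cmod_ge0.
have e0 : 0 < cmod (l - m) / 4 by rewrite divr_gt0.
have [d1 [d10 H1]] := F _ e0; have [d2 [d20 H2]] := G _ e0.
pose h : R[i] := (Num.min d1 d2 / 2)%:C%C.
have m0 := minr_gt0 d10 d20.
have hE : cmod h = Num.min d1 d2 / 2 by rewrite cmod_real ger0_norm// divr_ge0 // ltW.
have h0 : 0 < cmod h by rewrite hE divr_gt0.
have hm : cmod h < Num.min d1 d2 by rewrite hE ltr_pdivrMr// mulr_natr mulr2n ltrDl.
move: (hm); rewrite lt_min => /andP[/H1 a /H2 b].
have := lerD a b; rewrite (cmod_distC (f (s + h) - f s)) => /(le_trans (cmodD _ _)).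
have -> : h * l - (f (s + h) - f s) + (f (s + h) - f s - h * m) = h * (l - m) by ring.
rewrite cmodM -mulrDl mulrC ler_pM2r// leNgt => /negP; apply.
lra.
Qed.

Lemma cder_pow n s : cder (fun x => x ^+ n.+1) s (n.+1%:R * s ^+ n).
Proof.
elim: n => [|n IH]; first by rewrite expr0 mulr1; exact: cder_id.
have := cderM (cder_id s) IH.
have -> : 1 * s ^+ n.+1 + s * (n.+1%:R * s ^+ n) = n.+2%:R * s ^+ n.+1.
  by rewrite mulrCA -exprS -mulrDl -[in RHS]addn1 natrD addrC.
by apply: cder_ext => x; rewrite [RHS]exprS.
Qed.

Lemma ccont_cst (c : R[i]) s : ccont (fun=> c) s.
Proof. by apply: cdiff_cont; exists 0; exact: cder_cst. Qed.

Lemma ccont_id s : ccont (fun x => x) s.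
Proof. by apply: cdiff_cont; exists 1; exact: cder_id. Qed.

Lemma ccontD f g s : ccont f s -> ccont g s -> ccont (fun x => f x + g x) s.
Proof.
move=> F G e e0; have e20 : 0 < e / 2 by rewrite divr_gt0.
have [d1 [d10 H1]] := F _ e20; have [d2 [d20 H2]] := G _ e20.
exists (Num.min d1 d2); split; first by rewrite minr_gt0.
move=> h; rewrite lt_min => /andP[hd1 hd2].
have -> : f (s + h) + g (s + h) - (f s + g s) = (f (s + h) - f s) + (g (s + h) - g s) by ring.
by rewrite (splitr e) (le_trans (cmodD _ _))// lerD ?H1 ?H2.
Qed.

Lemma ccont_comp f g s : ccont f s -> ccont g (f s) -> ccont (fun x => g (f x)) s.
Proof.
move=> F G e /G [d [d0 H]]; have d2 : 0 < d / 2 by rewrite divr_gt0.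
have [d' [d'0 H']] := F _ d2; exists d'; split=> // h /H' h1.
have := H (f (s + h) - f s); rewrite subrKC; apply.
by rewrite (le_lt_trans h1)// ltr_pdivrMr// mulr_natr mulr2n ltrDl.
Qed.

Lemma ccontZ (c : R[i]) f s : ccont f s -> ccont (fun x => c * f x) s.
Proof.
move=> F; apply: (ccont_comp F (g := fun x => c * x)); apply: cdiff_cont.
by eexists; exact: cderZ (cder_id _).
Qed.

Lemma ccontM f g s : ccont f s -> ccont g s -> ccont (fun x => f x * g x) s.
Proof.
move=> F G; have sq h : ccont h s -> ccont (fun x => h x * h x) s.
  by move=> H; apply: (ccont_comp H (g := fun x => x * x)); apply: cdiff_cont;
    eexists; exact: cder_sqr.
have H := ccontZ 4^-1 (ccontD (sq _ (ccontD F G)) (ccontZ (-1) (sq _ (ccontD F (ccontZ (-1) G))))).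
move=> e /H [d [d0 Hd]]; exists d; split=> // h /Hd; congr (cmod _ <= e).
by field.
Qed.

Lemma ccont_pow n s : ccont (fun x => x ^+ n) s.
Proof.
case: n => [|n]; first exact: ccont_cst.
by apply: cdiff_cont; eexists; exact: cder_pow.
Qed.

Lemma ccontV f s : f s != 0 -> ccont f s -> ccont (fun x => (f x)^-1) s.
Proof.
move=> fs0 F; apply: (@ccont_comp f (fun x => x^-1)) => //.
by apply: cdiff_cont; eexists; exact: cderVid.
Qed.

Lemma ccont_punctured_eq f g w (d : R) : 0 < d -> ccont f w -> ccont g w ->
  (forall h, h != 0 -> cmod h < d -> f (w + h) = g (w + h)) -> f w = g w.
Proof.
move=> d0 fc gc fg; apply/eqP; rewrite -subr_eq0 -cmod_eq0 eq_le cmod_ge0 andbT.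
apply/ler_addgt0Pr => e e0; rewrite add0r.
have e2 : 0 < e / 2 by rewrite divr_gt0.
have [d1 [d10 H1]] := fc _ e2; have [d2 [d20 H2]] := gc _ e2.
pose m := Num.min (Num.min d1 d2) d; have m1 : 0 < m by rewrite !minr_gt0.
pose x : R[i] := (m / 2)%:C%C.
have xm : cmod x < m by rewrite cmod_real gtr0_norm ?divr_gt0//; lra.
move: (xm); rewrite !lt_min => /andP[/andP[x1 x2] x3].
have x0 : x != 0 by rewrite -cmod_gt0 cmod_real normr_gt0 gt_eqF ?divr_gt0.
have := H1 _ x1; have := H2 _ x2; rewrite fg// => a b.
rewrite (_ : f w - g w = (g (w + x) - g w) - (g (w + x) - f w)); last by ring.
by rewrite (le_trans (cmodB _ _))// (splitr e) lerD.
Qed.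

End complex_derivative.

Lemma is_derive_epsP (K : numFieldType) (f : K -> K) (s l : K) :
  is_derive s 1 f l <-> forall e : K, 0 < e -> exists d : K, 0 < d /\
    forall h, `|h| < d -> `|f (s + h) - f s - h * l| <= e * `|h|.
Proof.
split=> [[df dl] e e0|H].
  have : h^-1 *: (f (h *: (1 : K) + s) - f s) @[h --> 0^'] --> l.
    by rewrite -dl; exact: df.
  move=> /cvgrPdist_le /(_ _ e0) [d /= d0 H]; exists d; split=> // h hd.
  have [->|h0] := eqVneq h 0; first by rewrite addr0 subrr mul0r subrr normr0 mulr0.
  have := H h; rewrite /ball /= sub0r normrN => /(_ hd h0).
  rewrite /GRing.scale /= mulr1 (addrC h s) distrC -(ler_pM2r (_ : 0 < `|h|)) ?normr_gt0//.
  rewrite -normrM; congr (`|_| <= _).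
  by field.
have cv : h^-1 *: (f (h *: (1 : K) + s) - f s) @[h --> 0^'] --> l.
  apply/cvgrPdist_le => e e0; have [d [d0 Hd]] := H e e0.
  exists d => //= h; rewrite /ball /= sub0r normrN => hd h0.
  rewrite /GRing.scale /= mulr1 (addrC h s) distrC -(ler_pM2r (_ : 0 < `|h|)) ?normr_gt0//.
  rewrite -normrM; have := Hd h hd; congr (`|_| <= _).
  by field.
by apply: DeriveDef; [apply: cvgP cv | apply: cvg_lim cv].
Qed.

Lemma derivable_epsP (K : numFieldType) (f : K -> K) (s : K) :
  derivable f s 1 <-> exists l : K, forall e : K, 0 < e -> exists d : K, 0 < d /\
    forall h, `|h| < d -> `|f (s + h) - f s - h * l| <= e * `|h|.
Proof.
split=> [df|[l /is_derive_epsP []//]].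
by exists ('D_1 f s); apply/is_derive_epsP; exact: DeriveDef.
Qed.

Lemma near_epsP (K : numFieldType) (P : K -> Prop) w : (\forall s \near w, P s) <->
  exists d : K, 0 < d /\ forall h, `|h| < d -> P (w + h).
Proof.
split=> [/nbhs_ballP[e /= e0 H]|[d [d0 H]]].
  by exists e; split=> // h hd; apply: H; rewrite /ball /= opprD addrA subrr sub0r normrN.
by apply/nbhs_ballP; exists d => //= s; rewrite /ball /= distrC => /H; rewrite subrKC.
Qed.

Section complex_bridge.
Variable R : realType.

Lemma gt0_complexE (e : R[i]) : 0 < e -> 0 < Re e /\ e = (Re e)%:C%C.
Proof.
by rewrite ltcE => /andP[/eqP ei er]; split=> //; apply: complexP => //=; rewrite -ei.
Qed.

(** The notion [analytic_on] is stated over an abstract number field because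
    R[i] has no topology of its own; a singleton domain gives access to its
    pointwise content. *)
Lemma analytic_at_cdiff (f : R[i] -> R[i]) s : analytic_on [set s] f <-> cdiff f s.
Proof.
split=> [/(_ s erefl) /derivable_epsP [l H]|[l H] _ ->].
  exists l => e e0; have [|d [/gt0_complexE[d0 ->] Hd]] := H e%:C%C; first by rewrite ltcR.
  exists (Re d); split=> // h hd; have := Hd h; rewrite !normc_cmod -RtoCM ltcR lecR.
  exact.
apply/derivable_epsP; exists l => e /gt0_complexE[e0 ->].
have [d [d0 Hd]] := H _ e0.
exists d%:C%C; rewrite ltcR; split=> // h; rewrite !normc_cmod -RtoCM ltcR lecR.
exact: Hd.
Qed.

Lemma analytic_onP (D : set R[i]) (f : R[i] -> R[i]) :
  analytic_on D f <-> forall s, D s -> cdiff f s.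
Proof.
split=> H s Ds; last by have /analytic_at_cdiff/(_ s erefl) := H s Ds.
by apply/analytic_at_cdiff => _ ->; exact: H.
Qed.

End complex_bridge.

(** * Integrals along paths parametrised by the unit interval *)

Section path_integral.
Variable R : realType.
Implicit Types (phi psi Phi Psi : R -> R[i]) (t u : R).

(** Derivative within [0, 1], one-sided at the end points: paths need not be
    extended beyond the unit interval. *)
Definition pder Phi t v := forall e : R, 0 < e -> exists d : R, 0 < d /\
  forall u, 0 <= u <= 1 -> `|u - t| < d ->
    cmod (Phi u - Phi t - (u - t)%:C%C * v) <= e * `|u - t|.

Definition antider Phi phi := forall t, 0 <= t <= 1 -> pder Phi t (phi t).

Definition pcont phi := forall t, 0 <= t <= 1 -> forall e : R, 0 < e ->
  exists d : R, 0 < d /\ forall u, 0 <= u <= 1 -> `|u - t| < d ->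
    cmod (phi u - phi t) <= e.

Lemma pder_lipschitz Phi t v : pder Phi t v -> exists d : R, 0 < d /\
  forall u, 0 <= u <= 1 -> `|u - t| < d -> cmod (Phi u - Phi t) <= (cmod v + 1) * `|u - t|.
Proof.
move=> /(_ 1 ltr01) [d [d0 H]]; exists d; split=> // u u01 /(H _ u01) hd.
rewrite -(subrK ((u - t)%:C%C * v) (Phi u - Phi t)) (le_trans (cmodD _ _))//.
by rewrite mulrDl addrC cmodM cmod_real (mulrC (cmod v)) lerD2l.
Qed.

Lemma antider_pcont Phi phi : antider Phi phi -> pcont Phi.
Proof.
move=> H t t01 e e0; have [d [d0 {}H]] := pder_lipschitz (H t t01).
have l0 : 0 < cmod (phi t) + 1 by rewrite ltr_wpDl ?cmod_ge0.
exists (Num.min d (e / (cmod (phi t) + 1))); split; first by rewrite minr_gt0// divr_gt0.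
move=> h h01; rewrite lt_min => /andP[hd he]; rewrite (le_trans (H _ h01 hd))//.
by rewrite mulrC -ler_pdivlMr// ltW.
Qed.

Lemma antiderD Phi Psi phi psi : antider Phi phi -> antider Psi psi ->
  antider (fun t => Phi t + Psi t) (fun t => phi t + psi t).
Proof.
move=> F G t t01 e e0; have e20 : 0 < e / 2 by rewrite divr_gt0.
have [d1 [d10 H1]] := F _ t01 _ e20; have [d2 [d20 H2]] := G _ t01 _ e20.
exists (Num.min d1 d2); split; first by rewrite minr_gt0.
move=> u u01; rewrite lt_min => /andP[hd1 hd2].
have -> : Phi u + Psi u - (Phi t + Psi t) - (u - t)%:C%C * (phi t + psi t) =
  (Phi u - Phi t - (u - t)%:C%C * phi t) + (Psi u - Psi t - (u - t)%:C%C * psi t) by ring.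
rewrite (le_trans (cmodD _ _))// (le_trans (lerD (H1 _ u01 hd1) (H2 _ u01 hd2)))//.
by rewrite -mulrDl -splitr.
Qed.

Lemma antider_id : antider (fun t => t%:C%C) (fun=> 1).
Proof.
move=> t _ e e0; exists 1; split=> // u _ _.
by rewrite mulr1 RtoCB subrr cmod0 mulr_ge0 ?(ltW e0).
Qed.

Lemma antider_cst (c : R[i]) : antider (fun=> c) (fun=> 0).
Proof.
move=> t _ e e0; exists 1; split=> // u _ _.
by rewrite mulr0 subr0 subrr cmod0 mulr_ge0 ?(ltW e0).
Qed.

Lemma antider_comp (F : R[i] -> R[i]) (f : R[i] -> R[i]) Phi phi :
  (forall t, 0 <= t <= 1 -> cder F (Phi t) (f (Phi t))) -> antider Phi phi ->
  antider (fun t => F (Phi t)) (fun t => f (Phi t) * phi t).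
Proof.
move=> HF HP t t01 e e0; have [dl [dl0 L]] := pder_lipschitz (HP t t01).
have pos (a : R[i]) : 0 < cmod a + 1 by rewrite ltr_wpDl ?cmod_ge0.
set m := f _; set l := phi t in L *.
have [d1 [d10 H1]] := HP _ t01 _ (divr_gt0 (divr_gt0 e0 (ltr0n R 2)) (pos m)).
have [d2 [d20 H2]] := HF _ t01 _ (divr_gt0 (divr_gt0 e0 (ltr0n R 2)) (pos l)).
exists (Num.min (Num.min dl d1) (d2 / (cmod l + 1))); split.
  by rewrite !minr_gt0// divr_gt0.
move=> u u01; rewrite !lt_min => /andP[/andP[hdl hd1] hd2].
have k_le := L _ u01 hdl; set k := Phi u - Phi t in k_le.
have kd : cmod k < d2 by rewrite (le_lt_trans k_le)// mulrC -ltr_pdivlMr.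
have -> : F (Phi u) - F (Phi t) - (u - t)%:C%C * (m * l) =
  (F (Phi t + k) - F (Phi t) - k * m) + (Phi u - Phi t - (u - t)%:C%C * l) * m.
  by rewrite (_ : Phi t + k = Phi u) /k; [ring | rewrite subrKC].
rewrite (splitr e) [leRHS]mulrDl (le_trans (cmodD _ _))// lerD//.
  rewrite (le_trans (H2 _ kd))// mulrAC ler_pdivrMr// -[leRHS]mulrA ler_wpM2l ?divr_ge0 ?(ltW e0)//.
  by rewrite mulrC.
rewrite cmodM (le_trans (ler_wpM2r (cmod_ge0 _) (H1 _ u01 hd1)))//.
rewrite mulrAC ler_wpM2r// mulrAC ler_pdivrMr// ler_wpM2l ?divr_ge0 ?(ltW e0)//.
by rewrite lerDl.
Qed.

Lemma antiderZ (c : R[i]) Phi phi : antider Phi phi ->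
  antider (fun t => c * Phi t) (fun t => c * phi t).
Proof.
move=> H; apply: (@antider_comp (fun s => c * s) (fun=> c)) => // t _.
by have := cderZ c (cder_id (Phi t)); rewrite mulr1.
Qed.

Lemma antider_affine (p q : R) Phi phi :
  (forall t, 0 <= t <= 1 -> 0 <= p + q * t <= 1) -> antider Phi phi ->
  antider (fun t => Phi (p + q * t)) (fun t => q%:C%C * phi (p + q * t)).
Proof.
move=> pq H t t01 e e0; have q0 : 0 < `|q| + 1 by rewrite ltr_wpDl.
have [d [d0 Hd]] := H _ (pq _ t01) _ (divr_gt0 e0 q0).
exists (d / (`|q| + 1)); split; first by rewrite divr_gt0.
move=> u u01; rewrite ltr_pdivlMr// => ud.
have E : p + q * u - (p + q * t) = q * (u - t) by ring.
have := Hd _ (pq _ u01); rewrite E normrM.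
have qd : `|q| * `|u - t| <= (`|q| + 1) * `|u - t| by rewrite ler_wpM2r// lerDl.
rewrite mulrC in ud; move=> /(_ (le_lt_trans qd ud)).
have -> : (q * (u - t))%:C%C * phi (p + q * t) = (u - t)%:C%C * (q%:C%C * phi (p + q * t)).
  by rewrite RtoCM; ring.
move=> /le_trans; apply; rewrite mulrAC ler_pdivrMr// -mulrA ler_wpM2l ?(ltW e0)//.
by rewrite mulrC [leRHS]mulrC mulrC.
Qed.

Lemma antider_ext Phi phi Psi psi : (forall t, 0 <= t <= 1 -> Phi t = Psi t) ->
  (forall t, 0 <= t <= 1 -> phi t = psi t) -> antider Phi phi -> antider Psi psi.
Proof.
move=> h1 h2 H t t01 e e0; have [d [d0 Hd]] := H t t01 e e0.
by exists d; split=> // u u01 ut; rewrite -!h1// -h2//; exact: Hd.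
Qed.

(** Mean value inequality, by the real mean value theorem applied to the
    projection of [Phi] on the direction of its total increment. *)
Lemma antider_le Phi phi (M : R) : antider Phi phi ->
  (forall t, 0 <= t <= 1 -> cmod (phi t) <= M) -> cmod (Phi 1 - Phi 0) <= M.
Proof.
move=> H HM; set v := Phi 1 - Phi 0.
have [->|v0] := eqVneq v 0.
  by rewrite cmod0 (le_trans _ (HM 0 _)) ?cmod_ge0// lexx ler01.
pose u t := Re (v^*%C * Phi t).
have uE : u 1 - u 0 = cmod v ^+ 2.
  by rewrite /u -ReB -mulrBr -/v mulrC mul_conj_cmod.
have u_eps t : 0 <= t <= 1 -> forall e : R, 0 < e -> exists d : R, 0 < d /\
    forall x, 0 <= x <= 1 -> `|x - t| < d ->
    `|u x - u t - (x - t) * Re (v^*%C * phi t)| <= e * `|x - t|.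
  move=> t01 e /(antiderZ v^*%C H t01) [d [d0 Hd]]; exists d; split=> // x x01 xt.
  apply: le_trans (Hd x x01 xt); rewrite (le_trans _ (cmod_Re _))//.
  by rewrite /u -ReZ -!ReB.
have [||c c01] := @MVT R u (fun t => Re (v^*%C * phi t)) 0 1 ltr01.
- move=> x; rewrite in_itv /= => /andP[x0 x1]; apply/is_derive_epsP => e e0.
  have [|d [d0 Hd]] := u_eps x _ e e0; first by rewrite !ltW.
  have x1' : 0 < 1 - x by rewrite subr_gt0.
  exists (Num.min d (Num.min x (1 - x))); split; first by rewrite !minr_gt0.
  move=> h; rewrite !lt_min => /and3P[hd hx hx1].
  have := Hd (x + h); rewrite (_ : x + h - x = h); last by ring.
  by apply=> //; move: hx hx1; rewrite !ltr_norml; lra.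
- apply/subspace_continuousP => x /=; rewrite in_itv /= => x01.
  apply/cvgrPdist_le => e e0; have [d [d0 Hd]] := antider_pcont (antiderZ v^*%C H) x01 e0.
  rewrite near_withinE; exists d => //= y; rewrite /ball /= distrC => yx; rewrite in_itv /= => y01.
  rewrite distrC; apply: le_trans (Hd y y01 yx).
  by rewrite /u -ReB cmod_Re.
move=> E; have c01' : 0 <= c <= 1 by move: c01; rewrite in_itv /= => /andP[a b]; rewrite !ltW.
rewrite subr0 mulr1 uE in E; have v0' : 0 < cmod v by rewrite cmod_gt0.
rewrite -(ler_pM2l v0') -expr2 E (le_trans (Re_le_cmod _))// cmodM cmod_conj.
by rewrite ler_wpM2l ?cmod_ge0// HM.
Qed.

Lemma antider_incr Phi Psi phi : antider Phi phi -> antider Psi phi ->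
  Phi 1 - Phi 0 = Psi 1 - Psi 0.
Proof.
move=> F G; apply/eqP; rewrite -subr_eq0 -cmod_eq0 eq_le cmod_ge0 andbT.
have := antider_le (antiderD F (antiderZ (-1) G)) (M := 0).
rewrite (_ : _ - (Phi 0 + _) = Phi 1 - Phi 0 - (Psi 1 - Psi 0)); last by ring.
by apply=> t _; rewrite mulN1r subrr cmod0.
Qed.

Let clamp (t : R) := Num.max 0 (Num.min t 1).
Let clamp01 t : 0 <= clamp t <= 1.
Proof. by rewrite /clamp le_max lexx /= ge_max ler01 ge_min lexx orbT. Qed.
Let clamp_id t : 0 <= t <= 1 -> clamp t = t.
Proof. by case/andP=> t0 t1; rewrite /clamp (min_idPl t1) (max_idPr t0). Qed.
Let clamp_dist t u : `|clamp u - clamp t| <= `|u - t|.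
Proof.
have /andP[? ?] : - `|u - t| <= u - t <= `|u - t| by rewrite -ler_norml.
rewrite /clamp ler_norml; case: (leP u 1) => ?; case: (leP t 1) => ?;
  case: (leP 0 u) => ?; case: (leP 0 t) => ?; rewrite ?(max_idPr (@ler01 R)); lra.
Qed.

(** The two components, extended to the line by clamping the parameter, have
    antiderivatives by the fundamental theorem for the Lebesgue integral. *)
Lemma antider_exists phi : pcont phi -> exists Phi, antider Phi phi.
Proof.
move=> H.
have real_case (g : R -> R) : (forall t e, 0 < e -> exists d : R, 0 < d /\
      forall u, `|u - t| < d -> `|g u - g t| <= e) ->
    exists G : R -> R, forall t, 0 <= t <= 1 -> is_derive t 1 G (g t).
  move=> Hg.
  have gc : continuous g.
    move=> t; apply/cvgrPdist_le => e /(Hg t) [d [d0 Hd]].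
    by exists d => //= u; rewrite /ball /= distrC => /Hd; rewrite distrC.
  exists (fun y => (\int[lebesgue_measure]_(t in [set` `[-1, y]]) g t)%R) => t /andP[t0 t1].
  have [| |||] := @continuous_FTC1_closed R g (-1) t 2.
  - by rewrite (le_lt_trans t1)// ltr1n.
  - apply: continuous_compact_integrable; first exact: segment_compact.
    by apply: continuous_subspaceT.
  - by rewrite (lt_le_trans _ t0)// oppr_lt0.
  - exact: gc.
  by move=> dG dGE; rewrite derive1E in dGE; exact: (DeriveDef dG dGE).
have part (p : R[i] -> R) : (forall z w, p z - p w = p (z - w)) ->
    (forall z, `|p z| <= cmod z) ->
    exists G : R -> R, forall t, 0 <= t <= 1 -> is_derive t 1 G (p (phi t)).
  move=> pB pN; have [t e e0|G HG] := real_case (fun t => p (phi (clamp t))).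
    have [d [d0 Hd]] := H _ (clamp01 t) e e0; exists d; split=> // u ut.
    rewrite pB (le_trans (pN _))// Hd//; exact: le_lt_trans (clamp_dist _ _) ut.
  by exists G => t t01; rewrite -{2}(clamp_id t01); exact: HG.
have [G1 H1] := part (@Re R) (fun z w => esym (ReB z w)) (@cmod_Re R).
have [G2 H2] := part (@Im R) (fun z w => esym (ImB z w)) (@cmod_Im R).
exists (fun t => Complex (G1 t) (G2 t)) => t t01 e e0.
have e20 : 0 < e / 2 by rewrite divr_gt0.
have /is_derive_epsP/(_ _ e20) [d1 [d10 D1]] := H1 t t01.
have /is_derive_epsP/(_ _ e20) [d2 [d20 D2]] := H2 t t01.
exists (Num.min d1 d2); split; first by rewrite minr_gt0.
move=> u u01; rewrite lt_min => /andP[/D1 + /D2]; rewrite subrKC => a b.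
rewrite (le_trans (cmod_le_ReIm _))// (splitr e) mulrDl !ReB !ImB ReZ ImZ /=.
exact: lerD.
Qed.

(** The common increment of all the antiderivatives ([antider_incr]); thus all
    properties of integrals reduce to properties of derivatives. *)
Definition cint phi : R[i] :=
  xget 0 [set I | exists Phi, antider Phi phi /\ I = Phi 1 - Phi 0].

Lemma cintE Phi phi : antider Phi phi -> cint phi = Phi 1 - Phi 0.
Proof.
move=> H; rewrite /cint; case: xgetP => [I _ [Psi [HP ->]]|/(_ (Phi 1 - Phi 0))].
  exact: antider_incr HP H.
by case; exists Phi.
Qed.

Lemma cint_ext phi psi : (forall t, 0 <= t <= 1 -> phi t = psi t) -> pcont phi ->
  cint phi = cint psi.
Proof.
move=> E /antider_exists[Phi H]; rewrite (cintE H) (@cintE Phi)//.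
exact: antider_ext H.
Qed.

Lemma cintD phi psi : pcont phi -> pcont psi ->
  cint (fun t => phi t + psi t) = cint phi + cint psi.
Proof.
move=> /antider_exists[F HF] /antider_exists[G HG].
by rewrite (cintE HF) (cintE HG) (cintE (antiderD HF HG)); ring.
Qed.

Lemma cintZ c phi : pcont phi -> cint (fun t => c * phi t) = c * cint phi.
Proof.
by move=> /antider_exists[F HF]; rewrite (cintE HF) (cintE (antiderZ c HF)); ring.
Qed.

Lemma cint_cst c : cint (fun=> c) = c.
Proof.
have H := antiderZ c antider_id.
rewrite (@cintE (fun t : R => c * t%:C%C)); first by rewrite mulr1 mulr0 subr0.
by apply: antider_ext H => // t _; rewrite mulr1.
Qed.

Lemma cint_le phi (M : R) : pcont phi -> (forall t, 0 <= t <= 1 -> cmod (phi t) <= M) ->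
  cmod (cint phi) <= M.
Proof. by move=> /antider_exists[F HF]; rewrite (cintE HF); exact: antider_le. Qed.

Lemma pcontD phi psi : pcont phi -> pcont psi -> pcont (fun t => phi t + psi t).
Proof.
move=> F G t t01 e e0; have e20 : 0 < e / 2 by rewrite divr_gt0.
have [d1 [d10 H1]] := F _ t01 _ e20; have [d2 [d20 H2]] := G _ t01 _ e20.
exists (Num.min d1 d2); split; first by rewrite minr_gt0.
move=> h h01; rewrite lt_min => /andP[hd1 hd2].
have -> : phi h + psi h - (phi t + psi t) = (phi h - phi t) + (psi h - psi t) by ring.
by rewrite (splitr e) (le_trans (cmodD _ _))// lerD ?H1 ?H2.
Qed.

Lemma pcont_comp (f : R[i] -> R[i]) phi :
  (forall t, 0 <= t <= 1 -> ccont f (phi t)) -> pcont phi -> pcont (fun t => f (phi t)).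
Proof.
move=> F G t t01 e e0; have [d [d0 H]] := F t t01 e e0.
have d2 : 0 < d / 2 by rewrite divr_gt0.
have [d' [d'0 H']] := G t t01 _ d2; exists d'; split=> // u u01 ut.
rewrite -(subrKC (phi t) (phi u)); apply: H; apply: le_lt_trans (H' u u01 ut) _.
by rewrite ltr_pdivrMr// mulr_natr mulr2n ltrDl.
Qed.

Lemma pcont_cst c : pcont (fun=> c).
Proof. exact: antider_pcont (antider_cst c). Qed.

(** By polarisation, from the continuity of squaring. *)
Lemma pcontM phi psi : pcont phi -> pcont psi -> pcont (fun t => phi t * psi t).
Proof.
have sq phi' : pcont phi' -> pcont (fun t => phi' t * phi' t).
  by move=> H; apply: (@pcont_comp (fun x => x * x)) => // t _; apply: ccontM; exact: ccont_id.
have sc c phi' : pcont phi' -> pcont (fun t => c * phi' t).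
  by move=> H; apply: (@pcont_comp (fun x => c * x)) => // t _; apply: ccontZ; exact: ccont_id.
move=> F G; have H1 := sc 4^-1 _ (sq _ (pcontD F G)).
have H2 := sc (- 4^-1) _ (sq _ (pcontD F (sc (-1) _ G))).
move=> t t01 e e0; have [d [d0 H]] := pcontD H1 H2 t01 e0.
exists d; split=> // u u01 ut; have := H u u01 ut; congr (cmod _ <= e).
by field.
Qed.

End path_integral.

(** * Goursat's lemma and primitives on discs *)

Section goursat.
Variable R : realType.
Implicit Types (f g F : R[i] -> R[i]) (a b c s w z : R[i]) (K : set R[i]).

Definition segpt a b (t : R) : R[i] := a + t%:C%C * (b - a).
Definition cseg f a b : R[i] := cint (fun t => f (segpt a b t)) * (b - a).
Definition ccont_seg f a b := forall t : R, 0 <= t <= 1 -> ccont f (segpt a b t).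

Lemma segpt0 a b : segpt a b 0 = a. Proof. by rewrite /segpt mul0r addr0. Qed.
Lemma segpt1 a b : segpt a b 1 = b. Proof. by rewrite /segpt mul1r subrKC. Qed.

Lemma antider_segpt a b : antider (segpt a b) (fun=> b - a).
Proof.
have H := antiderD (antider_cst a) (antiderZ (b - a) (@antider_id R)).
apply: antider_ext H => t _.
  by rewrite /segpt mulrC.
by rewrite add0r mulr1.
Qed.

Lemma pcont_seg f a b : ccont_seg f a b -> pcont (fun t => f (segpt a b t)).
Proof. by move=> H; apply: pcont_comp H (antider_pcont (antider_segpt a b)). Qed.

Lemma cseg_ftc F f a b : ccont_seg f a b ->
  (forall t : R, 0 <= t <= 1 -> cder F (segpt a b t) (f (segpt a b t))) ->
  cseg f a b = F b - F a.
Proof.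
move=> Hc HF; have := cintE (antider_comp HF (antider_segpt a b)).
rewrite segpt0 segpt1 => <-; rewrite /cseg mulrC -cintZ; last exact: pcont_seg.
apply: cint_ext => [t _|]; first by rewrite mulrC.
by apply: pcontM; [exact: pcont_cst|exact: pcont_seg].
Qed.

Lemma csegD f g a b : ccont_seg f a b -> ccont_seg g a b ->
  cseg (fun s => f s + g s) a b = cseg f a b + cseg g a b.
Proof.
move=> Hf Hg; by rewrite /cseg -mulrDl -cintD//; exact: pcont_seg.
Qed.

Lemma cseg_le f a b (M : R) : ccont_seg f a b ->
  (forall t : R, 0 <= t <= 1 -> cmod (f (segpt a b t)) <= M) ->
  cmod (cseg f a b) <= M * cmod (b - a).
Proof.
by move=> Hf HM; rewrite /cseg cmodM ler_wpM2r ?cmod_ge0// cint_le//; exact: pcont_seg.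
Qed.

Lemma cseg_point f a : cseg f a a = 0.
Proof. by rewrite /cseg subrr mulr0. Qed.

(** Substitution of [1 - t] for [t] in an antiderivative. *)
Lemma cseg_rev f a b : ccont_seg f a b -> cseg f b a = - cseg f a b.
Proof.
move=> Hf; have [Phi HP] := antider_exists (pcont_seg Hf).
have h01 (t : R) : 0 <= t <= 1 -> 0 <= 1 + (-1) * t <= 1 by lra.
have E t : segpt a b (1 + (-1) * t) = segpt b a t.
  by rewrite /segpt RtoCD RtoCM RtoCN RtoC1; ring.
have := antiderZ (-1) (antider_affine h01 HP); rewrite /cseg (cintE HP) => H.
rewrite (@cintE _ (fun t => -1 * Phi (1 + -1 * t))).
  by rewrite mulr0 addr0 mulr1 subrr; ring.
by apply: antider_ext H => // t _; rewrite E RtoCN RtoC1; ring.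
Qed.

(** Both halves have rescaled copies of one antiderivative. *)
Lemma cseg_split f a b : ccont_seg f a b ->
  cseg f a b = cseg f a ((a + b) / 2) + cseg f ((a + b) / 2) b.
Proof.
move=> Hf; have [Phi HP] := antider_exists (pcont_seg Hf).
have h1 (t : R) : 0 <= t <= 1 -> 0 <= 0 + 2^-1 * t <= 1 by lra.
have h2 (t : R) : 0 <= t <= 1 -> 0 <= 2^-1 + 2^-1 * t <= 1 by lra.
have C2 : (2^-1 : R)%:C%C = 2^-1 :> R[i] by rewrite RtoCV RtoC_nat.
have H1 := antiderZ 2 (antider_affine h1 HP).
have H2 := antiderZ 2 (antider_affine h2 HP).
rewrite /cseg (cintE HP).
rewrite (@cintE _ (fun t => 2 * Phi (0 + 2^-1 * t)) (fun t => f (segpt a ((a + b) / 2) t))).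
  rewrite (@cintE _ (fun t => 2 * Phi (2^-1 + 2^-1 * t)) (fun t => f (segpt ((a + b) / 2) b t))).
    have e1 : (2^-1 : R) + 2^-1 = 1 by field.
    by rewrite !mulr1 !mulr0 !add0r !addr0 e1; field.
  apply: antider_ext H2 => // t _; rewrite C2 mulVKf ?pnatr_eq0//.
  by congr (f _); rewrite /segpt RtoCD RtoCM C2; field.
apply: antider_ext H1 => // t _; rewrite C2 mulVKf ?pnatr_eq0//.
by congr (f _); rewrite /segpt RtoCD RtoCM C2; field.
Qed.

Definition tri f a b c := cseg f a b + cseg f b c + cseg f c a.

Definition cconvex K := forall a b (t : R), K a -> K b -> 0 <= t <= 1 -> K (segpt a b t).
Definition cclosed K := forall p,
  (forall e : R, 0 < e -> exists q, K q /\ cmod (p - q) <= e) -> K p.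

Lemma midpoint_segpt a b : (a + b) / 2 = segpt a b 2^-1.
Proof. by rewrite /segpt RtoCV RtoC_nat; field. Qed.

Lemma cconvex_mid K a b : cconvex K -> K a -> K b -> K ((a + b) / 2).
Proof. by move=> H Ka Kb; rewrite midpoint_segpt; apply: H => //; lra. Qed.

Lemma tri_split K f a b c : cconvex K -> (forall s, K s -> ccont f s) ->
  K a -> K b -> K c ->
  tri f a b c = tri f a ((a + b) / 2) ((c + a) / 2) + tri f b ((b + c) / 2) ((a + b) / 2)
    + tri f c ((c + a) / 2) ((b + c) / 2)
    + tri f ((a + b) / 2) ((b + c) / 2) ((c + a) / 2).
Proof.
move=> Kx Hf Ka Kb Kc.
have cs x y : K x -> K y -> ccont_seg f x y by move=> Kx' Ky t t01; apply: Hf; exact: Kx.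
have Kab := cconvex_mid Kx Ka Kb; have Kbc := cconvex_mid Kx Kb Kc.
have Kca := cconvex_mid Kx Kc Ka.
rewrite /tri (cseg_split (cs _ _ Ka Kb)) (cseg_split (cs _ _ Kb Kc)) (cseg_split (cs _ _ Kc Ka)).
rewrite (cseg_rev (cs _ _ Kab Kbc)) (cseg_rev (cs _ _ Kbc Kca)) (cseg_rev (cs _ _ Kca Kab)).
ring.
Qed.

Definition tri_of f (T : R[i] * R[i] * R[i]) := tri f T.1.1 T.1.2 T.2.
Definition perim (T : R[i] * R[i] * R[i]) : R :=
  cmod (T.1.2 - T.1.1) + cmod (T.2 - T.1.2) + cmod (T.1.1 - T.2).
Definition inK K (T : R[i] * R[i] * R[i]) := [/\ K T.1.1, K T.1.2 & K T.2].

(** By the triangle inequality, one of the four half-size triangles carries a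
    quarter of the integral. *)
Lemma tri_step K f T : cconvex K -> (forall s, K s -> ccont f s) -> inK K T ->
  exists T', [/\ inK K T', perim T' = perim T / 2,
    cmod (T'.1.1 - T.1.1) <= perim T & cmod (tri_of f T) <= 4 * cmod (tri_of f T')].
Proof.
case: T => [[a b] c] Kx Hf [/= Ka Kb Kc].
have Kab := cconvex_mid Kx Ka Kb; have Kbc := cconvex_mid Kx Kb Kc.
have Kca := cconvex_mid Kx Kc Ka.
have half x : cmod (x / 2) = cmod x / 2.
  by rewrite cmodM cmodV cmod_nat.
have [ab bc ca] : [/\ 0 <= cmod (b - a), 0 <= cmod (c - b) & 0 <= cmod (a - c)].
  by rewrite !cmod_ge0.
have E := tri_split Kx Hf Ka Kb Kc.
have per x y z : cmod (y - x) + cmod (z - y) + cmod (x - z) =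
      (cmod (b - a) + cmod (c - b) + cmod (a - c)) / 2 ->
    perim (x, y, z) = perim (a, b, c) / 2 by [].
set T1 := (a, (a + b) / 2, (c + a) / 2); set T2 := (b, (b + c) / 2, (a + b) / 2).
set T3 := (c, (c + a) / 2, (b + c) / 2); set T4 := ((a + b) / 2, (b + c) / 2, (c + a) / 2).
have E' : tri_of f (a, b, c) = tri_of f T1 + tri_of f T2 + tri_of f T3 + tri_of f T4 by [].
have h1 x y : cmod ((x + y) / 2 - x) = cmod (y - x) / 2 by rewrite -half; congr cmod; field.
have h2 x y : cmod ((x + y) / 2 - y) = cmod (y - x) / 2.
  by rewrite (cmod_distC y) -half; congr cmod; field.
have h3 x y z : cmod ((y + z) / 2 - (x + y) / 2) = cmod (x - z) / 2.
  by rewrite (cmod_distC x) -half; congr cmod; field.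
have P1 : perim T1 = perim (a, b, c) / 2.
  by apply: per; rewrite (cmod_distC a (_ / 2)) h1 h2 (cmod_distC _ ((a + b) / 2)) h3; field.
have P2 : perim T2 = perim (a, b, c) / 2.
  by apply: per; rewrite (cmod_distC b (_ / 2)) h1 h2 (cmod_distC _ ((b + c) / 2)) h3; field.
have P3 : perim T3 = perim (a, b, c) / 2.
  by apply: per; rewrite (cmod_distC c (_ / 2)) h1 h2 (cmod_distC _ ((c + a) / 2)) h3; field.
have P4 : perim T4 = perim (a, b, c) / 2.
  by apply: per; rewrite !h3; field.
have D1 : cmod (T1.1.1 - a) <= perim (a, b, c).
  by rewrite subrr cmod0 /perim /= !addr_ge0.
have D2 : cmod (T2.1.1 - a) <= perim (a, b, c) by rewrite /perim /=; lra.
have D3 : cmod (T3.1.1 - a) <= perim (a, b, c) by rewrite /perim /= cmod_distC; lra.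
have D4 : cmod (T4.1.1 - a) <= perim (a, b, c).
  by rewrite /perim /= (_ : _ - a = (b - a) / 2) ?half; [lra|field].
have := cmodD (tri_of f T1 + tri_of f T2 + tri_of f T3) (tri_of f T4).
have := cmodD (tri_of f T1 + tri_of f T2) (tri_of f T3).
have := cmodD (tri_of f T1) (tri_of f T2).
rewrite -E'.
have [g1|g1] := leP (cmod (tri_of f (a, b, c))) (4 * cmod (tri_of f T1)); first by exists T1.
have [g2|g2] := leP (cmod (tri_of f (a, b, c))) (4 * cmod (tri_of f T2)); first by exists T2.
have [g3|g3] := leP (cmod (tri_of f (a, b, c))) (4 * cmod (tri_of f T3)); first by exists T3.
by move=> *; exists T4; split=> //; move: g1 g2 g3; lra.
Qed.

(** Nested intervals: adding and subtracting [2 L / 2 ^ n] makes the sequence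
    monotone in both directions. *)
Lemma dyadic_cauchy (u : nat -> R) (L : R) :
  (forall n, `|u n.+1 - u n| <= L / 2 ^+ n) ->
  exists l, forall n, `|u n - l| <= 2 * L / 2 ^+ n.
Proof.
move=> H; pose v n := u n - 2 * L / 2 ^+ n; pose w n := u n + 2 * L / 2 ^+ n.
have eS n : 2 * L / 2 ^+ n = 2 * (2 * L / 2 ^+ n.+1).
  by rewrite exprS; field; rewrite expf_neq0 // pnatr_eq0.
have eL n : L / 2 ^+ n = 2 * L / 2 ^+ n.+1.
  by rewrite exprS; field; rewrite expf_neq0 // pnatr_eq0.
have vS n : v n <= v n.+1.
  by have := eS n; have := eL n; have := H n; rewrite ler_norml /v; lra.
have wS n : w n.+1 <= w n.
  by have := eS n; have := eL n; have := H n; rewrite ler_norml /w; lra.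
have L0 n : 0 <= 2 * L / 2 ^+ n.
  by rewrite -mulrA mulr_ge0// (le_trans _ (H n)).
have vw m n : v m <= w n.
  have vm k : v m <= v (m + k)%N by elim: k => [|k IH]; rewrite ?addn0// addnS (le_trans IH).
  have wn k : w (n + k)%N <= w n by elim: k => [|k IH]; rewrite ?addn0// addnS (le_trans _ IH).
  apply: le_trans (vm n) _; rewrite addnC; apply: le_trans (wn m).
  by rewrite /v /w; have := L0 (n + m)%N; lra.
have hs : has_sup (range v).
  by split; [exists (v 0%N), 0%N | exists (w 0%N) => _ [n _ <-]].
exists (sup (range v)) => n.
have h1 : v n <= sup (range v) by apply: ub_le_sup; [exact: hs.2|exists n].
have h2 : sup (range v) <= w n by apply: ge_sup => [|_ [m _ <-]//]; exact: hs.1.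
by rewrite ler_norml; move: h1 h2; rewrite /v /w; lra.
Qed.

Lemma natr_large (x : R) : exists N : nat, forall n, (N <= n)%N -> x <= n%:R.
Proof.
exists (Num.bound `|x|) => n Nn; apply: le_trans (ler_norm _) _.
apply: le_trans (ltW (archi_boundP (normr_ge0 x))) _.
by rewrite ler_nat.
Qed.

Lemma dyadic_small (L e : R) : 0 < e -> exists n : nat, L / 2 ^+ n < e.
Proof.
move=> e0; have [N HN] := natr_large (L / e); exists N.
rewrite ltr_pdivrMr ?exprn_gt0// mulrC -ltr_pdivrMr//.
by rewrite (le_lt_trans (HN N (leqnn N)))// -natrX ltr_nat ltn_expl.
Qed.

(** Nested triangles shrink to a point [p] of [K].  Up to [o (|s - p|)], [f] is
    affine there, and affine functions have primitives; a triangle of perimeter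
    [L / 2 ^ n] therefore contributes [o (4 ^- n)], while at least [4 ^- n] of
    the initial integral was kept.  Degenerate triangles are not excluded. *)
Lemma tri_goursat K f a b c : cconvex K -> cclosed K -> (forall s, K s -> cdiff f s) ->
  K a -> K b -> K c -> tri f a b c = 0.
Proof.
move=> Kx Kc Hd Ka Kb Kcc.
have Hc s : K s -> ccont f s by move=> /Hd/cdiff_cont.
have next (T : {T | inK K T}) : exists T' : {T' | inK K T'},
    [/\ perim (sval T') = perim (sval T) / 2,
    cmod ((sval T').1.1 - (sval T).1.1) <= perim (sval T)
    & cmod (tri_of f (sval T)) <= 4 * cmod (tri_of f (sval T'))].
  have [T' [KT' h1 h2 h3]] := tri_step Kx Hc (svalP T).
  by exists (exist _ T' KT').
have [st Hst] := choice next.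
pose T0 : {T | inK K T} := exist _ (a, b, c) (And3 Ka Kb Kcc).
pose T n := sval (iter n st T0); set L := perim (a, b, c).
have KT n : inK K (T n) by exact: svalP.
have PT n : perim (T n) = L / 2 ^+ n.
  elim: n => [|n IH]; first by rewrite expr0 divr1.
  rewrite /T iterS; have [-> _ _] := Hst (iter n st T0); rewrite -/(T n) IH exprS.
  by field; rewrite expf_neq0 // pnatr_eq0.
have AT n : cmod ((T n.+1).1.1 - (T n).1.1) <= L / 2 ^+ n.
  by rewrite -PT /T iterS; have [_ + _] := Hst (iter n st T0).
have IT n : cmod (tri f a b c) <= 4 ^+ n * cmod (tri_of f (T n)).
  elim: n => [|n IH]; first by rewrite expr0 mul1r.
  apply: le_trans IH _; rewrite exprSr -mulrA ler_wpM2l ?exprn_ge0//.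
  by rewrite /T iterS; have [_ _ +] := Hst (iter n st T0).
have reT n : `|Re (T n.+1).1.1 - Re (T n).1.1| <= L / 2 ^+ n.
  by rewrite -ReB (le_trans (cmod_Re _) (AT n)).
have imT n : `|Im (T n.+1).1.1 - Im (T n).1.1| <= L / 2 ^+ n.
  by rewrite -ImB (le_trans (cmod_Im _) (AT n)).
have [p1 Hp1] := @dyadic_cauchy (fun n => Re (T n).1.1) L reT.
have [p2 Hp2] := @dyadic_cauchy (fun n => Im (T n).1.1) L imT.
pose p := Complex p1 p2.
have pT n : cmod ((T n).1.1 - p) <= 4 * L / 2 ^+ n.
  rewrite (le_trans (cmod_le_ReIm _))// ReB ImB (le_trans (lerD (Hp1 n) (Hp2 n)))//.
  by rewrite le_eqVlt; apply/orP; left; apply/eqP; field; rewrite expf_neq0 // pnatr_eq0.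
have Kp : K p.
  apply: Kc => e e0; have [n Hn] := dyadic_small (4 * L) e0.
  by exists (T n).1.1; split; [have [] := KT n | rewrite cmod_distC (le_trans (pT n))// ltW].
have [l Hl] := Hd p Kp.
apply/eqP; rewrite -cmod_eq0 eq_le cmod_ge0 andbT.
have L0 : 0 <= L by rewrite /L /perim !addr_ge0 ?cmod_ge0.
apply/ler_addgt0Pr => e e0; rewrite add0r.
(* All points of [T n] are within [5 * L / 2 ^+ n] of [p]: [4 * L / 2 ^+ n] for
   the first vertex, and the perimeter for the others. *)
have e1 : 0 < e / (5 * L ^+ 2 + 1).
  by rewrite divr_gt0// ltr_wpDl// mulr_ge0// exprn_ge0.
have [d [d0 Hdd]] := Hl _ e1; have [n Hn] := dyadic_small (5 * L) d0.
apply: le_trans (IT n) _.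
have [] := KT n; have := PT n; have := pT n; rewrite /tri_of /perim.
case: (T n) => [[x y] z] /= px per Kx1 Ky Kz.
set r := 5 * L / 2 ^+ n in Hn.
have [xy yz zx] : [/\ 0 <= cmod (y - x), 0 <= cmod (z - y) & 0 <= cmod (x - z)].
  by rewrite !cmod_ge0.
have rE : r = 4 * L / 2 ^+ n + L / 2 ^+ n.
  by rewrite /r; field; rewrite expf_neq0 // pnatr_eq0.
pose aff s := f p + (s - p) * l.
pose Aff s := f p * s + (s - p) ^+ 2 * (l / 2).
have cderAff s : cder Aff s (aff s).
  have h1 := cderZ (f p) (cder_id s).
  have h2 := cderB (cder_id s) (cder_cst p s).
  have := cderD h1 (cderM (cderM h2 h2) (cder_cst (l / 2) s)).
  rewrite (_ : _ + (_ + _) = aff s); last by rewrite /aff; field.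
  by apply: cder_ext => u; rewrite /Aff expr2.
have caff s : ccont aff s.
  apply: ccontD; first exact: ccont_cst.
  apply: ccontM; last exact: ccont_cst.
  by apply: ccontD; [exact: ccont_id|exact: ccont_cst].
pose g s := f s + (-1) * aff s.
have cg s : K s -> ccont g s by move=> Ks; apply: ccontD; [exact: Hc|exact: ccontZ].
have part u v : K u -> K v -> (forall t : R, 0 <= t <= 1 -> cmod (segpt u v t - x) <= L / 2 ^+ n) ->
    cmod (cseg f u v - (Aff v - Aff u)) <= e / (5 * L ^+ 2 + 1) * r * cmod (v - u).
  move=> Ku Kv uvx.
  rewrite -(@cseg_ftc Aff aff u v (fun t _ => caff _) (fun t _ => cderAff _)).
  have -> : cseg f u v = cseg aff u v + cseg g u v.
    rewrite -csegD; [|by move=> t _; exact: caff|by move=> t t01; apply: cg; exact: Kx].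
    by congr (cseg _ u v); apply/funext => s; rewrite /g mulN1r subrKC.
  rewrite addrAC subrr add0r; apply: cseg_le => [t t01|t t01]; first by apply: cg; exact: Kx.
  have ptp : cmod (segpt u v t - p) <= r.
    rewrite (_ : _ - p = (segpt u v t - x) + (x - p)); last by ring.
    by rewrite (le_trans (cmodD _ _))// rE addrC lerD// uvx.
  have := Hdd (segpt u v t - p) (le_lt_trans ptp Hn); rewrite subrKC /g mulN1r /aff opprD addrA.
  by move=> /le_trans; apply; rewrite ler_wpM2l// ltW.
have t01m (t : R) s : 0 <= t <= 1 -> cmod (t%:C%C * s) <= cmod s.
  by move=> /andP[t0 t1]; rewrite cmodM cmod_real ger0_norm// ler_piMl ?cmod_ge0.
have := part x y Kx1 Ky; have := part y z Ky Kz; have := part z x Kz Kx1.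
move=> /(_ _) p3 /(_ _) p2' /(_ _) p1'.
have {}p1' : cmod (cseg f x y - (Aff y - Aff x)) <= e / (5 * L ^+ 2 + 1) * r * cmod (y - x).
  apply: p1' => t t01; rewrite /segpt (_ : _ - x = t%:C%C * (y - x)); last by ring.
  by rewrite (le_trans (t01m _ _ t01))// -per; lra.
have {}p2' : cmod (cseg f y z - (Aff z - Aff y)) <= e / (5 * L ^+ 2 + 1) * r * cmod (z - y).
  apply: p2' => t t01; rewrite /segpt (_ : _ - x = (y - x) + t%:C%C * (z - y)); last by ring.
  rewrite (le_trans (cmodD _ _))// (le_trans (lerD (lexx _) (t01m _ _ t01)))// -per; lra.
have {}p3 : cmod (cseg f z x - (Aff x - Aff z)) <= e / (5 * L ^+ 2 + 1) * r * cmod (x - z).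
  apply: p3 => t t01; rewrite /segpt (_ : _ - x = (1 - t)%:C%C * (z - x)).
    have t01' : 0 <= 1 - t <= 1 by lra.
    by rewrite (le_trans (t01m _ _ t01'))// -per cmod_distC; lra.
  by rewrite RtoCB; ring.
have E : tri f x y z = (cseg f x y - (Aff y - Aff x)) + (cseg f y z - (Aff z - Aff y))
    + (cseg f z x - (Aff x - Aff z)) by rewrite /tri; ring.
have bound : cmod (tri f x y z) <= e / (5 * L ^+ 2 + 1) * r * (L / 2 ^+ n).
  rewrite E (le_trans (cmodD _ _))// -per mulrDr mulrDr lerD//.
  by rewrite (le_trans (cmodD _ _))// lerD.
apply: le_trans (ler_wpM2l _ bound) _; first by rewrite exprn_ge0.
have -> : 4 ^+ n * (e / (5 * L ^+ 2 + 1) * r * (L / 2 ^+ n)) = e * (5 * L ^+ 2 / (5 * L ^+ 2 + 1)).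
  rewrite /r (_ : 4 = 2 ^+ 2 :> R); last by rewrite -natrX.
  rewrite -exprM mulnC exprM; field.
  by rewrite expf_neq0 ?pnatr_eq0 //= gt_eqF// ltr_wpDl// mulr_ge0// exprn_ge0.
rewrite ler_piMr ?(ltW e0)// ler_pdivrMr ?mul1r ?lerDl// ltr_wpDl// mulr_ge0// exprn_ge0//.
Qed.

End goursat.

Section primitive.
Variable R : realType.
Implicit Types (f g F : R[i] -> R[i]) (a b c s w z : R[i]) (K : set R[i]).

Lemma cconvex_ball c (r : R) : cconvex [set s | cmod (s - c) <= r].
Proof.
move=> a b t /= ha hb /andP[t0 t1].
rewrite (_ : segpt a b t - c = (1 - t)%:C%C * (a - c) + t%:C%C * (b - c)).
  rewrite (le_trans (cmodD _ _))// !cmodM !cmod_real !ger0_norm ?subr_ge0//.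
  have := cmod_ge0 (a - c); have := cmod_ge0 (b - c); nra.
by rewrite /segpt RtoCB RtoC1; ring.
Qed.

Lemma cclosed_ball c (r : R) : cclosed [set s | cmod (s - c) <= r].
Proof.
move=> p H /=; apply/ler_addgt0Pr => e /H [q [/= qr pq]].
rewrite (_ : p - c = (q - c) + (p - q)); last by ring.
by rewrite (le_trans (cmodD _ _))// lerD.
Qed.

Lemma cconvex_halfplane c w (x : R) : cconvex [set s | x <= Re ((s - c) * w)].
Proof.
move=> a b t /= ha hb /andP[t0 t1].
rewrite (_ : (segpt a b t - c) * w = (1 - t)%:C%C * ((a - c) * w) + t%:C%C * ((b - c) * w)).
  by rewrite ReD !ReZ; nra.
by rewrite /segpt RtoCB RtoC1; ring.
Qed.

Lemma cclosed_halfplane c w (x : R) : cclosed [set s | x <= Re ((s - c) * w)].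
Proof.
move=> p H /=; apply/ler_addgt0Pr => e e0.
have w1 : 0 < cmod w + 1 by rewrite ltr_wpDl ?cmod_ge0.
have [q [/= qx pq]] := H _ (divr_gt0 e0 w1).
rewrite (_ : (q - c) * w = (p - c) * w - (p - q) * w) in qx; last by ring.
rewrite ReB in qx; have := cmod_Re ((p - q) * w); rewrite ler_norml cmodM.
have : cmod (p - q) * cmod w <= e.
  rewrite (le_trans (ler_wpM2r (cmod_ge0 w) pq))// mulrAC ler_pdivrMr//.
  by rewrite ler_wpM2l ?(ltW e0)// lerDl.
move: qx; set A := Re _; set B := Re _; lra.
Qed.

Lemma cconvexI K K' : cconvex K -> cconvex K' -> cconvex (K `&` K').
Proof. by move=> H H' a b t [? ?] [? ?] t01; split; [exact: H|exact: H']. Qed.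

Lemma cclosedI K K' : cclosed K -> cclosed K' -> cclosed (K `&` K').
Proof.
move=> H H' p Hp; split; [apply: H|apply: H'] => e /Hp [q [[? ?] ?]]; by exists q.
Qed.

Section exceptional_point.
Variables (f : R[i] -> R[i]) (z0 : R[i]) (r : R).
Hypothesis z0r : cmod z0 < r.
Hypothesis f_cont : forall s, cmod s < r -> ccont f s.
Hypothesis f_diff : forall s, cmod s < r -> s != z0 -> cdiff f s.

Let seg_cont a b : cmod a < r -> cmod b < r -> ccont_seg f a b.
Proof.
move=> ar br t t01; apply: f_cont.
have := @cconvex_ball 0 (Num.max (cmod a) (cmod b)) a b t.
rewrite /= !subr0 !le_max !lexx orbT /= => /(_ isT isT t01).
by move=> /orP[]/le_lt_trans; apply.
Qed.

(** For [w] close to [z], three of the four half-size triangles lie in a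
    half-plane that avoids [z0]; only the one at the vertex [z0] remains. *)
Lemma tri_corner z w : cmod z < r -> cmod w < r -> z != z0 ->
  cmod (w - z) <= cmod (z - z0) / 2 ->
  tri f z0 z w = tri f z0 ((z0 + z) / 2) ((w + z0) / 2).
Proof.
move=> zr wr zz0 wz.
pose rho := Num.max (cmod z0) (Num.max (cmod z) (cmod w)).
have rho_r : rho < r by rewrite /rho !gt_max z0r zr wr.
pose B := [set s | cmod (s - 0) <= rho].
have Bx : cconvex B := @cconvex_ball 0 rho.
have [B0 Bz Bw] : [/\ B z0, B z & B w] by rewrite /B /= !subr0 /rho !le_max !lexx /= !orbT.
have Bc s : B s -> ccont f s by rewrite /B /= subr0 => sr; apply: f_cont; exact: le_lt_trans rho_r.
pose H := [set s | cmod (z - z0) ^+ 2 / 4 <= Re ((s - z0) * (z - z0)^*%C)].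
have zz : 0 < cmod (z - z0) by rewrite cmod_gt0 subr_eq0.
have Kx : cconvex (B `&` H) by apply: cconvexI => //; exact: cconvex_halfplane.
have Kc : cclosed (B `&` H).
  by apply: cclosedI; [exact: cclosed_ball|exact: cclosed_halfplane].
have Kd s : (B `&` H) s -> cdiff f s.
  case=> Bs Hs; apply: f_diff.
    by move: Bs; rewrite /B /= subr0 => /le_lt_trans; apply.
  apply: contraTneq Hs => ->; rewrite /H /= subrr mul0r /= -ltNge.
  by rewrite divr_gt0// exprn_gt0.
have Rz : Re ((z - z0) * (z - z0)^*%C) = cmod (z - z0) ^+ 2 by rewrite mul_conj_cmod.
have Rw : cmod (z - z0) ^+ 2 / 2 <= Re ((w - z0) * (z - z0)^*%C).
  rewrite (_ : w - z0 = (z - z0) + (w - z)); last by ring.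
  rewrite mulrDl ReD Rz; have := cmod_Re ((w - z) * (z - z0)^*%C).
  rewrite ler_norml cmodM cmod_conj => /andP[h _].
  have := ler_wpM2r (ltW zz) wz; rewrite mulrAC -expr2.
  by move: h; set A := Re _; lra.
have C2 (x : R[i]) : Re (x / 2) = Re x / 2.
  by rewrite (_ : x / 2 = (2^-1)%:C%C * x) ?ReZ 1?mulrC// RtoCV RtoC_nat mulrC.
have sq0 : 0 <= cmod (z - z0) ^+ 2 by rewrite exprn_ge0// ltW.
have Hz : H z by rewrite /H /= Rz; lra.
have Hw : H w by rewrite /H /=; lra.
have Hm1 : H ((z0 + z) / 2).
  rewrite /H /= (_ : ((z0 + z) / 2 - z0) * _ = (z - z0) * (z - z0)^*%C / 2); last by field.
  by rewrite C2 Rz; lra.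
have Hm2 : H ((w + z0) / 2).
  rewrite /H /= (_ : ((w + z0) / 2 - z0) * _ = (w - z0) * (z - z0)^*%C / 2); last by field.
  by rewrite C2; lra.
have Kz : (B `&` H) z by [].
have Kw : (B `&` H) w by [].
have K1 : (B `&` H) ((z0 + z) / 2) by split=> //; exact: cconvex_mid.
have K2 : (B `&` H) ((w + z0) / 2) by split=> //; exact: cconvex_mid.
have K3 : (B `&` H) ((z + w) / 2) by exact: cconvex_mid.
rewrite (tri_split Bx Bc B0 Bz Bw) (tri_goursat Kx Kc Kd Kz K3 K1).
by rewrite (tri_goursat Kx Kc Kd Kw K2 K3) (tri_goursat Kx Kc Kd K1 K3 K2) !addr0.
Qed.

(** Near the exceptional point only continuity is available; halving towards
    it leaves the integral unchanged while the perimeter tends to 0. *)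
Lemma tri_exceptional z w : cmod z < r -> cmod w < r -> z != z0 ->
  cmod (w - z) <= cmod (z - z0) / 2 -> tri f z0 z w = 0.
Proof.
move=> zr wr zz0 wz.
pose p x (n : nat) : R[i] := z0 + (x - z0) / 2 ^+ n.
have c2 (n : nat) : (2 : R[i]) ^+ n != 0 by rewrite expf_neq0 // pnatr_eq0.
have p2 (n : nat) : cmod ((2 : R[i]) ^+ n) = 2 ^+ n by rewrite cmodX cmod_nat.
have pB x n : cmod x < r -> cmod (p x n) < r.
  move=> xr; have := @cconvex_ball 0 (Num.max (cmod z0) (cmod x)) z0 x (2 ^- n).
  rewrite /= !subr0 !le_max !lexx orbT /= => /(_ isT isT).
  rewrite (_ : segpt _ _ _ = p x n); last first.
    by rewrite /segpt /p RtoCV RtoCX RtoC_nat mulrC.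
  have -> : 0 <= (2 : R) ^- n <= 1 by rewrite invr_ge0 exprn_ge0//= invf_le1 ?exprn_gt0// exprn_ege1// ler1n.
  by move=> /(_ isT) /orP[]/le_lt_trans; apply.
have E n : tri f z0 z w = tri f z0 (p z n) (p w n).
  elim: n => [|n ->]; first by rewrite /p !expr0 !divr1 !subrKC.
  rewrite tri_corner ?pB//.
  - by congr (tri f z0 _ _); rewrite /p exprS; field; rewrite c2.
  - by rewrite -subr_eq0 /p addrAC subrr add0r mulf_neq0 ?invr_neq0// subr_eq0.
  have -> : p w n - p z n = (w - z) / 2 ^+ n by rewrite /p; field.
  have -> : p z n - z0 = (z - z0) / 2 ^+ n by rewrite /p; field.
  by rewrite !cmodM cmodV p2 mulrAC ler_wpM2r// invr_ge0 exprn_ge0.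
apply/eqP; rewrite -cmod_eq0 eq_le cmod_ge0 andbT.
apply/ler_addgt0Pr => e e0; rewrite add0r.
have [d [d0 Hd]] := f_cont z0r ltr01.
set M := cmod (f z0) + 1; set L := cmod (z - z0) + cmod (w - z0).
have M0 : 0 < M by rewrite ltr_wpDl ?cmod_ge0.
have L0 : 0 <= L by rewrite addr_ge0 ?cmod_ge0.
have [n Hn] := @dyadic_small R (4 * L) (Num.min d (e / M)) (minr_gt0 d0 (divr_gt0 e0 M0)).
move: Hn; rewrite lt_min => /andP[Hn1 Hn2].
rewrite (E n).
have n2 : 0 < (2 : R) ^+ n by rewrite exprn_gt0.
have pz x : cmod (p x n - z0) = cmod (x - z0) / 2 ^+ n.
  by rewrite /p addrAC subrr add0r cmodM cmodV p2.
pose B := [set s | cmod (s - z0) <= L / 2 ^+ n].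
have Bx : cconvex B by exact: cconvex_ball.
have B0 : B z0 by rewrite /B /= subrr cmod0 divr_ge0// ltW.
have Bz : B (p z n) by rewrite /B /= pz ler_wpM2r ?invr_ge0 ?(ltW n2)// lerDl cmod_ge0.
have Bw : B (p w n) by rewrite /B /= pz ler_wpM2r ?invr_ge0 ?(ltW n2)// lerDr cmod_ge0.
have Bd a : B a -> cmod (f a) <= M.
  rewrite /B /= => aL; rewrite -(subrKC z0 a) -[f _](subrK (f z0)) (le_trans (cmodD _ _))//.
  rewrite /M addrC lerD2l; apply: Hd; apply: le_lt_trans aL _; apply: le_lt_trans Hn1.
  by rewrite ler_wpM2r ?invr_ge0 ?(ltW n2)//; lra.
have sd a b : B a -> B b -> cmod a < r -> cmod b < r -> cmod (cseg f a b) <= M * cmod (b - a).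
  move=> Ba Bb ar br; apply: cseg_le; first exact: seg_cont.
  by move=> t t01; apply: Bd; exact: Bx.
rewrite /tri (le_trans (cmodD _ _))//.
have h1 := sd _ _ B0 Bz z0r (pB _ n zr); have h2 := sd _ _ Bz Bw (pB _ n zr) (pB _ n wr).
have h3 := sd _ _ Bw B0 (pB _ n wr) z0r.
have h4 := cmodD (cseg f z0 (p z n)) (cseg f (p z n) (p w n)).
have h5 : cmod (p w n - p z n) <= (cmod (w - z0) + cmod (z - z0)) / 2 ^+ n.
  rewrite mulrDl -!pz (_ : p w n - p z n = (p w n - z0) - (p z n - z0)); last by ring.
  exact: cmodB.
rewrite (cmod_distC z0) !pz in h1 h3.
have h6 : M * (4 * L / 2 ^+ n) <= e by rewrite mulrC -ler_pdivlMr// ltW.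
have h7 := ler_wpM2l (ltW M0) h5.
have E4 : M * (4 * L / 2 ^+ n) = 2 * (M * ((cmod (w - z0) + cmod (z - z0)) / 2 ^+ n))
  + 2 * (M * (cmod (z - z0) / 2 ^+ n)) + 2 * (M * (cmod (w - z0) / 2 ^+ n)).
  by rewrite /L; field; rewrite gt_eqF.
have : 0 <= M * (cmod (z - z0) / 2 ^+ n) by rewrite mulr_ge0 ?divr_ge0 ?(ltW M0) ?cmod_ge0 ?(ltW n2).
have : 0 <= M * (cmod (w - z0) / 2 ^+ n) by rewrite mulr_ge0 ?divr_ge0 ?(ltW M0) ?cmod_ge0 ?(ltW n2).
have : 0 <= M * ((cmod (w - z0) + cmod (z - z0)) / 2 ^+ n).
  by rewrite mulr_ge0 ?divr_ge0 ?addr_ge0 ?(ltW M0) ?cmod_ge0 ?(ltW n2).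
lra.
Qed.

(** Integrate from the exceptional point: every triangle that occurs has it as a
    vertex. *)
Lemma primitive_disc : exists F, forall s, cmod s < r -> cder F s (f s).
Proof.
exists (cseg f z0) => z zr e e0.
have [d1 [d10 Hd]] := f_cont zr e0.
have rz : 0 < r - cmod z by rewrite subr_gt0.
pose dz : R := if z == z0 then 1 else cmod (z - z0) / 2.
have dz0 : 0 < dz.
  by rewrite /dz; case: eqP => // /eqP zz0; rewrite divr_gt0// cmod_gt0 subr_eq0.
exists (Num.min d1 (Num.min (r - cmod z) dz)); split; first by rewrite !minr_gt0.
move=> h; rewrite !lt_min => /and3P[hd1 hr hz].
have wr : cmod (z + h) < r by rewrite (le_lt_trans (cmodD _ _))// addrC -ltrBrDr.
have incr : cseg f z0 (z + h) - cseg f z0 z = cseg f z (z + h).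
  move: hz; rewrite /dz; case: eqP => [->|/eqP zz0] hz; first by rewrite cseg_point subr0.
  have := @tri_exceptional z (z + h) zr wr zz0.
  rewrite addrAC subrr add0r (ltW hz) => /(_ isT).
  rewrite /tri (@cseg_rev _ f z0 (z + h)); last exact: seg_cont.
  by move=> /eqP; rewrite addrAC addr_eq0 => /eqP E; apply: oppr_inj; rewrite -E; ring.
rewrite incr (_ : h * f z = cseg (fun=> f z) z (z + h)); last first.
  by rewrite /cseg cint_cst addrAC subrr add0r mulrC.
have cc c : ccont_seg (fun=> c) z (z + h) by move=> t _; exact: ccont_cst.
have -> : cseg f z (z + h) = cseg (fun=> f z) z (z + h) + cseg (fun s => f s + - f z) z (z + h).
  rewrite -csegD//.
    by congr (cseg _ z (z + h)); apply/funext => s; rewrite subrKC.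
  by move=> t t01; apply: ccontD; [exact: seg_cont|exact: ccont_cst].
have -> : e * cmod h = e * cmod (z + h - z) by rewrite addrAC subrr add0r.
rewrite addrAC subrr add0r.
apply: cseg_le => t t01.
  by apply: ccontD; [exact: seg_cont|exact: ccont_cst].
rewrite /segpt; apply: Hd; apply: le_lt_trans hd1.
case/andP: t01 => t0 t1.
by rewrite addrAC subrr add0r cmodM cmod_real ger0_norm// ler_piMl ?cmod_ge0.
Qed.

End exceptional_point.
End primitive.

(** * The exponential function *)

Section complex_exponential.
Variable R : realType.
Implicit Types s w : R[i].

Lemma cexpD s w : cexp (s + w) = cexp s * cexp w.
Proof.
by apply: complexP; rewrite ?ReM ?ImM /cexp /= ?ReD ?ImD expRD ?cosD ?sinD; ring.
Qed.

Lemma cexp0 : cexp (0 : R[i]) = 1.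
Proof. by rewrite /cexp /= expR0 cos0 sin0 mulr1 mulr0. Qed.

Lemma cmod_cexp s : cmod (cexp s) = expR (Re s).
Proof.
by rewrite cmodE /cexp /= !exprMn -mulrDr cos2Dsin2 mulr1 sqrtr_sqr ger0_norm//.
Qed.

Lemma cexp_neq0 s : cexp s != 0.
Proof. by rewrite -cmod_gt0 cmod_cexp expR_gt0. Qed.

Lemma cexpN s : cexp (- s) = (cexp s)^-1.
Proof.
by apply: (mulfI (cexp_neq0 s)); rewrite -cexpD subrr cexp0 mulfV// cexp_neq0.
Qed.

Lemma cexp_real (x : R) : cexp x%:C%C = (expR x)%:C%C.
Proof. by rewrite /cexp /= cos0 sin0 mulr1 mulr0. Qed.

Lemma cexp_natM n s : cexp (n%:R * s) = cexp s ^+ n.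
Proof.
by elim: n => [|n IH]; rewrite ?mul0r ?cexp0 ?expr0// exprS -IH -cexpD -natr1 mulrDl mul1r addrC.
Qed.

Lemma expR_le_5 (x : R) : x <= 1 -> expR x <= 5.
Proof.
move=> x1; have h : 2^-1 <= expR (- 2^-1) :> R.
  by apply: le_trans (expR_ge1Dx _); lra.
have h2 : expR (2^-1 : R) <= 2.
  by move: h; rewrite expRN lef_pV2 ?posrE ?expR_gt0.
apply: (@le_trans _ _ (expR 1)); first by rewrite ler_expR.
have -> : (1 : R) = 2^-1 + 2^-1 by field.
by rewrite expRD; have := expR_gt0 (2^-1 : R); nra.
Qed.

Lemma cder_cexp s : cder (@cexp R) s (cexp s).
Proof.
have at0 : cder (@cexp R) 0 1.
  move=> e e0; 
  have [e' [e'0 e1 ee]] : exists e' : R, [/\ 0 < e', e' <= 1 & 20 * e' <= e].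
    exists (Num.min (e / 20) 1); rewrite minr_gt0 ?divr_gt0// ge_min lexx orbT; split=> //.
    by rewrite -ler_pdivlMl// mulrC ge_min lexx.
  have /is_derive_epsP/(_ _ e'0) [d1 [d10 D1]] := @is_derive_expR R 0.
  have /is_derive_epsP/(_ _ e'0) [d2 [d20 D2]] := @is_derive_cos R 0.
  have /is_derive_epsP/(_ _ e'0) [d3 [d30 D3]] := @is_derive_sin R 0.
  exists (Num.min e' (Num.min d1 (Num.min d2 d3))); split; first by rewrite !minr_gt0.
  move=> h; rewrite !lt_min => /and4P[he h1 h2 h3].
  have aR := cmod_Re h; have aI := cmod_Im h; have h0 := cmod_ge0 h.
  have := D1 _ (le_lt_trans aR h1); have := D2 _ (le_lt_trans aI h2).
  have := D3 _ (le_lt_trans aI h3).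
  rewrite !add0r expR0 cos0 sin0 !oppr0 mulr0 !mulr1 !subr0 ?addr0.
  set x := Re h in aR *; set y := Im h in aI * => S C E.
  have x1 : x <= 1 by rewrite (le_trans (ler_norm _))// (le_trans aR)// (le_trans (ltW he)).
  have X5 := expR_le_5 x1; have X0 := expR_ge0 x.
  have aR' : e' * `|x| <= e' * cmod h by rewrite ler_wpM2l// ltW.
  have aI' : e' * `|y| <= e' * cmod h by rewrite ler_wpM2l// ltW.
  rewrite cexp0 (le_trans (cmod_le_ReIm _))//.
  have -> : Re (cexp h - 1 - h) = (expR x - 1 - x) + expR x * (cos y - 1).
    by rewrite !ReB /= -/x -/y; ring.
  have -> : Im (cexp h - 1 - h) = expR x * (sin y - y) + (expR x - 1) * y.
    by rewrite !ImB /= -/x -/y; ring.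
  have t1 : `|expR x * (cos y - 1)| <= 5 * (e' * cmod h).
    by rewrite normrM ger0_norm// ler_pM// (le_trans C).
  have t2 : `|expR x * (sin y - y)| <= 5 * (e' * cmod h).
    by rewrite normrM ger0_norm// ler_pM// (le_trans S).
  have t3 : `|(expR x - 1) * y| <= 2 * (e' * cmod h).
    rewrite normrM mulrA ler_pM//; rewrite -(subrK x (expR x - 1)).
    rewrite (le_trans (ler_normD _ _))// mulr_natl mulr2n lerD//.
      by rewrite (le_trans E)// ler_piMr ?(ltW e'0)// (le_trans aR)// (le_trans (ltW he)).
    by rewrite (le_trans aR)// ltW.
  have := ler_normD (expR x - 1 - x) (expR x * (cos y - 1)).
  have := ler_normD (expR x * (sin y - y)) ((expR x - 1) * y).
  have := ler_wpM2r h0 ee; have := mulr_ge0 (ltW e'0) h0; lra.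
have := cder_comp (cderB (cder_id s) (cder_cst s s)) (_ : cder (@cexp R) (s - s) 1).
rewrite subrr subr0 mulr1 => /(_ at0) H.
have := cderZ (cexp s) H; rewrite mulr1; apply: cder_ext => w.
by rewrite -cexpD subrKC.
Qed.

Lemma ccont_cexp s : ccont (@cexp R) s.
Proof. by apply: cder_cont (cder_cexp s). Qed.

End complex_exponential.

(** * Cauchy's formula on a circle *)

Section circle.
Variable R : realType.
Implicit Types (f g F : R[i] -> R[i]) (s w z h : R[i]) (r rho : R).

Definition two_pi_i : R[i] := Complex 0 (2 * pi).
Definition circle r (t : R) : R[i] := r%:C%C * cexp (two_pi_i * t%:C%C).

Lemma two_pi_i_neq0 : two_pi_i != 0.
Proof.
apply/negP => /eqP[] /eqP; rewrite mulf_eq0 pnatr_eq0 /= => /eqP p0.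
by have := pi_gt0 R; rewrite p0 ltxx.
Qed.

Lemma cexp_two_pi_i : cexp two_pi_i = 1.
Proof.
by rewrite /cexp /= expR0 !mul1r mulr_natl mulr2n cosDpi sinDpi cospi sinpi !opprK oppr0.
Qed.

Lemma antider_cexpZ (c : R[i]) : antider (fun t : R => cexp (c * t%:C%C)) (fun t => cexp (c * t%:C%C) * c).
Proof.
have := antider_comp (F := @cexp R) (fun t _ => cder_cexp _) (antiderZ c (@antider_id R)).
by apply: antider_ext => // t _; rewrite mulr1.
Qed.

Lemma antider_circle r : antider (circle r) (fun t => circle r t * two_pi_i).
Proof.
have := antiderZ r%:C%C (antider_cexpZ two_pi_i).
by apply: antider_ext => // t _; rewrite mulrA.
Qed.

Lemma circle01 r : circle r 1 = circle r 0.
Proof. by rewrite /circle mulr1 mulr0 cexp0 cexp_two_pi_i. Qed.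

Lemma cmod_circle r t : 0 < r -> cmod (circle r t) = r.
Proof.
move=> r0; rewrite /circle cmodM cmod_real gtr0_norm// cmod_cexp ReM /=.
by rewrite mul0r mulr0 subrr expR0 mulr1.
Qed.

Lemma circle_sub_neq0 r t z : 0 < r -> cmod z < r -> circle r t - z != 0.
Proof.
move=> r0 zr; rewrite subr_eq0; apply: contraTneq zr => <-.
by rewrite cmod_circle// ltxx.
Qed.

Lemma circle_sub_ge r t z : 0 < r -> r - cmod z <= cmod (circle r t - z).
Proof. by move=> r0; rewrite -{1}(@cmod_circle r t r0) cmodB_ge. Qed.

Lemma pcont_circle r : pcont (circle r).
Proof. exact: antider_pcont (@antider_circle r). Qed.

Lemma pcont_circleV r z n : 0 < r -> cmod z < r -> pcont (fun t => (circle r t - z) ^- n).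
Proof.
move=> r0 zr; apply: (@pcont_comp _ (fun x => (x - z) ^- n)); last exact: pcont_circle.
move=> t _; apply: ccontV; first by rewrite expf_neq0// circle_sub_neq0.
apply: (@ccont_comp _ (fun x => x - z) (fun x => x ^+ n)); last exact: ccont_pow.
by apply: ccontD; [exact: ccont_id|exact: ccont_cst].
Qed.

Lemma pcont_bounded (phi : R -> R[i]) : pcont phi ->
  exists M : R, 0 < M /\ forall t, 0 <= t <= 1 -> cmod (phi t) <= M.
Proof.
move=> H; have [|c _ Hc] := @EVT_max R (fun t => cmod (phi t)) 0 1 ler01.
  apply/subspace_continuousP => x /=; rewrite in_itv /= => x01.
  apply/cvgrPdist_le => e e0; have [d [d0 Hd]] := H x x01 e e0.
  rewrite near_withinE; exists d => //= y; rewrite /ball /= distrC => yx; rewrite in_itv /= => y01.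
  apply: le_trans (Hd y y01 yx); rewrite ler_norml /=.
  have := cmodB_ge (phi y) (phi x); have := cmodB_ge (phi x) (phi y).
  rewrite (cmod_distC (phi x)) => A B.
  by apply/andP; split; [move: B|move: A]; rewrite /from_subspace; lra.
exists (cmod (phi c) + 1); split; first by rewrite ltr_wpDl ?cmod_ge0.
move=> t t01; apply: (@le_trans _ _ (cmod (phi c))); last by rewrite lerDl.
by apply: Hc; rewrite in_itv.
Qed.

(** Mean of the Cauchy kernel: the successive terms of the geometric expansion
    of [zeta / (zeta - z)] integrate to 0, and the remainders tend to 0. *)
Lemma cint_cauchy_kernel r z : 0 < r -> cmod z < r ->
  cint (fun t => circle r t / (circle r t - z)) = 1.
Proof.
move=> r0 zr.
have cn0 t : circle r t != 0 by rewrite -cmod_gt0 cmod_circle.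
have cz t : circle r t - z != 0 by apply: circle_sub_neq0.
pose q n t := (z / circle r t) ^+ n.
have qc n : pcont (q n).
  apply: (@pcont_comp _ (fun x => (z / x) ^+ n)); last exact: pcont_circle.
  move=> t _; apply: (@ccont_comp _ (fun x => z / x) (fun x => x ^+ n)); last exact: ccont_pow.
  apply: ccontM; first exact: ccont_cst.
  by apply: ccontV => //; exact: ccont_id.
have kc : pcont (fun t => circle r t / (circle r t - z)).
  apply: pcontM; first exact: pcont_circle.
  exact: (@pcont_circleV r z 1).
pose I n := cint (fun t => q n t * (circle r t / (circle r t - z))).
have Iq n : I n = cint (q n) + I n.+1.
  rewrite /I -cintD; [|exact: qc|by apply: pcontM; [exact: qc|exact: kc]].
  apply: cint_ext => [t _|]; last by apply: pcontM; [exact: qc|exact: kc].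
  by rewrite /q exprS; field; rewrite cz cn0.
have q0 n : cint (q n.+1) = 0.
  pose c := - (n.+1%:R * two_pi_i).
  have c0 : c != 0 by rewrite oppr_eq0 mulf_neq0 ?pnatr_eq0 ?two_pi_i_neq0.
  have := antiderZ ((z / r%:C%C) ^+ n.+1 / c) (antider_cexpZ c).
  set A := _ / c => H; rewrite (@cintE _ (fun t => A * cexp (c * t%:C%C))).
    by rewrite mulr1 mulr0 cexp0 cexpN cexp_natM cexp_two_pi_i expr1n invr1 subrr.
  apply: antider_ext H => // t _.
  have -> : c * t%:C%C = - (n.+1%:R * (two_pi_i * t%:C%C)) by rewrite /c; ring.
  have En : cexp (two_pi_i * t%:C%C) ^+ n.+1 != 0 by rewrite expf_neq0 ?cexp_neq0.
  rewrite cexpN cexp_natM /A /q /circle [in RHS]invfM [in RHS]mulrA [RHS]exprMn exprVn.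
  by move: En; move: (_ ^+ n.+1) ((z / _) ^+ n.+1) => E X En; field; rewrite En c0.
have E n : cint (fun t => circle r t / (circle r t - z)) = 1 + I n.+1.
  have -> : cint (fun t => circle r t / (circle r t - z)) = I 0%N.
    by apply: cint_ext => // t _; rewrite /q expr0 mul1r.
  elim: n => [|n ->]; last by rewrite [I n.+1]Iq q0 add0r.
  rewrite Iq; congr (_ + _); rewrite -[RHS]cint_cst.
  by apply: cint_ext => // t _; rewrite /q expr0.
apply/eqP; rewrite -subr_eq0 -cmod_eq0 eq_le cmod_ge0 andbT.
apply/ler_addgt0Pr => e e0; rewrite add0r.
have [M [M0 HM]] := pcont_bounded kc.
have x1 : `|cmod z / r| < 1.
  by rewrite ger0_norm ?divr_ge0 ?cmod_ge0 ?(ltW r0)// ltr_pdivrMr// mul1r.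
have /cvgrPdist_lt /(_ _ (divr_gt0 e0 M0)) [n _ Hn] := cvg_expr x1.
have := Hn n.+1 (leqnSn n); rewrite /= sub0r normrN => {}Hn.
rewrite (E n) addrAC subrr add0r /I; apply: cint_le => [|t t01].
  by apply: pcontM; [exact: qc|exact: kc].
rewrite cmodM cmodX cmodM cmodV cmod_circle//.
apply: (@le_trans _ _ (e / M * M)); last by rewrite mulfVK// gt_eqF.
rewrite ler_pM ?exprn_ge0 ?divr_ge0 ?cmod_ge0 ?(ltW r0) ?HM//.
exact: le_trans (ler_norm _) (ltW Hn).
Qed.

Definition holo_disc f rho := forall s, cmod s < rho -> cdiff f s.

(** Continuous at [z] when [l] is the derivative of [f] there. *)
Definition dquot f z l s := if s == z then l else (f s - f z) / (s - z).

Lemma dquotE f z l s : f s = f z + (s - z) * dquot f z l s.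
Proof.
rewrite /dquot; case: eqP => [->|/eqP]; first by rewrite subrr mul0r addr0.
by rewrite -subr_eq0 => s0; field.
Qed.

Lemma cdiff_dquot f z l s : s != z -> cdiff f s -> cdiff (dquot f z l) s.
Proof.
move=> sz [m H]; have sz0 : 0 < cmod (s - z) by rewrite cmod_gt0 subr_eq0.
have h := cderM (cderB H (cder_cst (f z) s))
  (cderV (f := fun x => x - z) _ (cderB (cder_id s) (cder_cst z s))).
eexists; apply: cder_near sz0 _ (h _); last by rewrite subr_eq0.
move=> x hx; rewrite /dquot; case: eqP => // E; move: hx.
by rewrite -E opprD addrA subrr sub0r cmodN ltxx.
Qed.

Lemma ccont_dquot f z l : cder f z l -> ccont (dquot f z l) z.
Proof.
move=> H e e0; have [d [d0 Hd]] := H e e0; exists d; split=> // h hd; rewrite /dquot eqxx.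
case: eqP => [_|/eqP hz]; first by rewrite subrr cmod0 ltW.
have h0 : h != 0 by apply: contraNneq hz => ->; rewrite addr0.
rewrite (_ : z + h - z = h); last by ring.
rewrite (_ : _ - l = (f (z + h) - f z - h * l) / h); last by field.
by rewrite cmodM cmodV ler_pdivrMr ?cmod_gt0// Hd.
Qed.

Lemma pcont_on_circle f rho r : holo_disc f rho -> 0 < r -> r < rho ->
  pcont (fun t => f (circle r t)).
Proof.
move=> Hf r0 rr; apply: pcont_comp; last exact: pcont_circle.
by move=> t _; apply: cdiff_cont; apply: Hf; rewrite cmod_circle.
Qed.

(** The difference quotient of [f] at [z] is continuous, and differentiable off
    [z]; so it has a primitive and its integral over the circle vanishes. *)
Theorem cauchy_formula f rho r z : holo_disc f rho -> 0 < r -> r < rho -> cmod z < r ->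
  f z = cint (fun t => f (circle r t) * (circle r t / (circle r t - z))).
Proof.
move=> Hf r0 rr zr; have zrho := lt_trans zr rr.
have [l Hl] := Hf z zrho.
pose k := dquot f z l.
have kd s : cmod s < rho -> s != z -> cdiff k s.
  by move=> sr sz; apply: cdiff_dquot => //; exact: Hf.
have kc s : cmod s < rho -> ccont k s.
  move=> sr; have [->|sz] := eqVneq s z; first exact: ccont_dquot.
  by apply: cdiff_cont; exact: kd.
have [K HK] := primitive_disc zrho kc kd.
have cr t : cmod (circle r t) < rho by rewrite cmod_circle.
have := cintE (antider_comp (F := K) (fun t _ => HK _ (cr t)) (@antider_circle r)).
rewrite circle01 subrr => k0.
have fc := pcont_on_circle Hf r0 rr.
have qc : pcont (fun t => circle r t / (circle r t - z)).
  by apply: pcontM; [exact: pcont_circle|exact: (@pcont_circleV r z 1)].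
have E : cint (fun t => k (circle r t) * (circle r t * two_pi_i)) =
   two_pi_i * (cint (fun t => f (circle r t) * (circle r t / (circle r t - z)))
   + (- f z) * cint (fun t => circle r t / (circle r t - z))).
  rewrite -cintZ // -cintD; [|exact: pcontM|by apply: pcontM => //; exact: pcont_cst].
  rewrite -cintZ; last first.
    by apply: pcontD; [exact: pcontM|apply: pcontM => //; exact: pcont_cst].
  apply: cint_ext => [t _|].
    have cz : circle r t - z != 0 by exact: circle_sub_neq0.
    by rewrite /k /dquot -subr_eq0 (negbTE cz); field.
  apply: pcontM; first by apply: pcont_comp (pcont_circle r) => t _; exact: kc.
  by apply: pcontM; [exact: pcont_circle|exact: pcont_cst].
move: k0; rewrite E cint_cauchy_kernel// mulr1 => /eqP.
by rewrite mulf_eq0 (negbTE two_pi_i_neq0) /= subr_eq0 => /eqP.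
Qed.

(** Differentiation under the integral from a second order bound, uniform in the
    parameter. *)
Lemma cder_cint (G : R -> R[i] -> R[i]) (G' : R -> R[i]) z (C d : R) : 0 < d -> 0 <= C ->
  (forall h, cmod h < d -> pcont (G ^~ (z + h))) -> pcont G' ->
  (forall t h, 0 <= t <= 1 -> cmod h < d ->
     cmod (G t (z + h) - G t z - h * G' t) <= C * cmod h ^+ 2) ->
  cder (fun x => cint (G ^~ x)) z (cint G').
Proof.
move=> d0 C0 Gc G'c H e e0; have C1 : 0 < C + 1 by rewrite ltr_wpDl.
exists (Num.min d (e / (C + 1))); split; first by rewrite minr_gt0// divr_gt0.
move=> h; rewrite lt_min => /andP[hd he].
have Gz : pcont (G ^~ z).
  by have := Gc 0; rewrite cmod0 addr0; apply.
have ph : pcont (fun t => (-1) * (G t z + h * G' t)).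
  apply: pcontM; first exact: pcont_cst.
  by apply: pcontD => //; apply: pcontM => //; exact: pcont_cst.
have hG : pcont (fun t => h * G' t) by apply: pcontM => //; exact: pcont_cst.
have -> : cint (G ^~ (z + h)) - cint (G ^~ z) - h * cint G' =
    cint (fun t => G t (z + h) + (-1) * (G t z + h * G' t)).
  rewrite cintD//; last exact: Gc.
  rewrite cintZ; last exact: pcontD.
  by rewrite cintD// cintZ//; ring.
have h2 : C * cmod h ^+ 2 <= e * cmod h.
  rewrite expr2 mulrA ler_wpM2r ?cmod_ge0//.
  move: he; rewrite ltr_pdivlMr// => /ltW; have := cmod_ge0 h; nra.
apply: le_trans h2; apply: cint_le => [|t t01]; first by apply: pcontD => //; exact: Gc.
by have := H t h t01 hd; congr (cmod _ <= _); ring.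
Qed.

(** Cauchy transforms are twice differentiable; through [cauchy_formula] this
    regularity passes to derivatives and to difference quotients. *)
Lemma cder_cauchy_transform (phi : R -> R[i]) r z : 0 < r -> cmod z < r -> pcont phi ->
  cder (fun x => cint (fun t => phi t * (circle r t - x)^-1)) z
       (cint (fun t => phi t * (circle r t - z) ^- 2)) /\
  cder (fun x => cint (fun t => phi t * (circle r t - x) ^- 2)) z
       (cint (fun t => phi t * (2 * (circle r t - z) ^- 3))).
Proof.
move=> r0 zr pc; have [M [M0 HM]] := pcont_bounded pc.
pose d := r - cmod z; have d0 : 0 < d by rewrite subr_gt0.
have d2 : 0 < d / 2 by rewrite divr_gt0.
have ud t : d <= cmod (circle r t - z) by exact: circle_sub_ge.
have uhd t h : cmod h < d / 2 -> d / 2 <= cmod (circle r t - z - h).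
  by move=> hd; have := cmodB_ge (circle r t - z) h; have := ud t; lra.
have zh h : cmod h < d / 2 -> cmod (z + h) < r.
  by move=> hd; have := cmodD z h; move: hd; rewrite /d; have := cmod_ge0 h; lra.
have inv_le (a b : R) n : 0 < a -> a <= b -> b ^- n <= a ^- n.
  move=> a0 ab; have b0 := lt_le_trans a0 ab.
  rewrite lef_pV2 ?posrE ?exprn_gt0// lerXn2r ?nnegrE//; exact: ltW.
split.
  apply: (@cder_cint (fun t x => phi t * (circle r t - x)^-1) _ z (M * (d ^- 2 * (d / 2) ^- 1)) (d / 2)) => //.
  - by rewrite !mulr_ge0 ?invr_ge0 ?exprn_ge0 ?(ltW M0) ?(ltW d0) ?(ltW d2).
  - by move=> h hd; apply: pcontM => //; apply: (@pcont_circleV r (z + h) 1) => //; exact: zh.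
  - by apply: pcontM => //; exact: pcont_circleV.
  move=> t h t01 hd /=; have u0 := @circle_sub_neq0 r t z r0 zr.
  have uh0 : circle r t - z - h != 0 by rewrite -addrA -opprD circle_sub_neq0 ?zh.
  have -> : phi t * (circle r t - (z + h))^-1 - phi t * (circle r t - z)^-1
       - h * (phi t * (circle r t - z) ^- 2) =
       phi t * ((circle r t - z) ^- 2 * (circle r t - z - h) ^- 1) * h ^+ 2.
    by rewrite opprD addrA; move: u0 uh0; move: (circle r t - z) => u u0 uh0; field; rewrite u0 uh0.
  rewrite !cmodM !cmodV !cmodX ler_wpM2r ?mulr_ge0 ?exprn_ge0 ?cmod_ge0//.
  rewrite ler_pM ?HM ?mulr_ge0 ?invr_ge0 ?exprn_ge0 ?cmod_ge0//.
  by rewrite ler_pM ?invr_ge0 ?exprn_ge0 ?cmod_ge0// inv_le ?uhd.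
apply: (@cder_cint (fun t x => phi t * (circle r t - x) ^- 2) _ z
  (M * (4 * (d ^- 2 * (d / 2) ^- 2))) (d / 2)) => //.
- by rewrite !mulr_ge0 ?invr_ge0 ?exprn_ge0 ?(ltW M0) ?(ltW d0) ?(ltW d2).
- by move=> h hd; apply: pcontM => //; apply: (@pcont_circleV r (z + h) 2) => //; exact: zh.
- by apply: pcontM => //; apply: pcontM; [exact: pcont_cst|exact: pcont_circleV].
move=> t h t01 hd /=; have u0 := @circle_sub_neq0 r t z r0 zr.
have uh0 : circle r t - z - h != 0 by rewrite -addrA -opprD circle_sub_neq0 ?zh.
have -> : phi t * (circle r t - (z + h)) ^- 2 - phi t * (circle r t - z) ^- 2
     - h * (phi t * (2 * (circle r t - z) ^- 3)) =
     phi t * ((3 * (circle r t - z) - 2 * h) * (circle r t - z)^-1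
       * ((circle r t - z) ^- 2 * (circle r t - z - h) ^- 2)) * h ^+ 2.
  by rewrite opprD addrA; move: u0 uh0; move: (circle r t - z) => u u0 uh0; field; rewrite u0 uh0.
rewrite !cmodM !cmodV !cmodX ler_wpM2r ?mulr_ge0 ?exprn_ge0 ?cmod_ge0//.
rewrite ler_pM ?HM ?mulr_ge0 ?invr_ge0 ?exprn_ge0 ?cmod_ge0//.
have uu : 0 < cmod (circle r t - z) by rewrite cmod_gt0.
rewrite ler_pM ?mulr_ge0 ?invr_ge0 ?exprn_ge0 ?cmod_ge0//.
  rewrite ler_pdivrMr// (le_trans (cmodB _ _))// !cmodM !cmod_nat.
  by have := ud t; move: hd; lra.
by rewrite ler_pM ?invr_ge0 ?exprn_ge0 ?cmod_ge0// inv_le ?uhd.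
Qed.

End circle.

(** * Consequences of Cauchy's formula *)

Section cauchy_consequences.
Variable R : realType.
Implicit Types (f g q F : R[i] -> R[i]) (s w z h : R[i]) (r rho M : R).

Lemma cder_shift f w s l : cder f (w + s) l -> cder (fun x => f (w + x)) s l.
Proof.
move=> H; have := cder_comp (cderD (cder_cst w s) (cder_id s)) H.
by rewrite add0r mul1r.
Qed.

Lemma holo_cauchy_transform f rho r z : holo_disc f rho -> 0 < r -> r < rho -> cmod z < r ->
  cder f z (cint (fun t => f (circle r t) * circle r t * (circle r t - z) ^- 2)) /\
  cdiff (fun x => cint (fun t => f (circle r t) * circle r t * (circle r t - x) ^- 2)) z.
Proof.
move=> Hf r0 rr zr.
have pc : pcont (fun t => f (circle r t) * circle r t).
  by apply: pcontM; [exact: pcont_on_circle Hf r0 rr|exact: pcont_circle].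
have [H1 H2] := cder_cauchy_transform r0 zr pc; split; last by eexists; exact: H2.
have d0 : 0 < r - cmod z by rewrite subr_gt0.
apply: cder_near d0 _ H1 => h hd.
have zh : cmod (z + h) < r by have := cmodD z h; move: hd; lra.
rewrite (cauchy_formula Hf r0 rr zh); congr cint; apply/funext => t.
by rewrite mulrA.
Qed.

Lemma holo_deriv f rho : holo_disc f rho ->
  exists f1, forall s, cmod s < rho -> cder f s (f1 s) /\ cdiff f1 s.
Proof.
move=> Hf; pose f1 s := xget 0 [set l | cder f s l].
have f1P s : cmod s < rho -> cder f s (f1 s).
  by move=> /Hf[l Hl]; rewrite /f1; case: xgetP => [//|/(_ l)].
exists f1 => s sr; split; first exact: f1P.
have [r0 rr sr'] : [/\ 0 < (cmod s + rho) / 2, (cmod s + rho) / 2 < rho & cmod s < (cmod s + rho) / 2].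
  by have := cmod_ge0 s; split; lra.
have [_ [l Hl]] := holo_cauchy_transform Hf r0 rr sr'; exists l.
have d0 : 0 < (cmod s + rho) / 2 - cmod s by rewrite subr_gt0.
apply: cder_near d0 _ Hl => h hd.
have sh : cmod (s + h) < (cmod s + rho) / 2 by have := cmodD s h; move: hd; lra.
apply: cder_unique (f1P _ (lt_trans sh rr)) _.
by have [] := holo_cauchy_transform Hf r0 rr sh.
Qed.

(** Off 0, the quotient is the Cauchy transform of [f] on a circle, because
    [zeta / (zeta - x) - 1 = x / (zeta - x)]; the latter is differentiable at 0. *)
Lemma holo_quotient f rho : 0 < rho -> holo_disc f rho ->
  exists q, holo_disc q rho /\ forall s, f s = f 0 + s * q s.
Proof.
move=> rho0 Hf; have m0 : cmod (0 : R[i]) < rho by rewrite cmod0.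
have [l Hl] := Hf 0 m0.
pose k := dquot f 0 l; exists k; split; last first.
  by move=> s; rewrite {1}(dquotE f 0 l s) subr0.
move=> s sr; have [->|s0] := eqVneq s 0; last by apply: cdiff_dquot => //; exact: Hf.
have r0 : 0 < rho / 2 by rewrite divr_gt0.
have rr : rho / 2 < rho by lra.
have fc := pcont_on_circle Hf r0 rr.
pose T x := cint (fun t => f (circle (rho / 2) t) * (circle (rho / 2) t - x)^-1).
have z0r : cmod (0 : R[i]) < rho / 2 by rewrite cmod0.
have [TD _] := cder_cauchy_transform r0 z0r fc.
have kT x : cmod x < rho / 2 -> x != 0 -> k x = T x.
  move=> xr x0; rewrite /k /dquot (negbTE x0) subr0.
  have E : f x - f 0 = x * T x.
    rewrite (cauchy_formula Hf r0 rr xr) (cauchy_formula Hf r0 rr z0r) /T.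
    have c1 : pcont (fun t => f (circle (rho / 2) t) * (circle (rho / 2) t / (circle (rho / 2) t - x))).
      by apply: pcontM => //; apply: pcontM; [exact: pcont_circle|exact: (@pcont_circleV _ _ x 1)].
    have c2 : pcont (fun t => f (circle (rho / 2) t) * (circle (rho / 2) t / (circle (rho / 2) t - 0))).
      by apply: pcontM => //; apply: pcontM; [exact: pcont_circle|exact: (@pcont_circleV _ _ 0 1)].
    have c3 : pcont (fun t => f (circle (rho / 2) t) * (circle (rho / 2) t - x)^-1).
      by apply: pcontM => //; exact: (@pcont_circleV _ _ x 1).
    apply/eqP; rewrite subr_eq -cintZ// -cintD//; last first.
      by apply: pcontM => //; exact: pcont_cst.
    apply/eqP; apply: cint_ext => // t _.
    have cx : circle (rho / 2) t - x != 0 by exact: circle_sub_neq0.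
    have c0 : circle (rho / 2) t - 0 != 0 by exact: circle_sub_neq0.
    by rewrite subr0 in c0 *; field; rewrite cx c0.
  by rewrite E mulrC mulKf.
have T0 : k 0 = T 0.
  apply: (ccont_punctured_eq r0 (ccont_dquot Hl) (cder_cont TD)) => h h0 hr.
  by rewrite add0r; exact: kT.
eexists; apply: cder_near r0 _ TD => h hd; rewrite add0r.
by have [->|h0] := eqVneq h 0; [exact: T0|exact: kT].
Qed.

(** A weak maximum principle: the loss of a factor 2 is harmless in growth
    estimates. *)
Lemma max_bound f rho r M : holo_disc f rho -> 0 < r -> r < rho ->
  (forall t, 0 <= t <= 1 -> cmod (f (circle r t)) <= M) ->
  forall z, cmod z <= r / 2 -> cmod (f z) <= 2 * M.
Proof.
move=> Hf r0 rr HM z zr; have zr' : cmod z < r by lra.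
rewrite (cauchy_formula Hf r0 rr zr'); apply: cint_le => [|t t01].
  apply: pcontM; first exact: pcont_on_circle Hf r0 rr.
  by apply: pcontM; [exact: pcont_circle|exact: (@pcont_circleV _ _ z 1)].
rewrite cmodM mulrC ler_pM ?cmod_ge0 ?HM// cmodM cmodV cmod_circle//.
have := @circle_sub_ge _ r t z r0 => h.
by rewrite ler_pdivrMr; lra.
Qed.

(** The maximum principle for [f s / s]. *)
Lemma schwarz_bound f rho M : 0 < rho -> holo_disc f rho -> f 0 = 0 ->
  (forall s, cmod s < rho -> cmod (f s) <= M) ->
  forall z, cmod z <= rho / 4 -> cmod (f z) <= 4 * M / rho * cmod z.
Proof.
move=> rho0 Hf f0 HM z zr; have [q [Hq E]] := holo_quotient rho0 Hf.
have r0 : 0 < rho / 2 by rewrite divr_gt0.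
have rr : rho / 2 < rho by lra.
rewrite E f0 add0r cmodM mulrC ler_wpM2r ?cmod_ge0//.
rewrite (_ : 4 * M / rho = 2 * (M / (rho / 2))); last by field; rewrite gt_eqF.
apply: (max_bound Hq r0 rr) => [t _|]; last by lra.
rewrite ler_pdivlMr// mulrC -{1}(@cmod_circle _ _ t r0) -cmodM -[_ * _]add0r -f0 -E.
by apply: HM; rewrite cmod_circle.
Qed.

(** All the coefficients at 0 vanish, so [f] can be divided by [s ^ n] for every
    [n]; the maximum principle for the quotient gives a bound of order [2 ^- n]
    for [f]. *)
Lemma holo_flat_zero f rho : 0 < rho -> holo_disc f rho ->
  (forall d : R, 0 < d -> exists s, [/\ s != 0, cmod s < d & f s = 0]) ->
  forall s, cmod s <= rho / 4 -> f s = 0.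
Proof.
move=> rho0 Hf Hz.
have acc q : holo_disc q rho ->
    (forall d : R, 0 < d -> exists s, [/\ s != 0, cmod s < d & q s = 0]) -> q 0 = 0.
  move=> Hq Hqz; apply/eqP; rewrite -cmod_eq0 eq_le cmod_ge0 andbT.
  apply/ler_addgt0Pr => e e0; rewrite add0r.
  have m0 : cmod (0 : R[i]) < rho by rewrite cmod0.
  have [d [d0 Hd]] := cdiff_cont (Hq 0 m0) e0.
  have [s [s0 sd qs]] := Hqz d d0; have := Hd s sd.
  by rewrite add0r qs sub0r cmodN.
have pow n : exists q, [/\ holo_disc q rho,
    (forall d : R, 0 < d -> exists s, [/\ s != 0, cmod s < d & q s = 0])
    & forall s, f s = s ^+ n * q s].
  elim: n => [|n [q [Hq Hqz E]]]; first by exists f; split=> // s; rewrite expr0 mul1r.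
  have [q' [Hq' E']] := holo_quotient rho0 Hq; have q0 := acc q Hq Hqz.
  exists q'; split=> // [d /Hqz[s [s0 sd qs]]|s].
    exists s; split=> //; move: qs; rewrite E' q0 add0r => /eqP.
    by rewrite mulf_eq0 (negbTE s0) => /eqP.
  by rewrite E E' q0 add0r exprSr mulrA.
have r0 : 0 < rho / 2 by rewrite divr_gt0.
have rr : rho / 2 < rho by lra.
have [M [M0 HM]] := pcont_bounded (pcont_on_circle Hf r0 rr).
move=> s sr; apply/eqP; rewrite -cmod_eq0 eq_le cmod_ge0 andbT.
apply/ler_addgt0Pr => e e0; rewrite add0r.
have [n Hn] := @dyadic_small R (2 * M) e e0.
have [q [Hq _ E]] := pow n; apply: le_trans (ltW Hn).
have rn : 0 < (rho / 2) ^+ n by rewrite exprn_gt0.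
have qM t : 0 <= t <= 1 -> cmod (q (circle (rho / 2) t)) <= M / (rho / 2) ^+ n.
  move=> t01; rewrite ler_pdivlMr// mulrC -[X in X ^+ n](@cmod_circle _ _ t r0) -cmodX -cmodM -E.
  exact: HM.
have s2 : cmod s <= rho / 2 / 2 by lra.
have := max_bound Hq r0 rr qM s2 => qs.
rewrite E cmodM cmodX (le_trans (ler_pM _ (cmod_ge0 _) (_ : _ <= (rho / 2 / 2) ^+ n) qs))//.
- by rewrite exprn_ge0 ?cmod_ge0.
- by rewrite lerXn2r ?nnegrE ?cmod_ge0//; lra.
rewrite expr_div_n le_eqVlt; apply/orP; left; apply/eqP.
have n2 : 0 < (2 : R) ^+ n by rewrite exprn_gt0.
move: rn n2; move: (_ ^+ n) ((2 : R) ^+ n) => x y x0 y0.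
by field; rewrite !gt_eqF.
Qed.

(** A primitive of the logarithmic derivative [g' / g]. *)
Lemma holo_log g rho : 0 < rho -> holo_disc g rho ->
  (forall s, cmod s < rho -> g s != 0) -> g 0 = 1 ->
  exists l, [/\ holo_disc l rho, l 0 = 0 & forall s, cmod s < rho -> cexp (l s) = g s].
Proof.
move=> rho0 Hg gn0 g0; have [g1 Hg1] := holo_deriv Hg.
pose k s := g1 s / g s.
have kd s : cmod s < rho -> cdiff k s.
  move=> sr; have [H1 [m Hm]] := Hg1 s sr.
  by eexists; apply: cderM Hm (cderV (gn0 s sr) H1).
have m0 : cmod (0 : R[i]) < rho by rewrite cmod0.
have [L HL] := primitive_disc m0 (fun s sr => cdiff_cont (kd s sr)) (fun s sr _ => kd s sr).
exists (fun s => L s - L 0); split; last 1 first; last 1 first.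
- by rewrite subrr.
- move=> s sr; pose u x := g x * cexp (L 0 - L x).
  have uder x : cmod x < rho -> cder u x 0.
    move=> xr; have [H1 _] := Hg1 x xr.
    have := cderM H1 (cder_comp (cderB (cder_cst (L 0) x) (HL x xr)) (cder_cexp _)).
    rewrite (_ : _ + _ = 0)// /k; field; exact: gn0.
  have A : antider (fun t : R => u (segpt 0 s t)) (fun=> 0).
    have := @antider_comp R u (fun=> 0) _ _ _ (antider_segpt 0 s).
    rewrite (_ : (fun t : R => 0 * (s - 0)) = fun=> 0); last by apply/funext => t; rewrite mul0r.
    apply=> t /andP[t0 t1]; apply: uder; rewrite /segpt add0r subr0 cmodM cmod_real ger0_norm//.
    by rewrite (le_lt_trans _ sr)// ler_piMl ?cmod_ge0.
  have := antider_le A (M := 0); rewrite segpt0 segpt1 => H.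
  have : u s - u 0 = 0.
    by apply/eqP; rewrite -cmod_eq0 eq_le cmod_ge0 andbT H// => t _; rewrite cmod0.
  move/eqP; rewrite subr_eq0 /u g0 subrr cexp0 mulr1 -opprB cexpN => /eqP E.
  by rewrite -[LHS]mul1r -E mulfVK// cexp_neq0.
- move=> s sr; eexists; exact: cderB (HL s sr) (cder_cst _ _).
Qed.

(** Borel-Caratheodory, with a crude constant: the function [l / (2 M - l)]
    is bounded by 1 and vanishes at 0. *)
Lemma borel_caratheodory l rho M : 0 < rho -> 0 < M -> holo_disc l rho -> l 0 = 0 ->
  (forall s, cmod s < rho -> Re (l s) <= M) ->
  forall z, cmod z <= rho / 8 -> cmod (l z) <= 2 * M.
Proof.
move=> rho0 M0 Hl l0 HM z zr.
pose m : R[i] := (2 * M)%:C%C.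
have ml s : cmod s < rho -> M <= Re (m - l s) by move=> /HM; rewrite ReB /=; lra.
have mn0 s : cmod s < rho -> m - l s != 0.
  by move=> /ml h; apply: contraTneq h => ->; rewrite /= -ltNge.
pose phi s := l s / (m - l s).
have Hphi : holo_disc phi rho.
  move=> s sr; have [d Hd] := Hl s sr.
  have h2 := cderB (cder_cst m s) Hd.
  by eexists; apply: cderM Hd (cderV _ h2); exact: mn0.
have phi0 : phi 0 = 0 by rewrite /phi l0 mul0r.
have phi1 s : cmod s < rho -> cmod (phi s) <= 1.
  move=> sr; rewrite cmodM cmodV ler_pdivrMr ?cmod_gt0 ?mn0// mul1r.
  rewrite -(@ler_pXn2r _ 2) ?nnegrE ?cmod_ge0// !sqr_cmod ReB ImB /= sub0r sqrrN lerD2r.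
  by have := HM s sr; rewrite -subr_ge0; nra.
have zr4 : cmod z <= rho / 4 by lra.
have zr1 : cmod z < rho by lra.
have ph := schwarz_bound rho0 Hphi phi0 phi1 zr4.
have ph2 : cmod (phi z) <= 2^-1.
  apply: le_trans ph _; rewrite mulr1 mulrAC ler_pdivrMr//; lra.
have : l z = phi z * (m - l z) by rewrite /phi mulfVK// mn0.
move/(congr1 (@cmod R)); rewrite cmodM => E.
have := cmodB m (l z); rewrite cmod_real ger0_norm; last by rewrite mulr_ge0// ltW.
move=> h; have := ler_pM (cmod_ge0 _) (cmod_ge0 _) ph2 h; rewrite -E; lra.
Qed.

(** Twice the Schwarz bound: once through [borel_caratheodory] for the logarithm,
    once for its difference quotient minus the value at 0.  The radius shrinks
    to [rho / 8], then [rho / 32], then [rho / 128]; the constant is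
    [4 * 128 * 32]. *)
Lemma log_linear_part g rho M c : 0 < rho -> 0 < M -> holo_disc g rho ->
  (forall s, cmod s < rho -> g s != 0) -> g 0 = 1 -> cder g 0 c ->
  (forall s, cmod s < rho -> cmod (g s) <= expR M) ->
  forall z, cmod z <= rho / 128 -> exists delta,
    g z = cexp (z * c + delta) /\ cmod delta <= 16384 * M * cmod z ^+ 2 / rho ^+ 2.
Proof.
move=> rho0 M0 Hg gn0 g0 gc gM z zr.
have [l [Hl l0 lE]] := holo_log rho0 Hg gn0 g0.
have lM s : cmod s < rho -> Re (l s) <= M.
  by move=> sr; rewrite -ler_expR -cmod_cexp lE// gM.
have l2M := borel_caratheodory rho0 M0 Hl l0 lM.
have [q [Hq E]] := holo_quotient rho0 Hl; rewrite l0 in E.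
have m0 : cmod (0 : R[i]) < rho by rewrite cmod0.
have qc : q 0 = c.
  have [k Hk] := Hq 0 m0; apply: cder_unique gc.
  have h1 := cderM (cder_id 0) Hk; rewrite mul1r mul0r addr0 in h1.
  have := cder_comp h1 (cder_cexp _); rewrite mul0r cexp0 mulr1.
  by apply: cder_near rho0 _ => h hd; rewrite add0r -lE// E add0r.
have r8 : 0 < rho / 8 by rewrite divr_gt0.
have r32 : 0 < rho / 32 by rewrite divr_gt0.
have q64 s : cmod s <= rho / 32 -> cmod (q s) <= 64 * M / rho.
  move=> sr.
  have r0 : 0 < rho / 16 by rewrite divr_gt0.
  have rr : rho / 16 < rho by lra.
  rewrite (_ : 64 * M / rho = 2 * (2 * M / (rho / 16))); last by field; rewrite gt_eqF.
  apply: (max_bound Hq r0 rr) => [t _|]; last by lra.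
  rewrite ler_pdivlMr// mulrC -{1}(@cmod_circle _ _ t r0) -cmodM -[_ * _]add0r -E.
  by apply: l2M; rewrite cmod_circle//; lra.
have Hq' : holo_disc (fun s => q s - q 0) (rho / 32).
  move=> s sr; have [|d Hd] := Hq s; first by lra.
  by eexists; exact: cderB Hd (cder_cst _ _).
have q128 s : cmod s < rho / 32 -> cmod (q s - q 0) <= 128 * M / rho.
  move=> sr; rewrite (le_trans (cmodB _ _))// (_ : 128 * M / rho = 64 * M / rho + 64 * M / rho).
    by rewrite lerD// q64// ?cmod0 ltW.
  by rewrite -mulrDl; congr (_ / _); ring.
have := schwarz_bound r32 Hq' (subrr _) q128 (z := z) => H.
exists (z * (q z - q 0)); split.
  by rewrite -lE; [rewrite E -qc add0r; congr cexp; ring | lra].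
rewrite cmodM (le_trans (ler_wpM2l (cmod_ge0 _) (H _)))//; first by lra.
by rewrite le_eqVlt; apply/orP; left; apply/eqP; field; rewrite gt_eqF.
Qed.

Definition entire f := forall s, cdiff f s.

Lemma entire_factor f w : entire f -> f w = 0 ->
  exists q, entire q /\ forall s, f s = (s - w) * q s.
Proof.
move=> Hf fw; have [l Hl] := Hf w.
exists (dquot f w l); split; last by move=> s; rewrite {1}(dquotE f w l s) fw add0r.
move=> s; have [->|sw] := eqVneq s w; last exact: cdiff_dquot.
have Hg : holo_disc (fun x => f (w + x)) 1 by move=> x _; have [m /cder_shift Hm] := Hf (w + x); exists m.
have [q [Hq E]] := holo_quotient ltr01 Hg.
have m0 : cmod (0 : R[i]) < 1 by rewrite cmod0.
have [m Hm] := Hq 0 m0; have q0 : q 0 = l.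
  apply: cder_unique Hl; have h1 := cderM (cder_id 0) Hm; rewrite mul1r mul0r addr0 in h1.
  have h2 : cder (fun x => f (w + x)) 0 (q 0).
    apply: cder_near ltr01 _ h1 => h _; by rewrite E addr0 fw add0r.
  have := @cder_shift (fun x => f (w + x)) (- w) w (q 0); rewrite addNr => /(_ h2).
  by apply: cder_ext => x; rewrite addrA subrr add0r.
exists m; have := @cder_shift q (- w) w m; rewrite addNr => /(_ Hm).
apply: cder_ext => x; rewrite /dquot; case: eqP => [->|/eqP xw]; first by rewrite addNr q0.
have := E (- w + x); rewrite addr0 fw add0r addrA subrr add0r subr0 => ->.
by rewrite addrC mulrC mulKf// subr_eq0.
Qed.

(** Identity theorem along a segment: the zero set propagates beyond its last
    point. *)
Lemma identity_theorem (D : set R[i]) f a : cconvex D ->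
  (forall s, D s -> exists d : R, 0 < d /\ forall h, cmod h < d -> D (s + h)) ->
  (forall s, D s -> cdiff f s) -> D a ->
  (forall d : R, 0 < d -> exists s, [/\ s != 0, cmod s < d & f (a + s) = 0]) ->
  forall b, D b -> f b = 0.
Proof.
move=> Dx Do Df Da Hz b Db.
have local p : D p -> (forall d : R, 0 < d -> exists s, [/\ s != 0, cmod s < d & f (p + s) = 0]) ->
    exists d : R, 0 < d /\ forall s, cmod s <= d -> f (p + s) = 0.
  move=> Dp Hp; have [d [d0 Hd]] := Do p Dp; exists (d / 4); rewrite divr_gt0//; split=> // s sd.
  apply: (@holo_flat_zero (fun x => f (p + x)) d) => // x xd.
  by have [m /cder_shift Hm] := Df _ (Hd x xd); exists m.
have [->|ba] := eqVneq b a.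
  have [d [d0 Hd]] := local a Da Hz; have := Hd 0; rewrite cmod0 addr0; apply; exact: ltW.
have L0 : 0 < cmod (b - a) by rewrite cmod_gt0 subr_eq0.
pose S := [set t : R | 0 <= t <= 1 /\ forall u : R, 0 <= u <= t -> f (segpt a b u) = 0].
have seg_dist (t u : R) : segpt a b u = segpt a b t + (u - t)%:C%C * (b - a).
  by rewrite /segpt RtoCB; ring.
have extend (t : R) : 0 <= t <= 1 -> (forall u : R, 0 <= u < t -> f (segpt a b u) = 0) ->
    exists d : R, 0 < d /\ forall u, `|u - t| <= d -> f (segpt a b u) = 0.
  move=> /andP[t0 t1] Ht; have Dt : D (segpt a b t) by apply: Dx => //; rewrite t0.
  have [|d [d0 Hd]] := local (segpt a b t) Dt.
    have [->|tn0] := eqVneq t 0; first by rewrite segpt0.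
    have tp : 0 < t by rewrite lt_neqAle eq_sym tn0.
    move=> d d0; pose x := Num.min t (d / cmod (b - a) / 2).
    have x0 : 0 < x by rewrite minr_gt0// !divr_gt0.
    have xt : x <= t by rewrite ge_min lexx.
    have xd : x <= d / cmod (b - a) / 2 by rewrite ge_min lexx orbT.
    exists ((- x)%:C%C * (b - a)); split.
    - by rewrite mulf_neq0 ?subr_eq0// -cmod_gt0 cmod_real normrN normr_gt0 gt_eqF.
    - rewrite cmodM cmod_real normrN gtr0_norm// -ltr_pdivlMr//.
      by apply: le_lt_trans xd _; rewrite ltr_pdivrMr// ltr_pMr ?divr_gt0// ltr1n.
    rewrite (_ : - x = (t - x) - t); last by ring.
    by rewrite -seg_dist; apply: Ht; lra.
  exists (d / cmod (b - a)); rewrite divr_gt0//; split=> // u ut.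
  by rewrite (seg_dist t); apply: Hd; rewrite cmodM cmod_real -ler_pdivlMr.
have S0 : S 0.
  split; first by rewrite lexx ler01.
  move=> u u0; have -> : u = 0 by apply/eqP; rewrite eq_le andbC.
  have [||d [d0 Hd]] := extend 0; first by rewrite lexx ler01.
    by move=> v /andP[v0 v1]; have := le_lt_trans v0 v1; rewrite ltxx.
  by apply: Hd; rewrite subrr normr0 ltW.
have hs : has_sup S by split; [exists 0|exists 1 => t [/andP[]]].
pose T := sup S.
have T01 : 0 <= T <= 1.
  rewrite /T (ub_le_sup hs.2 S0)/=; apply: ge_sup; [exact: hs.1|by move=> t [/andP[]]].
have below (u : R) : 0 <= u < T -> f (segpt a b u) = 0.
  move=> /andP[u0 uT]; have := sup_adherent (_ : 0 < T - u) hs.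
  rewrite subr_gt0 => /(_ uT) [t [t01 Ht]]; rewrite -/T opprB subrKC => ut.
  by apply: Ht; rewrite u0 ltW.
have [d [d0 Hd]] := extend T T01 below.
have upto (u : R) : 0 <= u <= T + d -> f (segpt a b u) = 0.
  move=> /andP[u0 ud]; have [uT|uT] := ltP u T; first by apply: below; rewrite u0.
  by apply: Hd; rewrite ger0_norm ?subr_ge0// lerBlDl.
have T1 : 1 <= T + d.
  rewrite leNgt; apply/negP => Td; have : S (T + d).
    by split=> //; move: T01 Td; lra.
  by move/(ub_le_sup hs.2); rewrite -/T gerDl leNgt d0.
by rewrite -(segpt1 a b); apply: upto; rewrite ler01.
Qed.

End cauchy_consequences.

(** * Product representation of an entire function of exponential type *)

Section zero_division.
Variable R : realType.
Implicit Types (f g q : R[i] -> R[i]) (s w z h : R[i]).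

(** Order of vanishing, with a cofactor that is only required to be
    continuous: such an order passes to quotients without any analyticity. *)
Definition corder f w m := exists g, [/\ ccont g w, g w != 0 &
  exists d : R, 0 < d /\ forall h, cmod h < d -> f (w + h) = h ^+ m * g (w + h)].

Lemma corder_eq0 f w m : corder f w m.+1 -> f w = 0.
Proof.
case=> g [_ _ [d [d0 H]]]; have := H 0; rewrite cmod0 addr0 expr0n /= mul0r.
by apply.
Qed.

Lemma corder0_neq0 f w : corder f w 0 -> f w != 0.
Proof.
case=> g [_ gw [d [d0 H]]]; have := H 0; rewrite cmod0 addr0 expr0 mul1r.
by move=> ->.
Qed.

Lemma neq0_corder0 f w : ccont f w -> f w != 0 -> corder f w 0.
Proof.
move=> fc fw; exists f; split=> //; exists 1; split=> // h _.
by rewrite expr0 mul1r.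
Qed.

(** The value at [w] itself is recovered by continuity. *)
Lemma corder_quotient_at f q w m : entire q -> (forall s, f s = (s - w) * q s) ->
  corder f w m.+1 -> corder q w m.
Proof.
move=> Hq E [g [gc gw [d [d0 H]]]]; exists g; split=> //; exists d; split=> // h hd.
have eqn x : x != 0 -> cmod x < d -> q (w + x) = x ^+ m * g (w + x).
  move=> x0 xd; have := H x xd; rewrite E addrAC subrr add0r exprS -mulrA.
  exact: mulfI.
have [->|h0] := eqVneq h 0; last exact: eqn.
rewrite addr0.
have c2 : ccont (fun x => (x - w) ^+ m * g x) w.
  apply: ccontM => //; apply: (@ccont_comp _ (fun x => x - w) (fun x => x ^+ m)); last exact: ccont_pow.
  by apply: ccontD; [exact: ccont_id|exact: ccont_cst].
have := @ccont_punctured_eq R q (fun x => (x - w) ^+ m * g x) w d d0 (cdiff_cont (Hq w)) c2.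
rewrite subrr; apply=> x x0 xd; rewrite eqn//; congr (_ ^+ _ * _); ring.
Qed.

Lemma corder_quotient_off f q w v m : v != w -> (forall s, f s = (s - w) * q s) ->
  corder f v m -> corder q v m.
Proof.
move=> vw E [g [gc gv [d [d0 H]]]].
have vw0 : v - w != 0 by rewrite subr_eq0.
exists (fun s => g s / (s - w)); split.
- apply: ccontM => //; apply: ccontV => //.
  by apply: ccontD; [exact: ccont_id|exact: ccont_cst].
- by rewrite mulf_neq0// invr_neq0.
exists (Num.min d (cmod (v - w))); split; first by rewrite minr_gt0// cmod_gt0.
move=> h; rewrite lt_min => /andP[hd hw].
have n0 : v + h - w != 0.
  apply: contraTneq hw => e; rewrite (_ : v - w = - h) ?cmodN ?ltxx//.
  by apply/eqP; rewrite -subr_eq0 opprK; apply/eqP; rewrite -e; ring.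
have := H h hd; rewrite E => e; apply: (mulfI n0); rewrite e.
by move: n0; move: (v + h - w) => x x0; field.
Qed.

(** One zero at a time; each division lowers the order at one point only. *)
Lemma divide_zeros (l : seq R[i]) : forall f (mult : R[i] -> nat), entire f ->
  (forall w, corder f w (mult w)) -> (forall w, (count_mem w l <= mult w)%N) ->
  exists q, [/\ entire q, forall s, f s = \prod_(w <- l) (s - w) * q s &
    forall w, corder q w (mult w - count_mem w l)].
Proof.
elim: l => [|v l IH] f mult Hf Hm Hc.
  exists f; split=> // [s|w]; first by rewrite big_nil mul1r.
  by rewrite subn0.
have mv : (0 < mult v)%N by apply: leq_trans (Hc v); rewrite /= eqxx.
have fv : corder f v (mult v).-1.+1 by rewrite prednK.
have [q [Hq E]] := entire_factor Hf (corder_eq0 fv).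
have [||q' [Hq' E' O']] := IH q (fun w => (mult w - (v == w))%N) Hq.
- move=> w; have [<-|vw] := eqVneq v w; last first.
    by rewrite subn0; apply: corder_quotient_off E (Hm w); rewrite eq_sym.
  by rewrite subn1; exact: corder_quotient_at E fv.
- by move=> w; rewrite leq_subRL ?(leq_trans _ (Hc w))//= leq_addr.
exists q'; split=> // [s|w]; first by rewrite E E' big_cons mulrA.
by rewrite /= subnDA.
Qed.

End zero_division.

Section hadamard.
Variable R : realType.
Implicit Types (s w : R[i]).

Variables (f : R[i] -> R[i]) (f1 : R[i]) (z : nat -> R[i]) (K kappa c0 c1 : R).
Hypothesis f_entire : entire f.
Hypothesis f0 : f 0 = 1.
Hypothesis f_der0 : cder f 0 f1.
Hypothesis K_ge1 : 1 <= K.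
Hypothesis kappa_gt0 : 0 < kappa.
Hypothesis f_growth : forall s, 1 <= cmod s -> cmod (f s) <= K * expR (kappa * cmod s).
Hypothesis c0_gt0 : 0 < c0.
Hypothesis z_lower : forall k, (0 < k)%N -> c0 * k%:R <= cmod (z k).
Hypothesis z_upper : forall k, (0 < k)%N -> cmod (z k) <= c1 * k%:R.
Hypothesis z_order : forall w, exists m, corder f w m /\
  ([set p : nat * bool | (0 < p.1)%N /\ listed_zero z p = w] #= `I_m)%card.

Definition zero_pairs N : seq (nat * bool) := [seq (k, b) | k <- iota 1 N, b <- [:: false; true]].
Definition zero_list N := [seq listed_zero z p | p <- zero_pairs N].

Lemma mem_zero_pairs N p : (p \in zero_pairs N) = (0 < p.1 <= N)%N.
Proof.
apply/allpairsP/idP => [[[k b] /= [kN _ ->]]|pN].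
  by move: kN; rewrite mem_iota add1n ltnS.
exists p; split; last by case: p pN.
  by rewrite mem_iota add1n ltnS.
by case: (p.2).
Qed.

Lemma uniq_zero_pairs N : uniq (zero_pairs N).
Proof. by apply: allpairs_uniq => //; [exact: iota_uniq|move=> [? ?] [? ?]]. Qed.

Lemma cmod_listed_zero p : cmod (listed_zero z p) = cmod (z p.1).
Proof. by rewrite /listed_zero; case: p.2; rewrite ?cmod_conj. Qed.

Lemma listed_zero_ge p : (0 < p.1)%N -> c0 <= cmod (listed_zero z p).
Proof.
move=> p0; rewrite cmod_listed_zero (le_trans _ (z_lower p0))// ler_peMr ?(ltW c0_gt0)//.
by rewrite ler1n.
Qed.

(** The list of the first [N] pairs is an initial part of the enumeration, so it
    never lists a zero more often than its order, and lists completely the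
    zeros whose indices are all at most [N]. *)
Lemma zero_list_order : exists mult : R[i] -> nat,
  [/\ forall w, corder f w (mult w),
      forall N w, (count_mem w (zero_list N) <= mult w)%N &
      forall N w, (forall p, (0 < p.1)%N -> listed_zero z p = w -> (p.1 <= N)%N) ->
        count_mem w (zero_list N) = mult w].
Proof.
have [mult Hm] := choice z_order; exists mult.
pose S w := [set p : nat * bool | (0 < p.1)%N /\ listed_zero z p = w].
have Sfin w : finite_set (S w) by apply/finite_setP; exists (mult w); have [] := Hm w.
have Ssz w : size (finmap.enum_fset (fset_set (S w))) = mult w.
  by apply: card_fset_set; have [] := Hm w.
have cnt N w : count_mem w (zero_list N) =
    size [seq p <- zero_pairs N | listed_zero z p == w].
  by rewrite /zero_list count_map size_filter.
have fu N w : uniq [seq p <- zero_pairs N | listed_zero z p == w].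
  by rewrite filter_uniq// uniq_zero_pairs.
have mS w p : (p \in finmap.enum_fset (fset_set (S w))) = (p \in S w).
  exact: (in_fset_set (Sfin w)).
split=> [w|N w|N w HN]; first by have [] := Hm w.
  rewrite cnt -Ssz uniq_leq_size// => p; rewrite mem_filter mem_zero_pairs mS.
  by move=> /andP[/eqP pw /andP[p0 _]]; rewrite inE; split.
rewrite cnt -Ssz; apply/eqP; rewrite eqn_leq; apply/andP; split; apply: uniq_leq_size.
- exact: fu.
- move=> p; rewrite mem_filter mem_zero_pairs mS.
  by move=> /andP[/eqP pw /andP[p0 _]]; rewrite inE; split.
- exact: finmap.fset_uniq.
move=> p; rewrite mS inE => -[p0 pw]; rewrite mem_filter mem_zero_pairs p0 pw eqxx /=.
exact: HN.
Qed.

Definition Qprod N s := \prod_(1 <= k < N.+1) quadratic_factor (z k) s.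
(** Logarithmic derivative at 0 of [f] divided by the partial product. *)
Definition csum N : R[i] := f1 + \sum_(1 <= k < N.+1) (2 * Re (z k) / cmod (z k) ^+ 2)%:C%C.

Lemma z_neq0 k : (0 < k)%N -> z k != 0.
Proof.
by move=> k0; rewrite -cmod_gt0 (lt_le_trans _ (z_lower k0))// mulr_gt0// ltr0n.
Qed.

Lemma quadratic_factorE w s : w != 0 ->
  quadratic_factor w s = (1 - s / w) * (1 - s / w^*%C).
Proof.
move=> w0; have w0' : w^*%C != 0 by rewrite conjc_eq0.
rewrite /quadratic_factor.
have -> : 2 * (Re w)%:C%C = w + w^*%C.
  by apply: complexP; rewrite ?ReM ?ImM ?ReD ?ImD ?Re_conj ?Im_conj /=; ring.
by field; rewrite w0 w0'.
Qed.

Lemma Qprod_list N s : Qprod N s = \prod_(w <- zero_list N) (1 - s / w).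
Proof.
rewrite /Qprod /zero_list /zero_pairs big_map big_allpairs_dep /= /index_iota subn1 /=.
apply: eq_big_seq => k; rewrite mem_iota => /andP[k0 _].
by rewrite !big_cons big_nil mulr1 /listed_zero /= quadratic_factorE// z_neq0.
Qed.

Lemma zero_list_neq0 N w : w \in zero_list N -> w != 0.
Proof.
move=> /mapP[p]; rewrite mem_zero_pairs => /andP[p0 _] ->.
by rewrite -cmod_gt0 (lt_le_trans c0_gt0)// listed_zero_ge.
Qed.

Lemma Qprod0 N : Qprod N 0 = 1.
Proof. by rewrite Qprod_list big1// => w _; rewrite mul0r subr0. Qed.

Lemma cder_Qprod N : cder (Qprod N) 0 (- \sum_(1 <= k < N.+1) (2 * Re (z k) / cmod (z k) ^+ 2)%:C%C).
Proof.
elim: N => [|N IH].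
  rewrite big_geq// oppr0; apply: cder_ext (cder_cst 1 0) => s.
  by rewrite /Qprod big_geq.
have z0 := z_neq0 (ltn0Sn N).
pose c : R[i] := (2 * Re (z N.+1) / cmod (z N.+1) ^+ 2)%:C%C.
have zz : z N.+1 * (z N.+1)^*%C = (cmod (z N.+1) ^+ 2)%:C%C by exact: mul_conj_cmod.
have H : cder (quadratic_factor (z N.+1)) 0 (- c).
  pose u : R[i] := (z N.+1 * (z N.+1)^*%C)^-1.
  have h := cderD (cderB (cder_cst 1 0) (cderZ c (cder_id 0))) (cderM (cder_pow 1 0) (cder_cst u 0)).
  have e : 0 - c * 1 + (2 * 0 ^+ 1 * u + 0 ^+ 2 * 0) = - c by ring.
  rewrite e in h; apply: cder_ext h => s; rewrite /quadratic_factor /u; congr (_ - _ + _).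
  rewrite /c RtoCM RtoCV -zz RtoCM (RtoC_nat R 2) mulrAC; ring.
have := cderM IH H; rewrite Qprod0 {2}/quadratic_factor mulr0 mul0r subr0 expr0n mul0r addr0.
rewrite mulr1 mul1r [in X in _ -> X]big_nat_recr//= opprD; apply: cder_ext => s.
by rewrite /Qprod [RHS]big_nat_recr.
Qed.

(** On the circle of radius [2 c1 N] every factor of the partial product has
    modulus at least 1, so the quotient inherits the growth of [f].  Zeros of
    modulus less than [c0 N] have index less than [N] and are divided out. *)
Lemma hadamard_step N : (0 < N)%N -> 1 <= 2 * c1 * N%:R ->
  forall s, cmod s <= c0 * N%:R / 128 -> exists delta,
  f s = Qprod N s * cexp (s * csum N + delta) /\
  cmod delta <= 16384 * (ln (2 * K) + 2 * kappa * c1 * N%:R) * cmod s ^+ 2 / (c0 * N%:R) ^+ 2.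
Proof.
move=> N0 cN s sN.
have [mult [Hm Hle Heq]] := zero_list_order.
have [q [Hq E O]] := divide_zeros f_entire Hm (Hle N).
have Nr : (0 : R) < N%:R by rewrite ltr0n.
pose b : R[i] := \prod_(w <- zero_list N) (- w).
pose g x := b * q x.
have fE x : f x = Qprod N x * g x.
  rewrite E Qprod_list /g /b mulrA -big_split /=; congr (_ * _).
  by apply: eq_big_seq => w /zero_list_neq0 w0; field.
have Hg rho : holo_disc g rho by move=> x _; have [l /(cderZ b) Hl] := Hq x; eexists; exact: Hl.
have g0 : g 0 = 1 by rewrite -f0 fE Qprod0 mul1r.
have gc : cder g 0 (csum N).
  have m0 : cmod (0 : R[i]) < 1 by rewrite cmod0.
  have [l Hl] := Hg 1 0 m0.
  have := cderM (cder_Qprod N) Hl; rewrite g0 Qprod0 mulr1 mul1r => h.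
  have /(cder_unique f_der0) f1E : cder f 0 (- \sum_(1 <= k < N.+1) (2 * Re (z k) / cmod (z k) ^+ 2)%:C%C + l).
    by apply: cder_ext h => x; rewrite fE.
  by rewrite /csum f1E addrAC addNr add0r.
have c1_0 : 0 < c1.
  have := lt_le_trans ltr01 cN; rewrite pmulr_lgt0// pmulr_rgt0//.
have c01 : c0 <= c1.
  have := le_trans (z_lower (ltn0Sn 0)) (z_upper (ltn0Sn 0)).
  by rewrite !mulr1.
have K0 : 0 < 2 * K by rewrite mulr_gt0// (lt_le_trans ltr01).
pose M := ln (2 * K) + 2 * kappa * c1 * N%:R.
have lnK0 : 0 <= ln (2 * K) by rewrite ln_ge0// ; move: K_ge1; lra.
have M0 : 0 < M by rewrite ltr_wpDl// !mulr_gt0.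
have r0 : 0 < 2 * c1 * N%:R by rewrite !mulr_gt0.
have rr : 2 * c1 * N%:R < 2 * c1 * N%:R + 1 by rewrite ltrDl.
have Qge x : cmod x = 2 * c1 * N%:R -> 1 <= cmod (Qprod N x).
  move=> xr; rewrite Qprod_list.
  have fac w : w \in zero_list N -> 1 <= cmod (1 - x / w).
    move=> wl; have w0 : 0 < cmod w by rewrite cmod_gt0 (zero_list_neq0 wl).
    have wle : cmod w <= c1 * N%:R.
      move: wl => /mapP[p]; rewrite mem_zero_pairs => /andP[p0 pN] ->.
      rewrite cmod_listed_zero (le_trans (z_upper p0))// ler_wpM2l ?(ltW c1_0)//.
      by rewrite ler_nat.
    have h : 2 <= cmod (x / w) by rewrite cmodM cmodV xr ler_pdivlMr// -mulrA ler_wpM2l.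
    by have := cmodB_ge (x / w) 1; rewrite cmod1 (cmod_distC _ 1); lra.
  elim: (zero_list N) fac => [|w l IH] fac; first by rewrite big_nil cmod1.
  rewrite big_cons cmodM -[leLHS]mulr1 ler_pM//; first by apply: fac; rewrite mem_head.
  by apply: IH => v vl; apply: fac; rewrite in_cons vl orbT.
have gcirc x : cmod x = 2 * c1 * N%:R -> cmod (g x) <= K * expR (2 * kappa * c1 * N%:R).
  move=> xr; have := @f_growth x; rewrite xr => /(_ cN).
  rewrite fE cmodM (_ : kappa * (2 * c1 * N%:R) = 2 * kappa * c1 * N%:R); last by ring.
  by apply: le_trans; rewrite ler_peMl ?cmod_ge0// Qge.
have gin x : cmod x < c0 * N%:R -> cmod (g x) <= expR M.
  move=> xr; rewrite /M expRD lnK ?posrE// -mulrA.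
  apply: (max_bound (Hg _) r0 rr) => [t _|]; first by apply: gcirc; rewrite cmod_circle.
  by rewrite (le_trans (ltW xr))// (_ : _ / 2 = c1 * N%:R) ?ler_wpM2r//; field.
have gn0 x : cmod x < c0 * N%:R -> g x != 0.
  move=> xr; rewrite mulf_neq0//.
    rewrite /b prodf_seq_neq0; apply/allP => w wl; apply/implyP => _.
    by rewrite oppr_eq0 (zero_list_neq0 wl).
  apply: corder0_neq0; have := O x; rewrite (Heq N x) ?subnn// => p p0 px.
  rewrite leqNgt; apply/negP => Np; move: xr; rewrite -px cmod_listed_zero ltNge.
  move/negP; apply; apply: le_trans (z_lower p0); rewrite ler_wpM2l ?(ltW c0_gt0)//.
  by rewrite ler_nat ltnW.
have rho0 : 0 < c0 * N%:R by rewrite mulr_gt0.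
have [delta [dE dle]] := log_linear_part rho0 M0 (Hg _) gn0 g0 gc gin sN.
by exists delta; rewrite fE dE.
Qed.

(** The factor left after dividing out the first [N] pairs of zeros has no
    zero in a disc of radius proportional to [N] and logarithm of size [O(N)]
    there, so this logarithm is linear up to [O(cmod s ^ 2 / N)]. *)
Theorem hadamard_limit s (e : R) : 0 < e -> exists N0 : nat, forall N, (N0 <= N)%N ->
  cmod (Qprod N s * cexp (s * csum N) - f s) <= e.
Proof.
move: hadamard_step (ler0n R 16384); move: (16384 : R) => A step A0 e0.
have c1_0 : 0 < c1.
  have := le_trans (z_lower (ltn0Sn 0)) (z_upper (ltn0Sn 0)); rewrite !mulr1.
  exact: lt_le_trans.
have fs1 : 0 < cmod (f s) + 1 by rewrite ltr_wpDl ?cmod_ge0.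
have [d [d0 Hd]] := ccont_cexp 0 (divr_gt0 e0 fs1).
have K0 : 0 <= ln (2 * K) by rewrite ln_ge0//; move: K_ge1; lra.
pose C := A * (ln (2 * K) + 2 * kappa * c1) * cmod s ^+ 2 / c0 ^+ 2.
have [N1 H1] := natr_large (1 / (2 * c1)); have [N2 H2] := natr_large (cmod s * 128 / c0).
have [N3 H3] := natr_large (C / (d / 2)).
exists (maxn 1 (maxn N1 (maxn N2 N3))) => N; rewrite !geq_max => /and4P[N0 /H1 h1 /H2 h2 /H3 h3].
have Nr : (0 : R) < N%:R by rewrite ltr0n.
have N1r : (1 : R) <= N%:R by rewrite ler1n.
have cN : 1 <= 2 * c1 * N%:R.
  by move: h1; rewrite ler_pdivrMr ?mulr_gt0// mulrC.
have sN : cmod s <= c0 * N%:R / 128.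
  by move: h2; rewrite ler_pdivrMr// ler_pdivlMr// [_ * c0]mulrC.
have [delta [E dle]] := step N N0 cN s sN.
have dd : cmod (- delta) < d.
  rewrite cmodN (le_lt_trans dle)//; apply: (@le_lt_trans _ _ (d / 2)); last by lra.
  apply: (@le_trans _ _ (C / N%:R)).
    rewrite /C (_ : _ / c0 ^+ 2 / N%:R =
        A * ((ln (2 * K) + 2 * kappa * c1) * N%:R) * cmod s ^+ 2 / (c0 * N%:R) ^+ 2).
      rewrite ler_wpM2r ?invr_ge0 ?exprn_ge0 ?mulr_ge0 ?(ltW c0_gt0)//.
      rewrite ler_wpM2r ?exprn_ge0 ?cmod_ge0// ler_wpM2l//.
      by rewrite [leRHS]mulrDl lerD// ler_peMr.
    by field; rewrite !gt_eqF.
  by rewrite ler_pdivrMr// [leRHS]mulrC -ler_pdivrMr ?divr_gt0.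
have -> : Qprod N s * cexp (s * csum N) = f s * cexp (- delta).
  by rewrite E -mulrA -cexpD addrK.
rewrite -{2}[f s]mulr1 -mulrBr cmodM; have := Hd _ dd; rewrite add0r cexp0 => h.
rewrite (le_trans (ler_wpM2l (cmod_ge0 _) h))// mulrCA ler_piMr ?(ltW e0)//.
by rewrite ler_pdivrMr// mul1r lerDl.
Qed.

End hadamard.

(** * Expectations of complex random variables *)

Section expectations.
Context d (T : measurableType d) (R : realType) (P : probability T R).
Implicit Types (f g : T -> R) (F G : T -> R[i]).

Definition rint f := P.-integrable [set: T] (EFin \o f).
Definition rE f : R := (\int[P]_w f w)%R.

Lemma fine_expectation f : fine 'E_P[f] = rE f.
Proof. by rewrite unlock. Qed.

Lemma rint_le f g : measurable_fun [set: T] f -> (forall w, `|f w| <= g w) -> rint g -> rint f.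
Proof.
move=> mf fg; apply: le_integrable => //; first exact/measurable_EFinP.
by move=> w _ /=; rewrite lee_fin (le_trans (fg w))// ler_norm.
Qed.

Lemma rint_bounded f (M : R) : measurable_fun [set: T] f -> (forall w, `|f w| <= M) -> rint f.
Proof. by move=> mf fM; apply: rint_le fM _ => //; exact: finite_measure_integrable_cst. Qed.

Lemma rintD f g : rint f -> rint g -> rint (fun w => f w + g w).
Proof. by move=> hf hg; have := integrableD measurableT hf hg. Qed.

Lemma rintZ (c : R) f : rint f -> rint (fun w => c * f w).
Proof. by move=> hf; have := integrableZl measurableT c hf. Qed.

Lemma rED f g : rint f -> rint g -> rE (fun w => f w + g w) = rE f + rE g.
Proof. exact: RintegralD. Qed.

Lemma rEZ (c : R) f : rint f -> rE (fun w => c * f w) = c * rE f.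
Proof. exact: RintegralZl. Qed.

Lemma rE_cst (c : R) : rE (fun=> c) = c.
Proof. by rewrite /rE Rintegral_cst// [X in fine X](probability_setT P) /= mulr1. Qed.

Lemma rE_le f g : rint f -> rint g -> (forall w, f w <= g w) -> rE f <= rE g.
Proof. by move=> hf hg fg; apply: le_Rintegral. Qed.

Lemma rE_ge0 f : (forall w, 0 <= f w) -> 0 <= rE f.
Proof. by move=> f0; apply: Rintegral_ge0. Qed.

Lemma rE_norm_le f g : rint f -> rint g -> (forall w, `|f w| <= g w) -> `|rE f| <= rE g.
Proof.
move=> hf hg fg; rewrite ler_norml -[- rE g]mulN1r -rEZ//; apply/andP; split.
  apply: rE_le => //; first exact: rintZ.
  by move=> w; have := fg w; rewrite ler_norml mulN1r => /andP[].
by apply: rE_le => // w; have := fg w; rewrite ler_norml => /andP[].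
Qed.

Definition cE F := cexpectation P F.

Lemma cEE F : cE F = Complex (rE (fun w => Re (F w))) (rE (fun w => Im (F w))).
Proof. by rewrite /cE /cexpectation !fine_expectation. Qed.

Lemma cintegrableP F : cintegrable P F <-> rint (fun w => Re (F w)) /\ rint (fun w => Im (F w)).
Proof. by []. Qed.

Lemma cintegrable_le F g : measurable_fun [set: T] (fun w => Re (F w)) ->
  measurable_fun [set: T] (fun w => Im (F w)) -> (forall w, cmod (F w) <= g w) -> rint g ->
  cintegrable P F.
Proof.
move=> mr mi Fg hg; apply/cintegrableP; split; apply: rint_le hg => // w.
  exact: le_trans (cmod_Re _) (Fg w).
exact: le_trans (cmod_Im _) (Fg w).
Qed.

Lemma cE_D F G : cintegrable P F -> cintegrable P G ->
  cE (fun w => F w + G w) = cE F + cE G.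
Proof.
move=> /cintegrableP[Fr Fi] /cintegrableP[Gr Gi]; rewrite !cEE; apply: complexP => /=.
  by rewrite -rED//; congr rE; apply/funext => w; rewrite ReD.
by rewrite -rED//; congr rE; apply/funext => w; rewrite ImD.
Qed.

Lemma cintegrableD F G : cintegrable P F -> cintegrable P G -> cintegrable P (fun w => F w + G w).
Proof.
move=> /cintegrableP[Fr Fi] /cintegrableP[Gr Gi]; apply/cintegrableP; split.
  by have := rintD Fr Gr; congr rint; apply/funext => w; rewrite ReD.
by have := rintD Fi Gi; congr rint; apply/funext => w; rewrite ImD.
Qed.

Lemma cintegrableZ c F : cintegrable P F -> cintegrable P (fun w => c * F w).
Proof.
move=> /cintegrableP[Fr Fi]; apply/cintegrableP; split.
  have := rintD (rintZ (Re c) Fr) (rintZ (- Im c) Fi).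
  by congr rint; apply/funext => w; rewrite ReM mulNr.
have := rintD (rintZ (Re c) Fi) (rintZ (Im c) Fr).
by congr rint; apply/funext => w; rewrite ImM.
Qed.

Lemma cE_Z c F : cintegrable P F -> cE (fun w => c * F w) = c * cE F.
Proof.
move=> /cintegrableP[Fr Fi]; rewrite !cEE; apply: complexP; rewrite ?ReM ?ImM /=.
  rewrite -mulNr -!rEZ// -rED; [|exact: rintZ|exact: rintZ].
  by congr rE; apply/funext => w; rewrite ReM mulNr.
rewrite -!rEZ// -rED; [|exact: rintZ|exact: rintZ].
by congr rE; apply/funext => w; rewrite ImM.
Qed.

(** Real and imaginary parts are bounded separately, whence the factor 2. *)
Lemma cE_le F g : cintegrable P F -> rint g -> (forall w, cmod (F w) <= g w) ->
  cmod (cE F) <= 2 * rE g.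
Proof.
move=> /cintegrableP[Fr Fi] hg Fg; rewrite cEE (le_trans (cmod_le_ReIm _))//= mulr_natl mulr2n lerD//.
  by apply: rE_norm_le => // w; exact: le_trans (cmod_Re _) (Fg w).
by apply: rE_norm_le => // w; exact: le_trans (cmod_Im _) (Fg w).
Qed.

(** Under independence the joint law is the product of the two laws, and
    Fubini's theorem applies. *)
Lemma independent_rE (f g : {mfun T >-> R}) (phi psi : R -> R) : independent P f g ->
  measurable_fun [set: R] phi -> measurable_fun [set: R] psi ->
  (forall x, `|phi x| <= 1) -> (forall x, `|psi x| <= 1) ->
  rE (fun w => phi (f w) * psi (g w)) = rE (fun w => phi (f w)) * rE (fun w => psi (g w)).
Proof.
move=> ind mphi mpsi phi1 psi1.
have mfg : measurable_fun [set: T] (fun w => (f w, g w)).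
  by apply: measurable_fun_pair; exact: measurable_funP.
pose FG : {mfun T >-> (R * R)%type} := HB.pack (fun w => (f w, g w)) (isMeasurableFun.Build _ _ _ _ _ mfg).
have mf1 : measurable_fun [set: T] (fun w => phi (f w)) by exact: measurableT_comp.
have mg1 : measurable_fun [set: T] (fun w => psi (g w)) by exact: measurableT_comp.
pose h (z : R * R) := (phi z.1 * psi z.2)%:E.
have mh : measurable_fun [set: R * R] h.
  by apply/measurable_EFinP; apply: measurable_funM;
    [apply: measurableT_comp => //; exact: measurable_fst
    |apply: measurableT_comp => //; exact: measurable_snd].
have prod1 (a b : R) : `|a| <= 1 -> `|b| <= 1 -> `|a * b| <= 1.
  by move=> a1 b1; rewrite normrM mulr_ile1.
have hFG : P.-integrable [set: T] (h \o FG).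
  apply: (@rint_bounded (fun w => phi (f w) * psi (g w)) 1); first exact: measurable_funM.
  by move=> w; exact: prod1.
have E0 := integral_distribution mh hFG.
have joint A : measurable A ->
    (distribution P f \x distribution P g)%E A = distribution P FG A.
  by apply: product_measure_unique => // B C; exact: ind.
have E1 : (\int[distribution P FG]_z h z = \int[distribution P f \x distribution P g]_z h z)%E.
  by apply: eq_measure_integral => A mA _; apply/esym/joint.
have h_int : (distribution P f \x distribution P g)%E.-integrable [set: R * R] h.
  apply: measurable_bounded_integrable => //.
  - move: (joint setT measurableT) => /= ->.
    by rewrite [X in (X < _)%E](probability_setT (distribution P FG)) ltry.
  - exact/measurable_EFinP.
  exists 1; split => // x x1 z _ /=; rewrite (le_trans (prod1 _ _ (phi1 _) (psi1 _)))//.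
  exact: ltW.
have E2 := integral12_prod_meas1 h_int.
have psi_int : P.-integrable [set: T] (EFin \o psi \o g).
  exact: (@rint_bounded (fun w => psi (g w)) 1).
have phi_int : P.-integrable [set: T] (EFin \o phi \o f).
  exact: (@rint_bounded (fun w => phi (f w)) 1).
have mphiE : measurable_fun [set: R] (EFin \o phi) by exact/measurable_EFinP.
have mpsiE : measurable_fun [set: R] (EFin \o psi) by exact/measurable_EFinP.
have Epsi := integral_distribution mpsiE psi_int.
have Ephi := integral_distribution mphiE phi_int.
have psiE : (\int[distribution P g]_y (EFin \o psi) y = (rE (fun w => psi (g w)))%:E)%E.
  by rewrite Epsi /rE /Rintegral fineK//; exact: integrable_fin_num psi_int.
have phiE : (\int[distribution P f]_y (EFin \o phi) y = (rE (fun w => phi (f w)))%:E)%E.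
  by rewrite Ephi /rE /Rintegral fineK//; exact: integrable_fin_num phi_int.
rewrite {1}/rE /Rintegral.
have -> : (\int[P]_w (phi (f w) * psi (g w))%:E = \int[P]_x (h \o FG) x)%E by [].
rewrite -E0 E1 -E2.
have -> : (fun x => \int[distribution P g]_y h (x, y))%E =
          (fun x => (rE (fun w => psi (g w)))%:E * (EFin \o phi) x)%E.
  apply/funext => x; rewrite /h /=; under eq_integral do rewrite EFinM.
  rewrite integralZl//; first by rewrite psiE muleC.
  exact: integrable_pushforward.
rewrite integralZl//; last exact: integrable_pushforward.
by rewrite phiE -EFinM /= mulrC.
Qed.

Lemma measurable_cos : measurable_fun [set: R] (@cos R).
Proof. by apply: continuous_measurable_fun => x; exact: continuous_cos. Qed.

Lemma measurable_sin : measurable_fun [set: R] (@sin R).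
Proof. by apply: continuous_measurable_fun => x; exact: continuous_sin. Qed.

Lemma measurable_scale (a : R) f : measurable_fun [set: T] f ->
  measurable_fun [set: T] (fun w => a * f w).
Proof. by move=> mf; apply: measurable_funM => //; exact: measurable_cst. Qed.

Lemma measurable_cexp s f : measurable_fun [set: T] f ->
  measurable_fun [set: T] (fun w => Re (cexp (s * (f w)%:C%C))) /\
  measurable_fun [set: T] (fun w => Im (cexp (s * (f w)%:C%C))).
Proof.
move=> mf.
have me : measurable_fun [set: T] (fun w => expR (Re s * f w)).
  by apply: (measurableT_comp (@measurable_expR R)); exact: measurable_scale.
have mc : measurable_fun [set: T] (fun w => cos (Im s * f w)).
  by apply: (measurableT_comp measurable_cos); exact: measurable_scale.
have ms : measurable_fun [set: T] (fun w => sin (Im s * f w)).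
  by apply: (measurableT_comp measurable_sin); exact: measurable_scale.
have e1 w : Re (s * (f w)%:C%C) = Re s * f w by rewrite ReM /= mulr0 subr0.
have e2 w : Im (s * (f w)%:C%C) = Im s * f w by rewrite ImM /= mulr0 add0r.
split.
  have := measurable_funM me mc; congr (measurable_fun _ _).
  by apply/funext => w; rewrite /cexp /= e1 e2.
have := measurable_funM me ms; congr (measurable_fun _ _).
by apply/funext => w; rewrite /cexp /= e1 e2.
Qed.

Lemma cintegrable_cexp s f g : measurable_fun [set: T] f -> (forall w, expR (Re s * f w) <= g w) ->
  rint g -> cintegrable P (fun w => cexp (s * (f w)%:C%C)).
Proof.
move=> mf fg; have [mr mi] := measurable_cexp s mf; apply: cintegrable_le mr mi _ => w.
by rewrite cmod_cexp ReM /= mulr0 subr0.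
Qed.

Lemma cintegrable_cexp_le1 s f : measurable_fun [set: T] f -> (forall w, Re s * f w <= 0) ->
  cintegrable P (fun w => cexp (s * (f w)%:C%C)).
Proof.
move=> mf fs; apply: (@cintegrable_cexp s f (fun=> 1)) => //; first by move=> w; rewrite -expR0 ler_expR.
exact: finite_measure_integrable_cst.
Qed.

Lemma cE_cexp_le2 s f : measurable_fun [set: T] f -> (forall w, Re s * f w <= 0) ->
  cmod (cE (fun w => cexp (s * (f w)%:C%C))) <= 2.
Proof.
move=> mf fs; have := @cE_le (fun w => cexp (s * (f w)%:C%C)) (fun=> 1) (cintegrable_cexp_le1 mf fs).
rewrite rE_cst mulr1; apply; first exact: finite_measure_integrable_cst.
by move=> w; rewrite cmod_cexp ReM /= mulr0 subr0 -expR0 ler_expR.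
Qed.

Lemma cexp_imag (t x : R) : cexp (Complex 0 t * x%:C%C) = Complex (cos (t * x)) (sin (t * x)).
Proof.
by apply: complexP; rewrite /cexp /= !mul0r mulr0 subrr expR0 mul1r ?addr0 ?add0r.
Qed.

Lemma independent_cE (f g : {mfun T >-> R}) (a b : R) : independent P f g ->
  cE (fun w => cexp (Complex 0 a * (f w)%:C%C)) * cE (fun w => cexp (Complex 0 b * (g w)%:C%C)) =
  cE (fun w => cexp (Complex 0 a * (f w)%:C%C) * cexp (Complex 0 b * (g w)%:C%C)).
Proof.
move=> ind.
have mk (h : R -> R) c : measurable_fun [set: R] h -> measurable_fun [set: R] (fun x => h (c * x)).
  move=> mh; apply: (measurableT_comp mh); apply: measurable_funM => //.
have mc c := mk _ c measurable_cos; have ms c := mk _ c measurable_sin.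
have c1 x : `|cos x| <= 1 :> R by rewrite ler_norml cos_geN1 cos_le1.
have s1 x : `|sin x| <= 1 :> R by rewrite ler_norml sin_geN1 sin_le1.
have ri (h k : R -> R) : measurable_fun [set: R] h -> measurable_fun [set: R] k ->
    (forall x, `|h x| <= 1) -> (forall x, `|k x| <= 1) -> rint (fun w => h (f w) * k (g w)).
  move=> mh mk' h1 k1; apply: (@rint_bounded _ 1).
    by apply: measurable_funM; apply: measurableT_comp.
  by move=> w; rewrite normrM mulr_ile1.
have cI c (k : T -> R) : (fun w => cexp (Complex 0 c * (k w)%:C%C)) =
    fun w => Complex (cos (c * k w)) (sin (c * k w)).
  by apply/funext => w; rewrite cexp_imag.
have -> : (fun w => cexp (Complex 0 a * (f w)%:C%C) * cexp (Complex 0 b * (g w)%:C%C)) =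
    fun w => Complex (cos (a * f w) * cos (b * g w) + (-1) * (sin (a * f w) * sin (b * g w)))
                     (cos (a * f w) * sin (b * g w) + sin (a * f w) * cos (b * g w)).
  by apply/funext => w; rewrite !cexp_imag; apply: complexP; rewrite ?ReM ?ImM //= mulN1r.
rewrite !cI !cEE; apply: complexP; rewrite ?ReM ?ImM /=.
  rewrite rED; [|exact: (ri _ _ (mc a) (mc b))|apply: rintZ; exact: (ri _ _ (ms a) (ms b))].
  rewrite rEZ; last exact: (ri _ _ (ms a) (ms b)).
  by rewrite (independent_rE ind (mc a) (mc b))// (independent_rE ind (ms a) (ms b))// mulN1r.
rewrite rED; [|exact: (ri _ _ (mc a) (ms b))|exact: (ri _ _ (ms a) (mc b))].
by rewrite (independent_rE ind (mc a) (ms b))// (independent_rE ind (ms a) (mc b)).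
Qed.

Lemma equal_in_law_rE (f g : {mfun T >-> R}) (phi : R -> R) : equal_in_law P f g ->
  measurable_fun [set: R] phi -> (forall x, `|phi x| <= 1) ->
  rE (fun w => phi (f w)) = rE (fun w => phi (g w)).
Proof.
move=> fg mphi phi1.
have int (k : {mfun T >-> R}) : P.-integrable [set: T] ((EFin \o phi) \o k).
  by apply: (@rint_bounded (fun w => phi (k w)) 1) => //; exact: measurableT_comp.
have mE : measurable_fun [set: R] (EFin \o phi) by exact/measurable_EFinP.
rewrite /rE /Rintegral; congr fine.
have := integral_distribution mE (int f); have := integral_distribution mE (int g) => /= <- <-.
by apply: eq_measure_integral => A mA _; exact: fg.
Qed.

Lemma equal_in_law_cE (f g : {mfun T >-> R}) (a : R) : equal_in_law P f g ->
  cE (fun w => cexp (Complex 0 a * (f w)%:C%C)) = cE (fun w => cexp (Complex 0 a * (g w)%:C%C)).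
Proof.
move=> fg.
have mk (h : R -> R) : measurable_fun [set: R] h -> measurable_fun [set: R] (fun x => h (a * x)).
  by move=> mh; apply: (measurableT_comp mh); apply: measurable_funM.
have c1 x : `|cos x| <= 1 :> R by rewrite ler_norml cos_geN1 cos_le1.
have s1 x : `|sin x| <= 1 :> R by rewrite ler_norml sin_geN1 sin_le1.
have cI (k : T -> R) : (fun w => cexp (Complex 0 a * (k w)%:C%C)) =
    fun w => Complex (cos (a * k w)) (sin (a * k w)).
  by apply/funext => w; rewrite cexp_imag.
rewrite !cI !cEE; apply: complexP => /=.
  exact: (equal_in_law_rE fg (mk _ measurable_cos) (fun x => c1 _)).
exact: (equal_in_law_rE fg (mk _ measurable_sin) (fun x => s1 _)).
Qed.

End expectations.

(** * Laplace transforms and Lindley's equation *)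

Section exponential_remainder.
Variable R : realType.
Implicit Types w : R[i].

Lemma cexp_sub1_le w : cmod (cexp w - 1) <= cmod w * expR (cmod w).
Proof.
have A := antider_cexpZ w.
have := antider_le A (M := cmod w * expR (cmod w)).
rewrite mulr1 mulr0 cexp0; apply=> t /andP[t0 t1].
rewrite cmodM mulrC ler_wpM2l ?cmod_ge0// cmod_cexp ler_expR mulrC ReZ.
by rewrite (le_trans (ler_wpM2l t0 (Re_le_cmod w)))// ler_piMl ?cmod_ge0.
Qed.

(** Integrate [cexp_sub1_le] along the segment from 0 to [w]. *)
Lemma cexp_taylor2 w : cmod (cexp w - 1 - w) <= cmod w ^+ 2 * expR (cmod w).
Proof.
have A := antiderD (antider_cexpZ w) (antiderZ (- w) (@antider_id R)).
have := antider_le A (M := cmod w ^+ 2 * expR (cmod w)).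
rewrite !mulr1 !mulr0 cexp0 addr0 (_ : cexp w + - w - 1 = cexp w - 1 - w); last by ring.
apply=> t /andP[t0 t1]; rewrite (_ : _ + - w = (cexp (w * t%:C%C) - 1) * w); last by ring.
rewrite cmodM expr2 mulrAC ler_wpM2r ?cmod_ge0//.
rewrite (le_trans (cexp_sub1_le _))// cmodM cmod_real ger0_norm//.
rewrite ler_pM ?mulr_ge0 ?cmod_ge0 ?expR_ge0//; first by rewrite ler_piMr ?cmod_ge0.
by rewrite ler_expR ler_piMr ?cmod_ge0.
Qed.

Lemma sqr_le_expR (x delta : R) : 0 <= x -> 0 < delta -> x ^+ 2 <= 4 / delta ^+ 2 * expR (delta * x).
Proof.
move=> x0 d0; have h : delta * x / 2 <= expR (delta * x / 2).
  by apply: le_trans (expR_ge1Dx _); rewrite lerDr.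
have h0 : 0 <= delta * x / 2 by rewrite divr_ge0// mulr_ge0// ltW.
have -> : x ^+ 2 = 4 / delta ^+ 2 * (delta * x / 2) ^+ 2 by field; rewrite gt_eqF.
rewrite ler_wpM2l ?divr_ge0 ?exprn_ge0 ?(ltW d0)//.
have -> : expR (delta * x) = expR (delta * x / 2) ^+ 2 by rewrite expr2 -expRD -splitr.
by rewrite lerXn2r ?nnegrE ?expR_ge0.
Qed.

End exponential_remainder.

Section transforms.
Context d (T : measurableType d) (R : realType) (P : probability T R).

Lemma rint_exp_strip (X : T -> R) (eps b : R) : laplace_analytic_in_strip P X eps ->
  - eps < b < eps -> rint P (fun w => expR (b * X w)).
Proof.
move=> [H _] /andP[b1 b2]; have [|h _] := H (- b)%:C%C.
  by rewrite /= ltrN2 b2 ltrNl b1.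
move: h; rewrite /rint; congr (_.-integrable _ _); apply/funext => w.
by rewrite -RtoCN opprK -RtoCM cexp_real.
Qed.

(** Differentiation under the expectation: the second order remainder is
    dominated by a multiple of [exp (b X)] for some [b < eps]. *)
Lemma cder_transform (W X : T -> R) (eps : R) : measurable_fun [set: T] W ->
  (forall w, 0 <= W w <= X w) -> (forall b, 0 < b < eps -> rint P (fun w => expR (b * X w))) ->
  0 < eps -> forall s : R[i], Re s < eps ->
  cder (fun u => cE P (fun w => cexp (u * (W w)%:C%C))) s
       (cE P (fun w => (W w)%:C%C * cexp (s * (W w)%:C%C))).
Proof.
move=> mW WX Xint eps0 s seps e e0.
(* [b] lies between [Re s] and [eps], and [delta] is half of [b - Re s]: one
   [delta] absorbs the increment of [s], the other one the square of [W]. *)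
pose b := (Num.max (Re s) 0 + eps) / 2.
have [sb b0 beps] : [/\ Re s < b, 0 < b & b < eps].
  by rewrite /b; case: (leP (Re s) 0) => h; split; lra.
pose delta := (b - Re s) / 2; have delta0 : 0 < delta by rewrite divr_gt0// subr_gt0.
have W0 w : 0 <= W w by have /andP[] := WX w.
have bX w : expR (b * W w) <= expR (b * X w).
  by rewrite ler_expR ler_wpM2l ?(ltW b0)//; have /andP[] := WX w.
have gint : rint P (fun w => expR (b * X w)) by apply: Xint; rewrite b0.
have int_u (u : R[i]) : Re u <= b -> cintegrable P (fun w => cexp (u * (W w)%:C%C)).
  move=> ub; apply: cintegrable_cexp gint => // w; apply: le_trans (bX w).
  by rewrite ler_expR ler_wpM2r.
have int_s := int_u s (ltW sb).
have [mr mi] := measurable_cexp s mW.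
have taylor_dom h w : cmod h < delta ->
    cmod (cexp ((s + h) * (W w)%:C%C) - cexp (s * (W w)%:C%C) - h * ((W w)%:C%C * cexp (s * (W w)%:C%C)))
    <= cmod h ^+ 2 * (4 / delta ^+ 2) * expR (b * X w).
  move=> hd.
  have -> : cexp ((s + h) * (W w)%:C%C) - cexp (s * (W w)%:C%C) - h * ((W w)%:C%C * cexp (s * (W w)%:C%C))
     = cexp (s * (W w)%:C%C) * (cexp (h * (W w)%:C%C) - 1 - h * (W w)%:C%C).
    by rewrite mulrDl cexpD; ring.
  rewrite cmodM cmod_cexp ReM /= mulr0 subr0.
  rewrite (le_trans (ler_wpM2l (expR_ge0 _) (cexp_taylor2 _)))// cmodM cmod_real ger0_norm//.
  have h2 : 0 <= cmod h ^+ 2 by rewrite exprn_ge0 ?cmod_ge0.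
  rewrite [leLHS](_ : _ = cmod h ^+ 2 * (expR (Re s * W w) * (W w ^+ 2 * expR (cmod h * W w)))); last by ring.
  rewrite -[leRHS]mulrA (ler_wpM2l h2)//.
  have h3 : expR (cmod h * W w) <= expR (delta * W w) by rewrite ler_expR ler_wpM2r// ltW.
  have h4 := ler_pM (sqr_ge0 (W w)) (expR_ge0 _) (sqr_le_expR (W0 w) delta0) h3.
  apply: le_trans (ler_wpM2l (expR_ge0 _) h4) _.
  rewrite [leLHS](_ : _ = 4 / delta ^+ 2 *
    (expR (Re s * W w) * (expR (delta * W w) * expR (delta * W w)))); last by ring.
  rewrite ler_wpM2l ?divr_ge0 ?exprn_ge0 ?(ltW delta0)//.
  rewrite -!expRD (le_trans _ (bX w))// ler_expR le_eqVlt; apply/orP; left; apply/eqP.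
  by rewrite /delta; field.
have int_d : cintegrable P (fun w => (W w)%:C%C * cexp (s * (W w)%:C%C)).
  have hb w : cmod ((W w)%:C%C * cexp (s * (W w)%:C%C)) <= (1 + 4 / delta ^+ 2) * expR (b * X w).
    rewrite cmodM cmod_real ger0_norm// cmod_cexp ReM /= mulr0 subr0.
    apply: (@le_trans _ _ ((1 + 4 / delta ^+ 2) * (expR (delta * W w) * expR (Re s * W w)))).
      rewrite mulrA ler_wpM2r ?expR_ge0//.
      have h1 : W w <= 1 + W w ^+ 2 by have := sqr_ge0 (W w - 1); have := W0 w; nra.
      have h2 : 1 <= expR (delta * W w) by rewrite -expR0 ler_expR mulr_ge0// ltW.
      by rewrite (le_trans h1)// mulrDl mul1r lerD// sqr_le_expR.
    rewrite ler_wpM2l ?addr_ge0 ?divr_ge0 ?exprn_ge0 ?(ltW delta0)//.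
    rewrite -expRD (le_trans _ (bX w))// ler_expR -mulrDl ler_wpM2r//.
    by move: delta0; rewrite /delta; lra.
  apply: cintegrable_le hb (rintZ _ gint).
    have := measurable_funM mW mr; congr (measurable_fun _ _).
    by apply/funext => w; rewrite ReZ.
  have := measurable_funM mW mi; congr (measurable_fun _ _).
  by apply/funext => w; rewrite ImZ.
set g := fun w => expR (b * X w) in gint.
pose C := 2 * (4 / delta ^+ 2 * rE P g) + 1.
have gE0 : 0 <= rE P g by apply: rE_ge0 => w; exact: expR_ge0.
have C0 : 0 < C.
  by rewrite ltr_wpDl// !mulr_ge0 ?invr_ge0 ?exprn_ge0 ?(ltW delta0).
exists (Num.min delta (e / C)); split; first by rewrite minr_gt0// divr_gt0.
move=> h; rewrite lt_min => /andP[hd he].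
have shb : Re (s + h) <= b.
  have := Re_le_cmod h; rewrite ReD; move: hd; rewrite /delta; lra.
have int_sh := int_u _ shb.
have int_n c F : cintegrable P F -> cintegrable P (fun w => c * F w) by exact: cintegrableZ.
have -> : cE P (fun w => cexp ((s + h) * (W w)%:C%C)) - cE P (fun w => cexp (s * (W w)%:C%C))
    - h * cE P (fun w => (W w)%:C%C * cexp (s * (W w)%:C%C)) =
    cE P (fun w => cexp ((s + h) * (W w)%:C%C) + ((-1) * cexp (s * (W w)%:C%C)
      + (- h) * ((W w)%:C%C * cexp (s * (W w)%:C%C)))).
  rewrite cE_D//; last by apply: cintegrableD; exact: int_n.
  by rewrite cE_D ?cE_Z//; [ring|exact: int_n|exact: int_n].
apply: le_trans (cE_le _ (rintZ (cmod h ^+ 2 * (4 / delta ^+ 2)) gint) _) _.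
- by apply: cintegrableD => //; apply: cintegrableD; exact: int_n.
- move=> w; have := taylor_dom h w hd; congr (cmod _ <= _); ring.
rewrite rEZ//; have h0 := cmod_ge0 h.
have -> : 2 * (cmod h ^+ 2 * (4 / delta ^+ 2) * rE P g) = cmod h * (cmod h * (C - 1)).
  by rewrite /C; ring.
rewrite [leRHS]mulrC ler_wpM2l//; move: he; rewrite ltr_pdivlMr// => he.
by apply: le_trans (ltW he); rewrite ler_wpM2l// gerBl.
Qed.

(** Pointwise, [exp (- s max (v, 0)) = exp (- s v) + 1 - exp (s max (- v, 0))];
    Lindley's equation turns the expectation of this identity into the product
    form on the imaginary axis, where all the variables are bounded. *)
Lemma lindley_identity (X Y V : {mfun T >-> R}) (t : R) :
  independent P X Y -> independent P V (fun w => Y w - X w) ->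
  equal_in_law P V (fun w => Num.max (V w + (Y w - X w)) 0) ->
  (laplace P Y (Complex 0 t) * laplace P X (- Complex 0 t) - 1) * laplace P V (Complex 0 t) =
  cE P (fun w => cexp (Complex 0 t * (Num.max (- (V w + (Y w - X w))) 0)%:C%C)) - 1.
Proof.
move=> XY VU EL.
have mX : measurable_fun [set: T] X by exact: measurable_funP.
have mY : measurable_fun [set: T] Y by exact: measurable_funP.
have mV : measurable_fun [set: T] V by exact: measurable_funP.
have mU : measurable_fun [set: T] (fun w => Y w - X w) by exact: measurable_funB.
have mZ : measurable_fun [set: T] (fun w => V w + (Y w - X w)) by exact: measurable_funD.
have mM : measurable_fun [set: T] (fun w => Num.max (V w + (Y w - X w)) 0).
  by apply: measurable_maxr.
have mW : measurable_fun [set: T] (fun w => Num.max (- (V w + (Y w - X w))) 0).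
  apply: measurable_maxr => //; exact: (measurableT_comp (@oppr_measurable R setT)).
pose U : {mfun T >-> R} := HB.pack (fun w => Y w - X w) (isMeasurableFun.Build _ _ _ _ _ mU).
pose M : {mfun T >-> R} := HB.pack (fun w => Num.max (V w + (Y w - X w)) 0)
  (isMeasurableFun.Build _ _ _ _ _ mM).
have Nt : - Complex 0 t = Complex 0 (- t) :> R[i] by apply: complexP; rewrite //= oppr0.
have NNt : - Complex 0 (- t) = Complex 0 t :> R[i] by rewrite -Nt opprK.
have EY : laplace P Y (Complex 0 t) = cE P (fun w => cexp (Complex 0 (- t) * (Y w)%:C%C)).
  by rewrite /laplace Nt.
have EX : laplace P X (- Complex 0 t) = cE P (fun w => cexp (Complex 0 t * (X w)%:C%C)).
  by rewrite /laplace opprK.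
have EV : laplace P V (Complex 0 t) = cE P (fun w => cexp (Complex 0 (- t) * (V w)%:C%C)).
  by rewrite /laplace Nt.
have EU : cE P (fun w => cexp (Complex 0 t * (X w)%:C%C)) *
    cE P (fun w => cexp (Complex 0 (- t) * (Y w)%:C%C)) =
    cE P (fun w => cexp (Complex 0 (- t) * (U w)%:C%C)).
  rewrite (independent_cE _ _ XY); congr (cE P _); apply/funext => w.
  by rewrite -cexpD; congr cexp; rewrite /= -Nt RtoCB; ring.
have int1 (k : T -> R) : measurable_fun [set: T] k ->
    forall a : R, cintegrable P (fun w => cexp (Complex 0 a * (k w)%:C%C)).
  by move=> mk a; apply: cintegrable_cexp_le1 => // w; rewrite /= mul0r.
have EVU : cE P (fun w => cexp (Complex 0 (- t) * (V w)%:C%C)) *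
    cE P (fun w => cexp (Complex 0 (- t) * (U w)%:C%C)) =
    cE P (fun w => cexp (Complex 0 (- t) * (V w + (Y w - X w))%:C%C)).
  rewrite (@independent_cE _ _ _ _ V U _ _ VU); congr (cE P _); apply/funext => w.
  by rewrite -cexpD; congr cexp; rewrite /= RtoCD; ring.
have EM := @equal_in_law_cE _ _ _ P V M (- t) EL.
have EM2 : cE P (fun w => cexp (Complex 0 (- t) * (M w)%:C%C)) =
   cE P (fun w => cexp (Complex 0 (- t) * (V w + (Y w - X w))%:C%C)
     + (1 + (-1) * cexp (Complex 0 t * (Num.max (- (V w + (Y w - X w))) 0)%:C%C))).
  congr (cE P _); apply/funext => w /=; move: (V w + (Y w - X w)) => v.
  rewrite -Nt; have [v0|v0] := leP 0 v.
    have -> : Num.max (- v) 0 = 0 by apply/max_idPr; rewrite oppr_le0.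
    by rewrite mulr0 cexp0; ring.
  have -> : Num.max (- v) 0 = - v by apply/max_idPl; rewrite oppr_ge0 ltW.
  by rewrite mulr0 cexp0 RtoCN mulrN (mulNr (Complex 0 t)); ring.
have int_c1 : cintegrable P (fun=> 1).
  have := int1 _ mV 0; congr cintegrable; apply/funext => w.
  by rewrite (_ : Complex 0 0 = 0)// mul0r cexp0.
have c1E : cE P (fun=> 1) = 1 by rewrite cEE !rE_cst.
rewrite EM2 cE_D in EM; [|exact: int1|apply: cintegrableD => //; apply: cintegrableZ; exact: int1].
rewrite cE_D// in EM; last by apply: cintegrableZ; exact: int1.
rewrite cE_Z in EM; last exact: int1.
rewrite c1E in EM; rewrite EY EX EV [X in (X - 1) * _]mulrC EU mulrBl mul1r mulrC EVU.
by rewrite {1}EM; ring.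
Qed.

End transforms.

(** * Growth of the product on the negative real axis *)

Section log_sums.
Variable R : realType.
Implicit Types (x y t : R).

(** An antiderivative of [y |-> ln (1 + x ^+ 2 / y ^+ 2)]; it increases from 0
    to [pi * x] on the positive axis. *)
Definition Lambda x y := y * (ln (y ^+ 2 + x ^+ 2) - 2 * ln y) + 2 * x * atan (y / x).

Definition ell x y := ln (1 + x ^+ 2 / y ^+ 2).

Lemma ellE x y : 0 < x -> 0 < y -> ell x y = ln (y ^+ 2 + x ^+ 2) - 2 * ln y.
Proof.
move=> x0 y0; have y2 : 0 < y ^+ 2 by rewrite exprn_gt0.
have -> : 2 * ln y = ln (y ^+ 2) by rewrite lnXn// mulr_natl.
rewrite -ln_div ?posrE ?addr_gt0 ?exprn_gt0//.
by rewrite mulrDl divff ?gt_eqF.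
Qed.

Lemma is_derive_Lambda x y : 0 < x -> 0 < y -> is_derive y 1 (Lambda x) (ell x y).
Proof.
move=> x0 y0; rewrite (ellE x0 y0).
have yx : 0 < y ^+ 2 + x ^+ 2 by rewrite addr_gt0 ?exprn_gt0.
have d1 : is_derive y 1 (fun u : R => u ^+ 2 + x ^+ 2) (2 * y).
  by apply: is_derive_eq; rewrite /GRing.scale /=; ring.
have d2 := @is_derive1_comp _ (@ln R) (fun u : R => u ^+ 2 + x ^+ 2) y _ _ (is_derive1_ln yx) d1.
have d3 : is_derive y 1 (fun u : R => u / x) x^-1.
  by apply: is_derive_eq; rewrite /GRing.scale /=; ring.
have d4 := @is_derive1_comp _ (@atan R) (fun u : R => u / x) y _ _ (is_derive1_atan (y / x)) d3.
have d5 := is_derive1_ln y0.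
have E : Lambda x = (fun u => u * ((@ln R \o (fun u : R => u ^+ 2 + x ^+ 2)) u - 2 * ln u)
   + 2 * x * (@atan R \o (fun u : R => u / x)) u) by [].
rewrite E; apply: is_derive_eq; rewrite /GRing.scale /= .
have xn : x != 0 by rewrite gt_eqF.
have yn : y != 0 by rewrite gt_eqF.
have zn : y ^+ 2 + x ^+ 2 != 0 by rewrite gt_eqF.
have zn' : 1 + (y / x) ^+ 2 != 0.
  by rewrite gt_eqF// ltr_pwDl// sqr_ge0.
have -> : (1 + (y / x) ^+ 2)^-1 = x ^+ 2 / (y ^+ 2 + x ^+ 2).
  have -> : 1 + (y / x) ^+ 2 = (y ^+ 2 + x ^+ 2) / x ^+ 2 by field.
  by rewrite invf_div.
move: (ln _) (ln _) => u v; field; by rewrite ?zn ?yn ?xn.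
Qed.

Lemma ell_ge0 x y : 0 <= ell x y.
Proof. by rewrite ln_ge0// lerDl divr_ge0 ?sqr_ge0. Qed.

Lemma ell_decr x y y' : 0 < y -> y <= y' -> ell x y' <= ell x y.
Proof.
move=> y0 yy; have y'0 := lt_le_trans y0 yy.
have p u : 0 < u -> 0 < 1 + x ^+ 2 / u ^+ 2.
  by move=> u0; rewrite ltr_pwDl// divr_ge0 ?sqr_ge0.
rewrite ler_ln ?posrE ?p// lerD2l ler_wpM2l ?sqr_ge0//.
by rewrite lef_pV2 ?posrE ?exprn_gt0// lerXn2r ?nnegrE ?(ltW y0) ?(ltW y'0).
Qed.

(** By the mean value theorem, [ell x] being decreasing. *)
Lemma Lambda_step x (k : nat) : 0 < x -> (0 < k)%N ->
  ell x k.+1%:R <= Lambda x k.+1%:R - Lambda x k%:R <= ell x k%:R.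
Proof.
move=> x0 k0; have kr : (0 : R) < k%:R by rewrite ltr0n.
have kk : (k%:R : R) < k.+1%:R by rewrite ltr_nat.
have [||c ck ->] := @MVT R (Lambda x) (ell x) k%:R k.+1%:R kk.
- move=> y; rewrite in_itv /= => /andP[ky _]; apply: is_derive_Lambda => //.
  exact: lt_trans ky.
- apply: derivable_within_continuous => y; rewrite in_itv /= => /andP[ky _].
  by have [] := is_derive_Lambda x0 (lt_le_trans kr ky).
have -> : k.+1%:R - k%:R = 1 :> R by rewrite -natr1; ring.
rewrite mulr1.
move: ck; rewrite in_itv /= => /andP[kc ck].
by rewrite (ell_decr _ (lt_trans kr kc) (ltW ck)) (ell_decr _ kr (ltW kc)).
Qed.

Lemma Lambda_sum_upper x (K N : nat) : 0 < x -> (0 < K)%N -> (K <= N)%N ->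
  \sum_(K.+1 <= k < N.+1) ell x k%:R <= Lambda x N%:R - Lambda x K%:R.
Proof.
move=> x0 K0; elim: N => [|N IH] KN; first by move: K0 KN; case: (K).
move: KN; rewrite leq_eqVlt => /orP[/eqP <-|KN].
  by rewrite big_geq// subrr.
rewrite big_nat_recr//=; have /andP[h _] := Lambda_step x0 (leq_trans K0 KN).
by have := IH KN; lra.
Qed.

Lemma Lambda_sum_lower x (K N : nat) : 0 < x -> (K <= N)%N ->
  Lambda x N.+1%:R - Lambda x K.+1%:R <= \sum_(K.+1 <= k < N.+1) ell x k%:R.
Proof.
move=> x0; elim: N => [|N IH] KN.
  by move: KN; rewrite leqn0 => /eqP ->; rewrite big_geq// subrr.
move: KN; rewrite leq_eqVlt => /orP[/eqP <-|KN].
  by rewrite big_geq// subrr.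
rewrite big_nat_recr//=; have /andP[_ h] := Lambda_step x0 (ltn0Sn N).
by have := IH KN; lra.
Qed.

Lemma atan_le y : 0 <= y -> atan y <= y.
Proof.
rewrite le_eqVlt => /orP[/eqP <-|y0]; first by rewrite atan0.
have [|c c01] := @MVT R (@atan R) _ 0 y y0 (fun x _ => is_derive1_atan x).
  apply: derivable_within_continuous => x _; exact: derivable_atan.
rewrite atan0 !subr0 => ->; rewrite ler_piMl ?(ltW y0)// invf_le1 ?lerDl ?sqr_ge0//.
by rewrite ltr_pwDl// sqr_ge0.
Qed.

(** [Lambda x] is at most [pi x + x^2 / y] at [y]. *)
Lemma ell_sum_upper x (K : nat) : 0 < x -> (0 < K)%N -> exists N0 : nat, forall N, (N0 <= N)%N ->
  \sum_(K.+1 <= k < N.+1) ell x k%:R <= pi * x + 1.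
Proof.
move=> x0 K0; have [N1 HN] := natr_large (x ^+ 2).
exists (maxn K N1) => N; rewrite geq_max => /andP[KN /HN xN].
have N0 : (0 : R) < N%:R by rewrite ltr0n (leq_trans K0).
have K0' : (0 : R) < K%:R by rewrite ltr0n.
have := Lambda_sum_upper x0 K0 KN.
have LK : 0 <= Lambda x K%:R.
  rewrite /Lambda -ellE// addr_ge0// mulr_ge0 ?ell_ge0 ?mulr_ge0 ?(ltW x0) ?(ltW K0')//.
  by rewrite -(@atan0 R); apply: le_atan; rewrite divr_ge0 ?(ltW x0) ?(ltW K0').
have LN : Lambda x N%:R <= 1 + pi * x.
  rewrite /Lambda -ellE// lerD//.
    have : ell x N%:R <= x ^+ 2 / N%:R ^+ 2.
      by apply: le_ln1Dx; rewrite (lt_le_trans (_ : -1 < 0))// ?divr_ge0 ?sqr_ge0// oppr_lt0.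
    move=> /(ler_wpM2l (ltW N0)) /le_trans; apply.
    rewrite [leLHS](_ : _ = x ^+ 2 / N%:R); last by field; rewrite gt_eqF.
    by rewrite ler_pdivrMr// mul1r.
  have := atan_ltpi2 (N%:R / x) => /ltW /(ler_wpM2l (_ : 0 <= 2 * x)) h.
  apply: le_trans (h _) _; first by rewrite mulr_ge0 ?(ltW x0).
  by move: (@pi R) => p; rewrite le_eqVlt; apply/orP; left; apply/eqP; field.
lra.
Qed.

Lemma ell_sum_lower x (K : nat) (e : R) : 0 < x -> 0 < e -> exists N0 : nat, forall N, (N0 <= N)%N ->
  (pi - e) * x - K.+1%:R * ell x K.+1%:R - 2 * K.+1%:R <= \sum_(K.+1 <= k < N.+1) ell x k%:R.
Proof.
move=> x0 e0; have e2 : 0 < e / 2 by rewrite divr_gt0.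
have /cvgrPdist_le /(_ _ e2) [B [Br HB]] := @cvgy_atan R.
have [N1 HN] := natr_large ((B + 1) * x).
exists (maxn K N1) => N; rewrite geq_max => /andP[KN NN].
have := HN N.+1 (leqW NN) => xN.
have BN : B < N.+1%:R / x.
  by apply: (@lt_le_trans _ _ (B + 1)); rewrite ?ltrDl// ler_pdivlMr.
have := HB _ BN; rewrite /= => h1.
have {h1} at_ge : pi / 2 - e / 2 <= atan (N.+1%:R / x).
  by move: h1; rewrite ler_norml; lra.
have := Lambda_sum_lower x0 KN; apply: le_trans.
have N0 : (0 : R) < N.+1%:R by rewrite ltr0n.
have K0 : (0 : R) < K.+1%:R by rewrite ltr0n.
rewrite /Lambda -!ellE//.
have h1 : 0 <= N.+1%:R * ell x N.+1%:R by rewrite mulr_ge0 ?ell_ge0 ?(ltW N0).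
have h2 : 2 * x * (pi / 2 - e / 2) <= 2 * x * atan (N.+1%:R / x).
  by rewrite ler_wpM2l// mulr_ge0 ?(ltW x0).
have h3 : 2 * x * atan (K.+1%:R / x) <= 2 * K.+1%:R.
  have := @atan_le (K.+1%:R / x); rewrite divr_ge0 ?(ltW x0) ?(ltW K0)// => /(_ isT).
  move=> /(ler_wpM2l (_ : 0 <= 2 * x)) h; apply: le_trans (h _) _; first by rewrite mulr_ge0 ?(ltW x0).
  by rewrite le_eqVlt; apply/orP; left; apply/eqP; field; rewrite gt_eqF.
have h4 : 2 * x * (pi / 2 - e / 2) = (pi - e) * x by move: (@pi R) => p; field.
lra.
Qed.

(** Sublinear growth in additive form: closed under sums without any limit. *)
Definition sublin (phi : R -> R) := forall delta : R, 0 < delta ->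
  exists C : R, forall t, 1 <= t -> phi t <= delta * t + C.

Lemma sublinD phi psi : sublin phi -> sublin psi -> sublin (fun t => phi t + psi t).
Proof.
move=> h1 h2 e e0; have e2 : 0 < e / 2 by rewrite divr_gt0.
have [C1 H1] := h1 _ e2; have [C2 H2] := h2 _ e2; exists (C1 + C2) => t t1.
by have := H1 t t1; have := H2 t t1; lra.
Qed.

Lemma sublin_cst c : sublin (fun=> c).
Proof. by move=> e e0; exists c => t t1; rewrite lerDr mulr_ge0 ?(ltW e0)// (le_trans ler01). Qed.

Lemma sublinZ c phi : 0 <= c -> sublin phi -> sublin (fun t => c * phi t).
Proof.
move=> c0 h e e0; have c1 : 0 < c + 1 by rewrite ltr_wpDl.
have [C HC] := h _ (divr_gt0 e0 c1); exists (c * C) => t t1.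
apply: le_trans (ler_wpM2l c0 (HC t t1)) _; rewrite mulrDr lerD2r mulrA.
rewrite ler_wpM2r ?(le_trans ler01)// mulrA ler_pdivrMr// mulrC ler_wpM2l ?(ltW e0)//.
by rewrite lerDl.
Qed.

Lemma sublin_le phi psi : (forall t, 1 <= t -> phi t <= psi t) -> sublin psi -> sublin phi.
Proof.
move=> h H e e0; have [C HC] := H e e0; exists C => t t1.
exact: le_trans (h t t1) (HC t t1).
Qed.

Lemma sublin_ln : sublin (@ln R).
Proof.
move=> e e0; exists (- ln e) => t t1; have t0 := lt_le_trans ltr01 t1.
have et : 0 < e * t by rewrite mulr_gt0.
have := ltW (ln_sublinear et); rewrite lnM ?posrE//; lra.
Qed.

Lemma sublin_ln_quad (a b : R) : 0 <= a -> 0 <= b -> sublin (fun t => ln (1 + a * t + b * t ^+ 2)).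
Proof.
move=> a0 b0; have p : 0 < 1 + a + b by rewrite ltr_pwDl// addrC ltr_pwDr.
apply: (@sublin_le _ (fun t => ln (1 + a + b) + 2 * ln t)); last first.
  by apply: sublinD; [exact: sublin_cst|apply: sublinZ => //; exact: sublin_ln].
move=> t t1; have t0 := lt_le_trans ltr01 t1.
rewrite (_ : 2 * ln t = ln (t ^+ 2)); last by rewrite lnXn// mulr_natl.
have tt : t <= t ^+ 2 by rewrite expr2 ler_peMr// ltW.
have t2 : 0 < t ^+ 2 by rewrite exprn_gt0.
have at0 : 0 <= a * t by rewrite mulr_ge0// ltW.
have bt0 : 0 <= b * t ^+ 2 by rewrite mulr_ge0// ltW.
rewrite -lnM ?posrE// ler_ln ?posrE ?mulr_gt0//; last by lra.
have := ler_wpM2l a0 tt; nra.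
Qed.

Lemma sublin_sum (F : nat -> R -> R) (K : nat) : (forall k, (0 < k)%N -> sublin (F k)) ->
  sublin (fun t => \sum_(1 <= k < K.+1) F k t).
Proof.
move=> H; elim: K => [|K IH].
  by apply: sublin_le (sublin_cst 0) => t _; rewrite big_geq.
apply: sublin_le (sublinD IH (H K.+1 (ltn0Sn K))) => t _.
by rewrite big_nat_recr.
Qed.

Lemma linear_le_sublin (c X : R) phi : sublin phi ->
  (forall t, 1 <= t -> c * t <= X * t + phi t) -> c <= X.
Proof.
move=> hphi H; rewrite leNgt; apply/negP => cX.
have e0 : 0 < (c - X) / 2 by rewrite divr_gt0// subr_gt0.
have [C HC] := hphi _ e0.
pose t := 1 + 2 * `|C| / (c - X).
have cX0 : 0 < c - X by rewrite subr_gt0.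
have t1 : 1 <= t by rewrite lerDl divr_ge0 ?mulr_ge0 ?(ltW cX0).
have := H t t1; have := HC t t1.
have E : (c - X) * t = (c - X) + 2 * `|C| by rewrite /t; field; rewrite gt_eqF.
have := ler_norm C; lra.
Qed.

Section exponent.
Variables (a b cN : nat -> R) (c q m m' : R).
Hypothesis q0 : 0 < q.
Hypothesis m0 : 0 < m.
Hypothesis m'0 : 0 < m'.
Hypothesis a_ge0 : forall k, (0 < k)%N -> 0 <= a k.
Hypothesis b_ge0 : forall k, (0 < k)%N -> 0 <= b k.
Hypothesis a_tail : forall e : R, 0 < e -> exists K0 : nat, forall K N, (K0 <= K)%N -> (K <= N)%N ->
  \sum_(K.+1 <= k < N.+1) a k <= e.
Hypothesis b_asym : forall e : R, 0 < e < q -> exists K0 : nat, forall k, (K0 <= k)%N ->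
  (q - e) ^+ 2 <= b k * k%:R ^+ 2 <= (q + e) ^+ 2.
Hypothesis cN_lim : forall e : R, 0 < e -> exists N0 : nat, forall N, (N0 <= N)%N -> `|cN N - c| <= e.
Hypothesis prod_lim : forall t, 1 <= t -> exists N0 : nat, forall N, (N0 <= N)%N ->
  m / t <= \prod_(1 <= k < N.+1) (1 + a k * t + b k * t ^+ 2) * expR (- (cN N * t)) <= m' / t.

Let fac_gt0 k t : (0 < k)%N -> 0 <= t -> 0 < 1 + a k * t + b k * t ^+ 2.
Proof.
by move=> k0 t0; rewrite ltr_wpDr ?mulr_ge0 ?sqr_ge0 ?b_ge0// ltr_wpDr ?mulr_ge0 ?a_ge0.
Qed.

Let ln_prod N t : 0 <= t ->
  ln (\prod_(1 <= k < N.+1) (1 + a k * t + b k * t ^+ 2)) =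
  \sum_(1 <= k < N.+1) ln (1 + a k * t + b k * t ^+ 2).
Proof.
move=> t0; elim: N => [|N IH]; first by rewrite !big_geq// ln1.
rewrite big_nat_recr//= [in RHS]big_nat_recr//= lnM ?IH ?posrE ?fac_gt0//.
elim: N {IH} => [|N IH]; first by rewrite big_geq.
by rewrite big_nat_recr//= mulr_gt0// fac_gt0.
Qed.

Let prod_gt0 N t : 0 <= t -> 0 < \prod_(1 <= k < N.+1) (1 + a k * t + b k * t ^+ 2).
Proof.
move=> t0; elim: N => [|N IH]; first by rewrite big_geq.
by rewrite big_nat_recr//= mulr_gt0// fac_gt0.
Qed.

Let ln_lim t : 1 <= t -> exists N0 : nat, forall N, (N0 <= N)%N ->
  ln m - ln t + cN N * t <= \sum_(1 <= k < N.+1) ln (1 + a k * t + b k * t ^+ 2)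
    <= ln m' - ln t + cN N * t.
Proof.
move=> t1; have t0 := lt_le_trans ltr01 t1; have [N0 H] := prod_lim t1; exists N0 => N /H.
have P0 := prod_gt0 N (ltW t0).
rewrite -ln_prod ?(ltW t0)// => /andP[h1 h2].
have E : ln (\prod_(1 <= k < N.+1) (1 + a k * t + b k * t ^+ 2) * expR (- (cN N * t))) =
   ln (\prod_(1 <= k < N.+1) (1 + a k * t + b k * t ^+ 2)) - cN N * t.
  by rewrite lnM ?posrE ?expR_gt0// expRK.
have X0 : 0 < \prod_(1 <= k < N.+1) (1 + a k * t + b k * t ^+ 2) * expR (- (cN N * t)).
  by rewrite mulr_gt0 ?expR_gt0.
have a1 : ln (m / t) <= ln (\prod_(1 <= k < N.+1) (1 + a k * t + b k * t ^+ 2) * expR (- (cN N * t))).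
  by rewrite ler_ln ?posrE ?divr_gt0.
have a2 : ln (\prod_(1 <= k < N.+1) (1 + a k * t + b k * t ^+ 2) * expR (- (cN N * t))) <= ln (m' / t).
  by rewrite ler_ln ?posrE ?divr_gt0.
by move: a1 a2; rewrite E !ln_div ?posrE//; lra.
Qed.

(** The factors with [k <= K] contribute [o (t)]; beyond [K], compare [b_k] with
    [(q + e)^2 / k^2] and bound the logarithm of [1 + a_k t] by [a_k t]. *)
Lemma exponent_le : c <= pi * q.
Proof.
apply/ler_addgt0Pr => e e0; have p0 := pi_gt0 R.
pose e1 := Num.min (q / 2) (e / (pi + 2)).
have pi2 : 0 < pi + 2 :> R by rewrite addr_gt0.
have e10 : 0 < e1 by rewrite lt_min !divr_gt0.
have e1q : e1 < q by rewrite gt_min ltr_pdivrMr// ltr_pMr// ltr1n.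
have e1e : pi * e1 + 2 * e1 <= e by rewrite -mulrDl mulrC -ler_pdivlMr// ge_min lexx orbT.
have [K1 HK1] := a_tail e10; have [|K2 HK2] := b_asym (e := e1); first by rewrite e10.
pose K := maxn 1 (maxn K1 K2).
have K0 : (0 < K)%N by rewrite leq_max.
have KK1 : (K1 <= K)%N by rewrite !leq_max leqnn !orbT.
have KK2 : (K2 <= K)%N by rewrite !leq_max leqnn !orbT.
clearbody K.
have qe0 : 0 < q + e1 by rewrite addr_gt0.
pose S t := \sum_(1 <= k < K.+1) ln (1 + a k * t + b k * t ^+ 2).
have Ssub : sublin S by apply: sublin_sum => k k0; apply: sublin_ln_quad; [exact: a_ge0|exact: b_ge0].
apply: le_trans (_ : _ <= pi * q + (pi * e1 + 2 * e1)) _; last by rewrite lerD2l.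
apply: (@linear_le_sublin _ _ (fun t => S t + (ln t + (1 - ln m)))).
  by apply: sublinD => //; apply: sublinD; [exact: sublin_ln|exact: sublin_cst].
move=> t t1; have t0 := lt_le_trans ltr01 t1.
have qt0 : 0 < (q + e1) * t by rewrite mulr_gt0.
have [N1 HN1] := ln_lim t1; have [N2 HN2] := cN_lim e10.
have [N3 HN3] := ell_sum_upper qt0 K0.
pose N := maxn (maxn K N1) (maxn N2 N3).
have KN : (K <= N)%N by rewrite !leq_max leqnn.
have /HN1/andP[L1 _] : (N1 <= N)%N by rewrite !leq_max leqnn !orbT.
have /HN2 : (N2 <= N)%N by rewrite !leq_max leqnn !orbT.
have /HN3 L3 : (N3 <= N)%N by rewrite !leq_max leqnn !orbT.
rewrite ler_norml => /andP[L2 _].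
have AT := HK1 K N KK1 KN.
have tail : \sum_(K.+1 <= k < N.+1) ln (1 + a k * t + b k * t ^+ 2) <=
    \sum_(K.+1 <= k < N.+1) (ell ((q + e1) * t) k%:R + a k * t).
  rewrite big_nat_cond [leRHS]big_nat_cond; apply: ler_sum => k /andP[/andP[Kk _] _].
  have k0 : (0 < k)%N by exact: leq_trans Kk.
  have kr : (0 : R) < k%:R by rewrite ltr0n.
  have bt : b k * t ^+ 2 <= ((q + e1) * t) ^+ 2 / k%:R ^+ 2.
    have /HK2/andP[_ h] : (K2 <= k)%N by exact: leq_trans KK2 (ltnW Kk).
    by rewrite ler_pdivlMr ?exprn_gt0// mulrAC exprMn ler_wpM2r// exprn_ge0// ltW.
  have ak := a_ge0 k0; have at0 : 0 <= a k * t by rewrite mulr_ge0// ltW.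
  have bk0 : 0 <= b k * t ^+ 2 by rewrite mulr_ge0 ?b_ge0 ?sqr_ge0.
  apply: (@le_trans _ _ (ln ((1 + ((q + e1) * t) ^+ 2 / k%:R ^+ 2) * (1 + a k * t)))).
    rewrite ler_ln ?posrE ?fac_gt0 ?(ltW t0)//; last first.
      by rewrite mulr_gt0//; lra.
    have : 0 <= ((q + e1) * t) ^+ 2 / k%:R ^+ 2 * (a k * t) by rewrite mulr_ge0// (le_trans bk0).
    by move: bt; nra.
  rewrite lnM ?posrE; [|lra|lra].
  by rewrite lerD// le_ln1Dx//; lra.
have SN : \sum_(1 <= k < N.+1) ln (1 + a k * t + b k * t ^+ 2) =
    S t + \sum_(K.+1 <= k < N.+1) ln (1 + a k * t + b k * t ^+ 2).
  by rewrite /S -big_cat_nat//= ltnS.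
move: tail; rewrite big_split /= -mulr_suml => tail.
have AT' := ler_wpM2r (ltW t0) AT.
have L2' := ler_wpM2r (ltW t0) L2.
move: L1; rewrite SN; move: L2' L3 tail AT'.
move: (\sum_(K.+1 <= k < N.+1) ell _ _) (\sum_(K.+1 <= k < N.+1) ln _)
  (\sum_(K.+1 <= k < N.+1) a k) => A B D; lra.
Qed.

(** Drop the terms [a_k t] and the factors with [k <= K], and compare [b_k] with
    [(q - e)^2 / k^2]. *)
Lemma exponent_ge : pi * q <= c.
Proof.
apply/ler_addgt0Pr => e e0; have p0 := pi_gt0 R.
pose e1 := Num.min (q / 2) (e / (q + (pi + 1))).
have pi2 : 0 < q + (pi + 1) :> R by rewrite addr_gt0 // addr_gt0.
have e10 : 0 < e1 by rewrite lt_min !divr_gt0.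
have e1q : e1 < q by rewrite gt_min ltr_pdivrMr// ltr_pMr// ltr1n.
have e1e : q * e1 + (pi * e1 + 1 * e1) <= e.
  by rewrite -!mulrDl mulrC -ler_pdivlMr// ge_min lexx orbT.
have [|K2 HK2] := b_asym (e := e1); first by rewrite e10.
pose K := maxn 1 K2.
have KK2 : (K2 <= K)%N by rewrite !leq_max leqnn !orbT.
clearbody K.
have qe0 : 0 < q - e1 by rewrite subr_gt0.
rewrite -lerBlDr; apply: le_trans (_ : _ <= (pi - e1) * (q - e1) - e1) _; first by nra.
have ellS : sublin (fun t => ell ((q - e1) * t) K.+1%:R).
  apply: sublin_le (sublin_ln_quad (lexx 0) (_ : 0 <= (q - e1) ^+ 2 / K.+1%:R ^+ 2)).
    by move=> t _; rewrite /ell mul0r addr0 exprMn mulrAC.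
  by rewrite divr_ge0 ?sqr_ge0.
apply: (@linear_le_sublin _ _ (fun t => K.+1%:R * ell ((q - e1) * t) K.+1%:R + (2 * K.+1%:R + ln m'))).
  by apply: sublinD; [apply: sublinZ|exact: sublin_cst].
move=> t t1; have t0 := lt_le_trans ltr01 t1.
have qt0 : 0 < (q - e1) * t by rewrite mulr_gt0.
have [N1 HN1] := ln_lim t1; have [N2 HN2] := cN_lim e10.
have [N3 HN3] := ell_sum_lower K qt0 e10.
pose N := maxn (maxn K N1) (maxn N2 N3).
have KN : (K <= N)%N by rewrite !leq_max leqnn.
have /HN1/andP[_ L1] : (N1 <= N)%N by rewrite !leq_max leqnn !orbT.
have /HN2 : (N2 <= N)%N by rewrite !leq_max leqnn !orbT.
have /HN3 L3 : (N3 <= N)%N by rewrite !leq_max leqnn !orbT.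
rewrite ler_norml => /andP[_ L2].
have tail : \sum_(K.+1 <= k < N.+1) ell ((q - e1) * t) k%:R <=
    \sum_(K.+1 <= k < N.+1) ln (1 + a k * t + b k * t ^+ 2).
  rewrite big_nat_cond [leRHS]big_nat_cond; apply: ler_sum => k /andP[/andP[Kk _] _].
  have k0 : (0 < k)%N by exact: leq_trans Kk.
  have kr : (0 : R) < k%:R by rewrite ltr0n.
  have bt : ((q - e1) * t) ^+ 2 / k%:R ^+ 2 <= b k * t ^+ 2.
    have /HK2/andP[h _] : (K2 <= k)%N by exact: leq_trans KK2 (ltnW Kk).
    by rewrite ler_pdivrMr ?exprn_gt0// [leRHS]mulrAC exprMn ler_wpM2r// exprn_ge0// ltW.
  have ak := a_ge0 k0; have at0 : 0 <= a k * t by rewrite mulr_ge0// ltW.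
  rewrite ler_ln ?posrE ?fac_gt0 ?(ltW t0)//; last by rewrite ltr_pwDl// divr_ge0 ?sqr_ge0.
  lra.
have S0 : 0 <= \sum_(1 <= k < K.+1) ln (1 + a k * t + b k * t ^+ 2).
  rewrite big_nat_cond sumr_ge0// => k /andP[/andP[k0 _] _]; rewrite ln_ge0//.
  by rewrite -addrA lerDl addr_ge0// mulr_ge0 ?a_ge0 ?b_ge0 ?sqr_ge0 ?(ltW t0).
have SN : \sum_(1 <= k < N.+1) ln (1 + a k * t + b k * t ^+ 2) =
    \sum_(1 <= k < K.+1) ln (1 + a k * t + b k * t ^+ 2)
    + \sum_(K.+1 <= k < N.+1) ln (1 + a k * t + b k * t ^+ 2).
  by rewrite -big_cat_nat//= ltnS.
have L2' := ler_wpM2r (ltW t0) L2.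
have lt0 : 0 <= ln t by rewrite ln_ge0.
move: L1; rewrite SN; move: L2' L3 tail S0 lt0.
move: (\sum_(K.+1 <= k < N.+1) ell _ _) (\sum_(K.+1 <= k < N.+1) ln _)
  (\sum_(1 <= k < K.+1) ln _) => A B D; lra.
Qed.

Lemma exponent_eq : c = pi * q.
Proof. by apply/eqP; rewrite eq_le exponent_le exponent_ge. Qed.

End exponent.

(** Telescoping: [1 / (k sqrt k)] is at most four times
    [1 / sqrt k - 1 / sqrt (k + 1)]. *)
Lemma sqrt_sum_bounded (a : nat -> R) (C : R) : 0 <= C ->
  (forall k, (0 < k)%N -> 0 <= a k) ->
  (forall k, (0 < k)%N -> a k <= C / (k%:R * Num.sqrt k%:R)) ->
  forall N, \sum_(1 <= k < N.+1) a k <= 4 * C.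
Proof.
move=> C0 a0 aC N.
have main M : \sum_(1 <= k < M.+1) a k <= 4 * C * (1 - (Num.sqrt M.+1%:R)^-1).
  elim: M => [|M IH]; first by rewrite big_geq// sqrtr1 invr1 subrr mulr0.
  rewrite big_nat_recr//=; have := aC M.+1 (ltn0Sn M).
  set k := M.+1; set u : R := Num.sqrt k%:R; set v : R := Num.sqrt k.+1%:R => h.
  have u0 : 0 < u by rewrite sqrtr_gt0 ltr0n.
  have v0 : 0 < v by rewrite sqrtr_gt0 ltr0n.
  have u2 : u ^+ 2 = k%:R by rewrite sqr_sqrtr.
  have v2 : v ^+ 2 = u ^+ 2 + 1 by rewrite u2 sqr_sqrtr// -natr1.
  have uv : u <= v by rewrite ler_sqrt ?ler_nat.
  have u1 : 1 <= u.
    by rewrite -[leLHS]sqrtr1 ler_sqrt ?ler1n// ltr0n.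
  have key : (k%:R * u)^-1 <= 4 * (u^-1 - v^-1).
    have uvp : 0 < u + v by rewrite addr_gt0.
    have E : u^-1 - v^-1 = ((u + v) * (u * v))^-1.
      have h2 : (v - u) * (u + v) = 1.
        have -> : (v - u) * (u + v) = v ^+ 2 - u ^+ 2 by ring.
        by rewrite v2; ring.
      have h3 : v - u = (u + v)^-1.
        by apply: (mulIf (_ : u + v != 0)); rewrite ?gt_eqF// mulVf ?gt_eqF.
      by rewrite invfM -h3; field; rewrite !gt_eqF.
    rewrite E -u2 -(invrK (4 : R)) -invfM lef_pV2 ?posrE ?mulr_gt0 ?invr_gt0 ?exprn_gt0//.
    rewrite ler_pdivrMl// (_ : 4 * (u ^+ 2 * u) = u * (4 * u ^+ 2)); last by ring.
    rewrite (_ : (u + v) * (u * v) = u * ((u + v) * v)); last by ring.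
    rewrite ler_wpM2l ?(ltW u0)//; have := sqr_ge0 (u - v); nra.
  have := ler_wpM2l C0 key; lra.
apply: le_trans (main N) _; by rewrite ler_piMr ?mulr_ge0 ?gerBl.
Qed.

End log_sums.

(** * Product formula for zeros close to an arithmetic progression *)

Lemma infinite_product_epsP (K : numFieldType) (u : nat -> K) (p : K) :
  (forall e : K, 0 < e -> exists N0 : nat, forall N, (N0 <= N)%N ->
     `|\prod_(1 <= k < N.+1) u k - p| <= e) -> infinite_product u p.
Proof.
move=> H; apply/cvgrPdist_le => e /H [N0 HN]; exists N0 => // n /= n0.
by rewrite distrC; exact: HN.
Qed.

Lemma zero_of_order_eps (K : numFieldType) (f : K -> K) (w : K) (m : nat) :
  zero_of_order f w m -> exists g : K -> K, [/\ analytic_on [set w] g, g w != 0 &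
    exists d : K, 0 < d /\ forall h, `|h| < d -> f (w + h) = h ^+ m * g (w + h)].
Proof.
case=> g [gd gw /near_epsP[d [d0 H]]]; exists g; split=> //.
  by move=> _ ->; exact: nbhs_singleton gd.
by exists d; split=> // h /H ->; congr (_ ^+ _ * _); ring.
Qed.

Section real_values.
Variable R : realType.
Implicit Types (f : R[i] -> R[i]).

Lemma zero_of_order_corder f w m : zero_of_order f w m -> corder f w m.
Proof.
move=> /zero_of_order_eps [g [/analytic_at_cdiff gd gw [d [/gt0_complexE[d0 ->] H]]]].
exists g; split=> //; first exact: cdiff_cont.
by exists (Re d); split=> // h hd; apply: H; rewrite normc_cmod ltcR.
Qed.

Lemma negC_small (d : R) : 0 < d -> exists t : R, [/\ 0 < t, t < 1 & cmod (- t%:C%C) < d].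
Proof.
move=> d0; exists (Num.min (d / 2) 2^-1); have p : 0 < Num.min (d / 2) 2^-1.
  by rewrite minr_gt0 ?divr_gt0 ?invr_gt0.
split=> //; first by rewrite gt_min invf_lt1// ltr1n orbT.
by rewrite cmodN cmod_real gtr0_norm// gt_min; apply/orP; left; rewrite ltr_pdivrMr// ltr_pMr// ltr1n.
Qed.

(** Values and difference quotients along the negative axis are real, and so are
    their limits. *)
Lemma real_at0 f l : cder f 0 l -> (forall t : R, 0 < t -> Im (f (- t%:C%C)) = 0) ->
  Im (f 0) = 0 /\ Im l = 0.
Proof.
move=> H fr; have f0 : Im (f 0) = 0.
  apply/eqP; rewrite -normr_eq0 eq_le normr_ge0 andbT.
  apply/ler_addgt0Pr => e e0; rewrite add0r.
  have [d [d0 Hd]] := cder_cont H e0; have [t [t0 _ td]] := negC_small d0.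
  have := le_trans (cmod_Im _) (Hd _ td).
  by rewrite add0r ImB fr// sub0r normrN.
split=> //; apply/eqP; rewrite -normr_eq0 eq_le normr_ge0 andbT.
apply/ler_addgt0Pr => e e0; rewrite add0r.
have [d [d0 Hd]] := H e e0; have [t [t0 _ td]] := negC_small d0.
have := le_trans (cmod_Im _) (Hd _ td).
rewrite add0r !ImB fr// f0 subrr sub0r -RtoCN ImZ cmod_real mulNr opprK normrN normrM.
by rewrite mulrC ler_pM2r// normr_gt0 gt_eqF.
Qed.

Lemma nonneg_at0 f : ccont f 0 -> (forall t : R, 0 < t -> 0 <= Re (f (- t%:C%C))) ->
  0 <= Re (f 0).
Proof.
move=> H fr; apply/ler_addgt0Pr => e e0.
have [d [d0 Hd]] := H e e0; have [t [t0 _ td]] := negC_small d0.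
have := le_trans (cmod_Re _) (Hd _ td); rewrite add0r ReB ler_norml.
have := fr t t0; lra.
Qed.

End real_values.

Section zero_asymptotics.
Variable R : realType.
Variables (z : nat -> R[i]) (alpha beta : R).
Hypothesis alpha_gt0 : 0 < alpha.
Hypothesis z_pos : forall n, (0 < n)%N -> 0 < Re (z n).
Hypothesis Re_z : Re (z n) / Num.sqrt n%:R @[n --> \oo] --> (0 : R).
Hypothesis Im_z : Im (z n) - (2 * pi / alpha * n%:R + beta) @[n --> \oo] --> (0 : R).

Let p : R := 2 * pi / alpha.
Let p_gt0 : 0 < p. Proof. by rewrite divr_gt0// mulr_gt0// pi_gt0. Qed.

(** [Re z_n = o (n)], so the modulus of [z_n] is asymptotic to [Im z_n]. *)
Lemma cmod_zero_asymptotic (e : R) : 0 < e -> exists N0 : nat, forall n, (N0 <= n)%N ->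
  `|cmod (z n) / n%:R - p| <= e.
Proof.
move=> e0; have e2 : 0 < e / 2 by rewrite divr_gt0.
have /cvgrPdist_le /(_ _ ltr01) [N1 _ H1] := Re_z.
have /cvgrPdist_le /(_ _ ltr01) [N2 _ H2] := Im_z.
have [N3 H3] := natr_large ((e / 2) ^- 2); have [N4 H4] := natr_large ((1 + `|beta|) / (e / 2)).
exists (maxn 1 (maxn (maxn N1 N2) (maxn N3 N4))) => n.
rewrite !geq_max => /and3P[n0 /andP[/H1 /= h1 /H2 /= h2] /andP[/H3 h3 /H4 h4]].
have nr : (0 : R) < n%:R by rewrite ltr0n.
set u : R := Num.sqrt n%:R in h1; have u0 : 0 < u by rewrite sqrtr_gt0.
have u2 : u ^+ 2 = n%:R by rewrite sqr_sqrtr// ltW.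
have re_le : `|Re (z n)| <= e / 2 * n%:R.
  move: h1; rewrite sub0r normrN normrM normfV (gtr0_norm u0) ler_pdivrMr// mul1r => h1.
  apply: le_trans h1 _; rewrite -u2 expr2 mulrA ler_peMl ?(ltW u0)//.
  rewrite -ler_pdivrMl// mulr1 -(@ler_pXn2r _ 2) ?nnegrE ?invr_ge0 ?(ltW e2) ?(ltW u0)//.
  by rewrite exprVn u2.
have im_le : `|Im (z n) - p * n%:R| <= e / 2 * n%:R.
  move: h4; rewrite ler_pdivrMr// mulrC; apply: le_trans.
  move: h2; rewrite sub0r normrN -/p => h2.
  rewrite (_ : _ - p * n%:R = (Im (z n) - (p * n%:R + beta)) + beta); last by ring.
  by rewrite (le_trans (ler_normD _ _))// lerD2r.
have c_im : `|cmod (z n) - `|Im (z n)| | <= `|Re (z n)|.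
  rewrite ler_norml; have := cmod_Im (z n); have := cmod_le_ReIm (z n).
  have := normr_ge0 (Re (z n)); lra.
have im_p : `| `|Im (z n)| - p * n%:R| <= e / 2 * n%:R.
  apply: le_trans im_le; have pn : 0 <= p * n%:R by rewrite mulr_ge0 ?(ltW p_gt0) ?(ltW nr).
  by rewrite -{1}(ger0_norm pn); exact: ler_dist_dist.
have -> : cmod (z n) / n%:R - p = (cmod (z n) - p * n%:R) / n%:R by field; rewrite gt_eqF.
rewrite normrM normfV (gtr0_norm nr) ler_pdivrMr//.
rewrite (_ : _ - p * n%:R = (cmod (z n) - `|Im (z n)|) + (`|Im (z n)| - p * n%:R)); last by ring.
rewrite (le_trans (ler_normD _ _))// (splitr e) mulrDl lerD//.
exact: le_trans c_im re_le.
Qed.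

Let zn_gt0 n : (0 < n)%N -> 0 < cmod (z n).
Proof. by move=> /z_pos h; exact: lt_le_trans h (Re_le_cmod _). Qed.

Lemma zero_linear_bounds : exists c0 c1 : R, 0 < c0 /\ forall k, (0 < k)%N ->
  c0 * k%:R <= cmod (z k) <= c1 * k%:R.
Proof.
have p2 : 0 < p / 2 by rewrite divr_gt0.
have [N0 HN] := cmod_zero_asymptotic p2.
have [c0 [c1 [c00 H]]] : exists c0 c1 : R, 0 < c0 /\ forall k, (0 < k < N0)%N ->
    c0 <= cmod (z k) / k%:R <= c1.
  elim: N0 {HN} => [|N [c0 [c1 [c00 H]]]]; first by exists 1, 1; split=> // k; rewrite ltn0 andbF.
  have [->|N1] := posnP N; first by exists 1, 1; split=> // k; case: k.
  exists (Num.min c0 (cmod (z N) / N%:R)), (Num.max c1 (cmod (z N) / N%:R)).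
  split; first by rewrite lt_min c00 divr_gt0 ?zn_gt0 ?ltr0n.
  move=> k /andP[k0]; rewrite ltnS leq_eqVlt => /orP[/eqP->|kN].
    by rewrite ge_min le_max lexx !orbT.
  by have /andP[a b] := H k (introT andP (conj k0 kN)); rewrite ge_min le_max a b.
exists (Num.min c0 (p / 2)), (Num.max c1 (p + p / 2)); split; first by rewrite lt_min c00.
move=> k k0; have kr : (0 : R) < k%:R by rewrite ltr0n.
rewrite -ler_pdivlMr// -[X in _ && X]ler_pdivrMr// ge_min le_max.
have [kN|kN] := ltnP k N0; first by have /andP[-> ->] := H k (introT andP (conj k0 kN)).
by have := HN k kN; rewrite ler_norml => h; apply/andP; split; apply/orP; right; lra.
Qed.

Definition zcoef k : R := 2 * Re (z k) / cmod (z k) ^+ 2.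

Lemma zcoef_ge0 k : (0 < k)%N -> 0 <= zcoef k.
Proof. by move=> /z_pos h; rewrite divr_ge0 ?sqr_ge0// mulr_ge0// ltW. Qed.

Lemma zcoef_sums_cvg : exists l : R, forall e : R, 0 < e -> exists N0 : nat, forall N, (N0 <= N)%N ->
  `|\sum_(1 <= k < N.+1) zcoef k - l| <= e.
Proof.
have [c0 [c1 [c00 Hc]]] := zero_linear_bounds.
have [M0 HM] : exists M : R, 0 <= M /\ forall k, (0 < k)%N -> Re (z k) <= M * Num.sqrt k%:R.
  have /cvgrPdist_le /(_ _ ltr01) [N1 _ H1] := Re_z.
  have [M [M0 H]] : exists M : R, 1 <= M /\ forall k, (0 < k < N1)%N -> Re (z k) <= M * Num.sqrt k%:R.
    elim: N1 {H1} => [|N [M [M0 H]]]; first by exists 1; split=> // k; rewrite ltn0 andbF.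
    exists (Num.max M (Re (z N) / Num.sqrt N%:R)); split; first by rewrite le_max M0.
    move=> k /andP[k0]; have sk : 0 < Num.sqrt k%:R :> R by rewrite sqrtr_gt0 ltr0n.
    rewrite -ler_pdivrMr// ltnS leq_eqVlt le_max => /orP[/eqP->|kN]; first by rewrite lexx orbT.
    by rewrite ler_pdivrMr// H ?k0.
  exists M; split; first exact: le_trans ler01 M0.
  move=> k k0; have [kN|kN] := ltnP k N1; first by rewrite H ?k0.
  have sk : 0 < Num.sqrt k%:R :> R by rewrite sqrtr_gt0 ltr0n.
  have := H1 k kN; rewrite /= sub0r normrN -ler_pdivrMr// => h.
  exact: le_trans (ler_norm _) (le_trans h M0).
case: HM => M00 HM.
pose s := (fun N : nat => \sum_(1 <= k < N.+1) zcoef k) : R^nat.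
have snd : nondecreasing_seq s.
  apply/nondecreasing_seqP => n; rewrite /s [leRHS]big_nat_recr//= lerDl.
  by rewrite zcoef_ge0.
have sb N : s N <= 4 * (2 * M0 / c0 ^+ 2).
  apply: sqrt_sum_bounded => [|k|k k0]; first by rewrite divr_ge0 ?sqr_ge0 ?mulr_ge0.
    exact: zcoef_ge0.
  have kr : (0 : R) < k%:R by rewrite ltr0n.
  set u : R := Num.sqrt k%:R; have u0 : 0 < u by rewrite sqrtr_gt0.
  have u2 : k%:R = u ^+ 2 by rewrite sqr_sqrtr// ltW.
  rewrite /zcoef ler_pdivrMr ?exprn_gt0 ?zn_gt0//.
  have /andP[h _] := Hc k k0.
  have h2 : c0 ^+ 2 * k%:R ^+ 2 <= cmod (z k) ^+ 2.
    by rewrite -exprMn lerXn2r ?nnegrE ?mulr_ge0 ?(ltW c00) ?(ltW kr) ?cmod_ge0.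
  have h3 : 0 <= 2 * M0 / c0 ^+ 2 / (k%:R * u).
    by rewrite divr_ge0 ?divr_ge0 ?mulr_ge0 ?sqr_ge0 ?(ltW kr) ?(ltW u0) ?(ltW c00).
  apply: le_trans (ler_wpM2l h3 h2).
  rewrite [leRHS](_ : _ = 2 * (M0 * u)); first by rewrite ler_wpM2l// HM.
  by rewrite u2; field; rewrite !gt_eqF.
have ub : has_ubound (range s) by exists (4 * (2 * M0 / c0 ^+ 2)) => _ [N _ <-].
have /cvgrPdist_le cv := nondecreasing_cvgn snd ub.
exists (sup (range s)) => e /cv [N0 _ H]; exists N0 => N /H /=.
by rewrite distrC.
Qed.

Lemma zcoef_tail (e : R) : 0 < e -> exists K0 : nat, forall K N, (K0 <= K)%N -> (K <= N)%N ->
  \sum_(K.+1 <= k < N.+1) zcoef k <= e.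
Proof.
move=> e0; have [l Hl] := zcoef_sums_cvg; have e2 : 0 < e / 2 by rewrite divr_gt0.
have [K0 H] := Hl _ e2; exists K0 => K N K0K KN.
have hK := H K K0K; have hN := H N (leq_trans K0K KN).
have E : \sum_(1 <= k < N.+1) zcoef k = \sum_(1 <= k < K.+1) zcoef k + \sum_(K.+1 <= k < N.+1) zcoef k.
  by rewrite -big_cat_nat//= ltnS.
by move: hK hN; rewrite E !ler_norml; lra.
Qed.

Lemma zquad_asym (e : R) : 0 < e < p^-1 -> exists K0 : nat, forall k, (K0 <= k)%N ->
  (p^-1 - e) ^+ 2 <= (cmod (z k) ^+ 2)^-1 * k%:R ^+ 2 <= (p^-1 + e) ^+ 2.
Proof.
move=> /andP[e0 eq].
have c1 : cmod (z n) / n%:R @[n --> \oo] --> p.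
  apply/cvgrPdist_le => d /cmod_zero_asymptotic[N0 H]; exists N0 => // n /= /H.
  by rewrite distrC.
have c2 : (cmod (z n) / n%:R)^-1 @[n --> \oo] --> p^-1.
  by apply: cvgV => //; exact: lt0r_neq0.
have /cvgrPdist_le /(_ _ e0) [N0 _ H] := c2.
exists (maxn 1 N0) => k; rewrite geq_max => /andP[k0 /H /=].
have kr : (0 : R) < k%:R by rewrite ltr0n.
rewrite [(cmod _ / _)^-1]invf_div ler_norml => /andP[h1 h2].
have x0 : 0 <= k%:R / cmod (z k) by rewrite divr_ge0 ?cmod_ge0 ?(ltW kr).
rewrite mulrC -exprVn -exprMn; move: (p^-1) (k%:R / cmod (z k)) eq h1 h2 x0 => P x eq h1 h2 x0.
by rewrite !lerXn2r ?nnegrE//; lra.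
Qed.

End zero_asymptotics.

Section assembly.
Variable R : realType.
Implicit Types s w : R[i].

(** Hadamard's product together with the value of its linear exponent, found
    from the algebraic decay on the negative real axis. *)
Theorem product_formula (f : R[i] -> R[i]) (z : nat -> R[i]) (alpha beta K kappa m m' : R) :
  0 < alpha -> (forall n, (0 < n)%N -> 0 < Re (z n)) ->
  Re (z n) / Num.sqrt n%:R @[n --> \oo] --> (0 : R) ->
  Im (z n) - (2 * pi / alpha * n%:R + beta) @[n --> \oo] --> (0 : R) ->
  entire f -> f 0 = 1 -> 1 <= K -> 0 < kappa ->
  (forall s, 1 <= cmod s -> cmod (f s) <= K * expR (kappa * cmod s)) ->
  (forall w, exists n, corder f w n /\
    ([set p : nat * bool | (0 < p.1)%N /\ listed_zero z p = w] #= `I_n)%card) ->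
  0 < m -> (forall t : R, 0 < t -> Im (f (- t%:C%C)) = 0) ->
  (forall t : R, 1 <= t -> m / t <= Re (f (- t%:C%C)) <= m' / t) ->
  forall s (e : R), 0 < e -> exists N0 : nat, forall N, (N0 <= N)%N ->
    cmod (\prod_(1 <= k < N.+1) quadratic_factor (z k) s
      - f s * cexp (- ((alpha / 2)%:C%C * s))) <= e.
Proof.
move=> al0 zpos Rez Imz fe f0 K1 ka0 fgr ford m0 fim fre.
have [c0 [c1 [c00 Hc]]] := zero_linear_bounds al0 zpos Rez Imz.
have [f1 Hf1] := fe 0.
have [_ f1i] := real_at0 Hf1 fim.
have zl k : (0 < k)%N -> c0 * k%:R <= cmod (z k) by move=> /Hc/andP[].
have zu k : (0 < k)%N -> cmod (z k) <= c1 * k%:R by move=> /Hc/andP[].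
have had := hadamard_limit fe f0 Hf1 K1 ka0 fgr c00 zl zu ford.
pose cN N : R := Re f1 + \sum_(1 <= k < N.+1) zcoef z k.
have csE N : csum f1 z N = (cN N)%:C%C.
  rewrite /csum /cN RtoCD (rmorph_sum (real_complex R)); congr (_ + _).
  by apply: complexP => //=; rewrite f1i.
have [l Hl] := zcoef_sums_cvg al0 zpos Rez Imz.
pose c := Re f1 + l.
have cN_lim e : 0 < e -> exists N0 : nat, forall N, (N0 <= N)%N -> `|cN N - c| <= e.
  move=> /Hl[N0 H]; exists N0 => N /H; congr (`|_| <= _); rewrite /cN /c; ring.
pose b k : R := (cmod (z k) ^+ 2)^-1.
have quadE k t : (0 < k)%N -> quadratic_factor (z k) (- t%:C%C) = (1 + zcoef z k * t + b k * t ^+ 2)%:C%C.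
  move=> k0; rewrite /quadratic_factor mul_conj_cmod /zcoef /b.
  rewrite sqrrN -RtoCX; move: (t ^+ 2) (cmod (z k) ^+ 2) (Re (z k)) => T A r.
  by rewrite !RtoCD !RtoCM !RtoCV (RtoC_nat R 2) RtoC1; ring.
have prodE N t : \prod_(1 <= k < N.+1) quadratic_factor (z k) (- t%:C%C) =
    (\prod_(1 <= k < N.+1) (1 + zcoef z k * t + b k * t ^+ 2))%:C%C.
  rewrite (rmorph_prod (real_complex R)) big_nat_cond [RHS]big_nat_cond.
  by apply: eq_bigr => k /andP[/andP[k0 _] _]; exact: quadE.
have plim t : 1 <= t -> exists N0 : nat, forall N, (N0 <= N)%N ->
    (m / 2) / t <= \prod_(1 <= k < N.+1) (1 + zcoef z k * t + b k * t ^+ 2) * expR (- (cN N * t))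
    <= (m' + m / 2) / t.
  move=> t1; have t0 := lt_le_trans ltr01 t1.
  have mt : 0 < m / 2 / t by rewrite !divr_gt0.
  have [N0 H] := had (- t%:C%C) _ mt; exists N0 => N /H.
  have -> : Qprod z N (- t%:C%C) * cexp (- t%:C%C * csum f1 z N) =
     (\prod_(1 <= k < N.+1) (1 + zcoef z k * t + b k * t ^+ 2) * expR (- (cN N * t)))%:C%C.
    rewrite /Qprod prodE csE RtoCM -cexp_real; congr (_ * cexp _).
    by rewrite RtoCN RtoCM; ring.
  move=> /(le_trans (cmod_Re _)); rewrite ReB /=.
  have := fre t t1; rewrite ler_norml (mulrDl m').
  have -> : m / t = m / 2 / t + m / 2 / t by rewrite -mulrDl -splitr.
  by move: (m' / t) (m / 2 / t) (_ * expR _) => x y v; lra.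
have ca : c = alpha / 2.
  have p0 := pi_gt0 R; have q0 : 0 < (2 * pi / alpha)^-1 by rewrite invr_gt0 divr_gt0// mulr_gt0.
  have m20 : 0 < m / 2 by rewrite divr_gt0.
  have mm : 0 < m' + m / 2.
    have := fre 1 (lexx 1); rewrite !divr1 => /andP[a1 a2].
    by rewrite addr_gt0// (lt_le_trans m0)// (le_trans a1).
  rewrite (exponent_eq q0 m20 mm _ _ _ _ cN_lim plim).
  - by rewrite invf_div; move: p0; move: (@pi R) => p p0; field; rewrite gt_eqF.
  - exact: zcoef_ge0.
  - by move=> k _; rewrite invr_ge0 sqr_ge0.
  - exact: zcoef_tail al0 zpos Rez Imz.
  - exact: zquad_asym al0 Rez Imz.
move=> s e e0.
have fs0 : 0 < cmod (f s) + 1 by rewrite ltr_wpDl ?cmod_ge0.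
set w : R[i] := - (c%:C%C * s).
have [d [d0 Hd]] := ccont_cexp w (divr_gt0 (divr_gt0 e0 (ltr0n R 2)) fs0).
pose E1 := cmod (cexp w) + e / 2 / (cmod (f s) + 1).
have E10 : 0 < E1 by rewrite ltr_wpDl ?cmod_ge0// !divr_gt0.
have [N1 HN1] := had s _ (divr_gt0 (divr_gt0 e0 (ltr0n R 2)) E10).
have s1 : 0 < cmod s + 1 by rewrite ltr_wpDl ?cmod_ge0.
have [N2 HN2] := cN_lim _ (divr_gt0 (divr_gt0 d0 (ltr0n R 2)) s1).
exists (maxn N1 N2) => N; rewrite geq_max => /andP[/HN1 h1 /HN2 h2].
pose h : R[i] := - ((cN N - c)%:C%C * s).
have hd : cmod h < d.
  rewrite /h cmodN cmodM cmod_real.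
  apply: le_lt_trans (ler_wpM2r (cmod_ge0 s) h2) _; rewrite mulrAC ltr_pdivrMr//.
  by have := cmod_ge0 s; nra.
have wh : w + h = - (s * (cN N)%:C%C) by rewrite /w /h RtoCB; ring.
have h3 := Hd h hd; rewrite wh in h3.
have h4 : cmod (cexp (- (s * (cN N)%:C%C))) <= E1.
  rewrite -(subrK (cexp w) (cexp (- _))) (le_trans (cmodD _ _))// addrC lerD2l//.
rewrite -ca -/w.
set Q := \prod_(_ <= _ < _) _; rewrite /Qprod -/Q csE in h1.
have -> : Q - f s * cexp w = (Q * cexp (s * (cN N)%:C%C) - f s) * cexp (- (s * (cN N)%:C%C))
    + f s * (cexp (- (s * (cN N)%:C%C)) - cexp w).
  by rewrite (cexpN (s * _)); field; exact: cexp_neq0.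
rewrite (splitr e) (le_trans (cmodD _ _))// lerD// cmodM.
  apply: le_trans (ler_pM (cmod_ge0 _) (cmod_ge0 _) h1 h4) _.
  by rewrite mulfVK// gt_eqF.
apply: le_trans (ler_wpM2l (cmod_ge0 _) h3) _.
by rewrite mulrCA ler_piMr ?divr_ge0 ?(ltW e0)// ler_pdivrMr// mul1r lerDl.
Qed.

End assembly.

(** * The queue *)

Section smith_factor.
Context d (T : measurableType d) (R : realType) (P : probability T R).
Variables (X Y V : {mfun T >-> R}).
Hypothesis X_ge0 : forall w, 0 <= X w.
Hypothesis Y_ge0 : forall w, 0 <= Y w.
Hypothesis V_ge0 : forall w, 0 <= V w.
Hypothesis XY_indep : independent P X Y.
Hypothesis VU_indep : independent P V (fun w => Y w - X w).
Hypothesis V_stationary : equal_in_law P V (fun w => Num.max (V w + (Y w - X w)) 0).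
Variables (eps : R) (eps_gt0 : 0 < eps).
Hypothesis X_strip : laplace_analytic_in_strip P X eps.
Variables (D : set R[i]) (A B psi chi : R[i] -> R[i]) (eps1 : R).
Hypothesis A_entire : laplace_continuation P X eps [set: R[i]] A.
Hypothesis B_cont : laplace_continuation P Y eps D B.
Hypothesis psi_laplace : forall s : R[i], 0 <= Re s -> psi s = laplace P V s.
Hypothesis smith : smith_factorization D (Ffun A B) psi chi eps1.

(** The idle time of the server, [(V + Y - X)^-]. *)
Definition idle (w : T) : R := Num.max (- (V w + (Y w - X w))) 0.
Definition idle_transform (s : R[i]) : R[i] := cE P (fun w => cexp (s * (idle w)%:C%C)).

Lemma idle_bounds w : 0 <= idle w <= X w.
Proof.
rewrite /idle le_max lexx orbT ge_max X_ge0 andbT /=.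
by have := V_ge0 w; have := Y_ge0 w; lra.
Qed.

Lemma measurable_idle : measurable_fun [set: T] idle.
Proof.
have mU : measurable_fun [set: T] (fun w => Y w - X w) by exact: measurable_funB.
have mZ : measurable_fun [set: T] (fun w => V w + (Y w - X w)) by exact: measurable_funD.
by apply: measurable_maxr => //; exact: (measurableT_comp (@oppr_measurable R setT)).
Qed.

Lemma idle_transform_cdiff s : Re s < eps -> cdiff idle_transform s.
Proof.
move=> se; eexists; apply: (cder_transform measurable_idle idle_bounds _ eps_gt0 se).
move=> b /andP[b0 be]; apply: rint_exp_strip X_strip _.
by rewrite be andbT (lt_trans _ b0)// oppr_lt0.
Qed.

Lemma idle_transform_le2 s : Re s <= 0 -> cmod (idle_transform s) <= 2.
Proof.
move=> s0; apply: cE_cexp_le2; first exact: measurable_idle.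
by move=> w; have /andP[i0 _] := idle_bounds w; rewrite mulr_le0_ge0.
Qed.

(** [g] is the real Laplace transform of the idle time. *)
Lemma idle_transform_real : exists g : R -> R,
  [/\ forall t, idle_transform (- t%:C%C) = (g t)%:C%C, forall t, 0 <= t -> 0 <= g t <= 1 &
      forall t, 1 <= t -> g t <= g 1].
Proof.
have e1 t w : cexp (- t%:C%C * (idle w)%:C%C) = (expR (- t * idle w))%:C%C.
  by rewrite -RtoCN -RtoCM cexp_real.
exists (fun t => rE P (fun w => expR (- t * idle w))).
have i0 w : 0 <= idle w by have /andP[] := idle_bounds w.
have le1 t w : 0 <= t -> expR (- t * idle w) <= 1.
  by move=> t0; rewrite -expR0 ler_expR mulNr oppr_le0 mulr_ge0.
have int t : 0 <= t -> rint P (fun w => expR (- t * idle w)).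
  move=> t0; apply: (@rint_bounded _ _ _ _ _ 1).
    apply: (measurableT_comp (@measurable_expR R)); apply: measurable_scale.
    exact: measurable_idle.
  by move=> w; rewrite ger0_norm ?expR_ge0// le1.
split=> [t|t t0|t t1].
- rewrite /idle_transform (_ : (fun w => _) = fun w => (expR (- t * idle w))%:C%C).
    by rewrite cEE; apply: complexP => //=; exact: rE_cst.
  by apply/funext => w; rewrite e1.
- apply/andP; split; first by apply: rE_ge0 => w; exact: expR_ge0.
  rewrite -[leRHS](rE_cst P); apply: rE_le => //; first exact: int.
    exact: finite_measure_integrable_cst.
  by move=> w; exact: le1.
apply: rE_le => [||w]; [by apply: int; exact: le_trans t1|exact: int|].
by rewrite ler_expR !mulNr lerN2 ler_wpM2r.
Qed.

Lemma half_plane_in_D s : 0 <= Re s -> D s.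
Proof.
case: B_cont => _ H _ _ s0; apply: H => /=.
by rewrite (lt_le_trans _ s0)// oppr_lt0.
Qed.

Lemma smith_eq_right s : 0 <= Re s -> s * chi s = Ffun A B s * psi s.
Proof.
move=> s0; have psi0 : psi s != 0.
  by apply: (smith_psi_neq0 smith); rewrite (lt_le_trans _ s0)// oppr_lt0 (smith_eps1 smith).
have Ds := half_plane_in_D s0.
have -> : Ffun A B s = s * chi s / psi s.
  apply: (smith_eq smith) => // /(smith_psi_poles smith Ds) [h _].
  by move: h; rewrite ltNge s0.
by rewrite mulfVK.
Qed.

Lemma Ffun_cdiff s : 0 <= Re s -> cdiff (Ffun A B) s.
Proof.
move=> s0; case: A_entire => _ _ /analytic_onP Aan _; case: B_cont => _ _ /analytic_onP Ban _.
have [a Ha] := Aan (- s) I; have [b Hb] := Ban s (half_plane_in_D s0).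
have h := cderB (cderM Hb (cder_comp (cderN (cder_id s)) Ha)) (cder_cst 1 s).
by eexists; exact: h.
Qed.

(** In the right half-plane, [chi] is the quotient of [F psi] by [s]. *)
Lemma chi_entire : entire chi.
Proof.
move=> s; have [se|se] := ltP (Re s) eps1.
  by have /analytic_onP := smith_chi_analytic smith; apply.
have e10 := smith_eps1 smith.
have s0 : 0 < Re s by exact: lt_le_trans se.
have [b Hb] := Ffun_cdiff (ltW s0).
have [c Hc] : cdiff psi s.
  have /analytic_onP := smith_psi_analytic smith; apply.
  by rewrite /= (lt_trans _ s0)// oppr_lt0.
have sn0 : s != 0 by apply: contraTneq s0 => ->; rewrite ltxx.
have h := cderM (cderM Hb Hc) (cderVid sn0).
eexists; apply: cder_near s0 _ h => x xs.
have rx : 0 < Re (s + x).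
  by have := cmod_Re x; rewrite ReD ler_norml; move: xs; lra.
have n0 : s + x != 0 by apply: contraTneq rx => ->; rewrite ltxx.
by rewrite -smith_eq_right ?(ltW rx)// mulrC mulKf.
Qed.

Lemma chi0_neq0 : chi 0 != 0.
Proof. by apply: (smith_chi_neq0 smith); exact: smith_eps1 smith. Qed.

(** The two sides agree on the imaginary axis by [lindley_identity], and are
    analytic on an open half-plane that contains it. *)
Lemma idle_identity s : Re s <= 0 -> s * chi s = idle_transform s - 1.
Proof.
move=> s0; have e10 := smith_eps1 smith.
pose e := Num.min eps eps1; have e0 : 0 < e by rewrite minr_gt0.
suff : s * chi s - (idle_transform s - 1) = 0 by move/eqP; rewrite subr_eq0 => /eqP.
apply: (@identity_theorem _ [set s : R[i] | Re s < e] (fun s => s * chi s - (idle_transform s - 1)) 0) => //=.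
- move=> x y t /= xe ye /andP[t0 t1]; rewrite /segpt ReD ReZ ReB.
  have [->|tn] := eqVneq t 0; first by rewrite mul0r addr0.
  have tp : 0 < t by rewrite lt_neqAle eq_sym tn.
  have ey : 0 < e - Re y by rewrite subr_gt0.
  have ex : 0 <= e - Re x by rewrite subr_ge0 ltW.
  have t1' : 0 <= 1 - t by rewrite subr_ge0.
  by have := mulr_gt0 tp ey; have := mulr_ge0 t1' ex; lra.
- move=> x /= xe; exists (e - Re x); split; first by rewrite subr_gt0.
  by move=> h; have := Re_le_cmod h; rewrite ReD; lra.
- move=> x /= xe; have [a Ha] := chi_entire x.
  have [|b Hb] := @idle_transform_cdiff x; first by rewrite (lt_le_trans xe)// ge_min lexx.
  by eexists; exact: cderB (cderM (cder_id x) Ha) (cderB Hb (cder_cst 1 x)).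
- move=> r r0; exists (Complex 0 (r / 2)).
  have c : cmod (Complex 0 (r / 2)) = r / 2.
    by rewrite cmodE /= expr0n add0r sqrtr_sqr gtr0_norm// divr_gt0.
  split; first by rewrite -cmod_gt0 c divr_gt0.
    by rewrite c ltr_pdivrMr// ltr_pMr// ltr1n.
  rewrite add0r smith_eq_right//; apply/eqP; rewrite subr_eq0; apply/eqP.
  have := lindley_identity (r / 2) XY_indep VU_indep V_stationary.
  rewrite /idle_transform /idle => <-; rewrite psi_laplace//; congr (_ * _).
  case: A_entire => _ _ _ AE; case: B_cont => _ _ _ BE.
  by rewrite /Ffun AE ?BE //= ?oppr0 oppr_lt0.
exact: le_lt_trans e0.
Qed.

Lemma laplace_le2 (Z : {mfun T >-> R}) s : (forall w, 0 <= Z w) -> 0 <= Re s ->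
  cmod (laplace P Z s) <= 2.
Proof.
move=> Z0 s0; apply: (@cE_cexp_le2 _ _ _ P (- s)); first exact: measurable_funP.
by move=> w; rewrite ReN mulNr oppr_le0 mulr_ge0.
Qed.

Variables (C lambda : R).
Hypothesis C_gt0 : 0 < C.
Hypothesis lambda_gt0 : 0 < lambda.
Hypothesis A_bound : forall s : R[i], `|A s| < ((C * expR (lambda * Re `|s|))%:C)%C.

Lemma chi_growth s : cmod (s * chi s) <= (4 * C + 5) * expR (lambda * cmod s).
Proof.
have E1 : 1 <= expR (lambda * cmod s) by rewrite -expR0 ler_expR mulr_ge0 ?cmod_ge0 ?(ltW lambda_gt0).
have [s0|s0] := leP (Re s) 0.
  rewrite idle_identity//; have := cmodB (idle_transform s) 1; rewrite cmod1.
  have := idle_transform_le2 s0.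
  have : 4 * C + 5 <= (4 * C + 5) * expR (lambda * cmod s).
    by rewrite ler_peMr// addr_ge0// mulr_ge0// ltW.
  by move: C_gt0; lra.
rewrite smith_eq_right ?(ltW s0)// cmodM psi_laplace ?(ltW s0)//.
have hV := laplace_le2 V_ge0 (ltW s0); have hY := laplace_le2 Y_ge0 (ltW s0).
have hA : cmod (A (- s)) <= C * expR (lambda * cmod s).
  by have := A_bound (- s); rewrite !normc_cmod cmodN ltcR => /ltW.
have BE : B s = laplace P Y s.
  by case: B_cont => _ _ _ H; apply: H; rewrite (lt_trans _ s0)// oppr_lt0.
have hF : cmod (Ffun A B s) <= 2 * (C * expR (lambda * cmod s)) + 1.
  rewrite /Ffun BE (le_trans (cmodB _ _))// cmod1 lerD2r cmodM.
  by rewrite ler_pM ?cmod_ge0.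
apply: le_trans (ler_pM (cmod_ge0 _) (cmod_ge0 _) hF hV) _; nra.
Qed.

Variables (z : nat -> R[i]).
Hypothesis z_enum : enumerates_right_zeros (Ffun A B) z.

Lemma chi_corder w : exists n, corder chi w n /\
  ([set p : nat * bool | (0 < p.1)%N /\ listed_zero z p = w] #= `I_n)%card.
Proof.
case: z_enum => zpos zz; have [w0|w0] := ltP 0 (Re w); last first.
  exists 0%N; split.
    apply: neq0_corder0; first exact: cdiff_cont (chi_entire w).
    by apply/eqP => /(smith_chi_zeros smith)[h _]; move: h; rewrite ltNge w0.
  rewrite (_ : [set _ | _] = set0) ?II0 ?card_eq00//.
  apply/seteqP; split=> // p /= [p0 pw]; move: w0; rewrite -pw leNgt.
  by rewrite /listed_zero; case: p.2; rewrite ?Re_conj zpos.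
have [n [/zero_of_order_corder [g [gc gw [r [r0 H]]]] cardn]] := zz w w0.
exists n; split=> //; have e10 := smith_eps1 smith.
have wn0 : w != 0 by apply: contraTneq w0 => ->; rewrite ltxx.
have pw : - eps1 < Re w by rewrite (lt_trans _ w0)// oppr_lt0.
exists (fun s => g s * psi s / s); split.
- apply: ccontM; last by apply: ccontV => //; exact: ccont_id.
  apply: ccontM => //; apply: cdiff_cont.
  by have /analytic_onP := smith_psi_analytic smith; apply.
- by rewrite !mulf_neq0 ?invr_neq0// (smith_psi_neq0 smith).
exists (Num.min r (Re w)); split; first by rewrite minr_gt0.
move=> h; rewrite lt_min => /andP[hr hw].
have rx : 0 < Re (w + h).
  by have := cmod_Re h; rewrite ReD ler_norml; move: hw; lra.
have n0 : w + h != 0 by apply: contraTneq rx => ->; rewrite ltxx.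
apply: (mulfI n0); rewrite smith_eq_right ?(ltW rx)// H//.
by move: n0; move: (w + h) => x x0; move: (h ^+ n) => y; field.
Qed.

Variables (alpha beta : R).
Hypothesis alpha_gt0 : 0 < alpha.
Hypothesis Re_z : Re (z n) / Num.sqrt n%:R @[n --> \oo] --> (0 : R).
Hypothesis Im_z : Im (z n) - (2 * pi / alpha * n%:R + beta) @[n --> \oo] --> (0 : R).

(** On the negative axis, [chi (- t) = (1 - g t) / t] with [g t <= g 1 < 1] for
    [t >= 1]: the strict inequality holds because [chi (- 1)] is not 0. *)
Lemma chi_product s : infinite_product (fun k => quadratic_factor (z k) s)
  (chi s / chi 0 * cexp (- ((alpha / 2)%:C%C * s))).
Proof.
have c00 := chi0_neq0; have zpos : forall n, (0 < n)%N -> 0 < Re (z n) by case: z_enum.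
have mc0 : 0 < cmod (chi 0) by rewrite cmod_gt0.
have [g [gE g01 g1]] := idle_transform_real.
have chiE t : 0 < t -> chi (- t%:C%C) = ((1 - g t) / t)%:C%C.
  move=> t0; have tn : t%:C%C != 0 :> R[i] by rewrite -cmod_gt0 cmod_real normr_gt0 gt_eqF.
  have := @idle_identity (- t%:C%C); rewrite /= oppr_le0 (ltW t0) => /(_ isT).
  rewrite gE => h; apply: (mulfI (_ : - t%:C%C != 0 :> R[i])); first by rewrite oppr_eq0.
  by rewrite h RtoCM RtoCV RtoCB RtoC1; field.
have [l Hl] := chi_entire 0.
have [chi0i _] := real_at0 Hl (fun t t0 => congr1 (@Im R) (chiE t t0)).
have chi0r : 0 <= Re (chi 0).
  apply: nonneg_at0; first exact: cder_cont Hl.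
  move=> t t0; rewrite chiE//= divr_ge0 ?(ltW t0)// subr_ge0.
  by have /andP[] := g01 t (ltW t0).
have chi0E : chi 0 = (Re (chi 0))%:C%C by apply: complexP.
set k := Re (chi 0) in chi0r chi0E.
have k0 : 0 < k.
  by rewrite lt_neqAle chi0r andbT eq_sym; apply: contraNneq c00 => h; rewrite chi0E h.
have g11 : g 1 < 1.
  have /andP[_ h] := g01 1 ler01; rewrite lt_neqAle h andbT.
  have : chi (- 1%:C%C) != 0.
    apply: (smith_chi_neq0 smith); rewrite /= (lt_trans _ (smith_eps1 smith))// oppr_lt0 ltr01 //.
  by apply: contraNneq => E; rewrite chiE// E subrr mul0r.
pose f s := chi s / chi 0.
have fe : entire f.
  by move=> x; have [a /(cderZ (chi 0)^-1) Ha] := chi_entire x; eexists; apply: cder_ext Ha => y; rewrite mulrC.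
have f0 : f 0 = 1 by rewrite /f divff.
have fE t : 0 < t -> f (- t%:C%C) = ((1 - g t) / t / k)%:C%C.
  by move=> t0; rewrite /f chiE// chi0E -RtoCV -RtoCM.
pose K := 1 + (4 * C + 5) / cmod (chi 0).
have C5 : 0 < 4 * C + 5 by rewrite addr_gt0// mulr_gt0.
have K1 : 1 <= K by rewrite lerDl divr_ge0 ?(ltW C5) ?(ltW mc0).
have fgr x : 1 <= cmod x -> cmod (f x) <= K * expR (lambda * cmod x).
  move=> x1; have x0 := lt_le_trans ltr01 x1.
  have := chi_growth x; rewrite cmodM => h.
  rewrite /f cmodM cmodV ler_pdivrMr//.
  apply: (@le_trans _ _ (cmod x * cmod (chi x))); first by rewrite ler_peMl ?cmod_ge0.
  have Kc : K * cmod (chi 0) = cmod (chi 0) + (4 * C + 5).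
    by rewrite /K mulrDl mul1r mulfVK// gt_eqF.
  apply: le_trans h _; rewrite [leRHS]mulrAC Kc ler_wpM2r ?expR_ge0//.
  by rewrite lerDr ltW.
have ford w : exists n, corder f w n /\
    ([set p : nat * bool | (0 < p.1)%N /\ listed_zero z p = w] #= `I_n)%card.
  have [n [[g' [gc gw [r [r0 H]]]] cn]] := chi_corder w; exists n; split=> //.
  exists (fun s => g' s / chi 0); split.
  - by apply: ccontM => //; exact: ccont_cst.
  - by rewrite mulf_neq0// invr_neq0.
  by exists r; split=> // h /H; rewrite /f mulrA => ->.
have m0 : 0 < (1 - g 1) / k by rewrite divr_gt0// subr_gt0.
have fre t : 1 <= t -> (1 - g 1) / k / t <= Re (f (- t%:C%C)) <= k^-1 / t.
  move=> t1; have t0 := lt_le_trans ltr01 t1; rewrite fE//= (mulrAC (1 - g t)).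
  have /andP[gt0 gt1] := g01 t (ltW t0).
  have ki : 0 < k^-1 by rewrite invr_gt0.
  have ti : 0 < t^-1 by rewrite invr_gt0.
  rewrite !(ler_pM2r ti) (ler_pM2r ki) lerD2l lerN2 g1//=.
  by rewrite ler_piMl ?(ltW ki)// gerBl.
have := @product_formula R f z alpha beta K lambda ((1 - g 1) / k) k^-1
  alpha_gt0 zpos Re_z Im_z fe f0 K1 lambda_gt0 fgr ford m0
  (fun t t0 => congr1 (@Im R) (fE t t0)) fre s => H.
apply: infinite_product_epsP => e /gt0_complexE[e0 ->].
have [N0 HN] := H _ e0; exists N0 => N /HN h.
by rewrite normc_cmod lecR.
Qed.

End smith_factor.

Theorem theorem2p2 (R : realType) (d : measure_display) (T : measurableType d)
  (P : probability T R) (X Y V : {RV P >-> R})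
  (X_ge0 : forall w, 0 <= X w) (Y_ge0 : forall w, 0 <= Y w)
  (V_ge0 : forall w, 0 <= V w)
  (XY_indep : independent P X Y)
  (stable : ('E_P[Y] < 'E_P[X])%E)
  (nonlattice : ~ lattice P X \/ ~ lattice P Y)
  (VU_indep : independent P V (fun w => Y w - X w))
  (V_stationary :
     equal_in_law P V (fun w => Num.max (V w + (Y w - X w)) 0))
  (eps : R) (eps_gt0 : 0 < eps)
  (X_strip : laplace_analytic_in_strip P X eps)
  (Y_strip : laplace_analytic_in_strip P Y eps)
  (D : set R[i]) (A B psi chi : R[i] -> R[i]) (eps1 : R)
  (A_entire : laplace_continuation P X eps [set: R[i]] A)
  (B_cont : laplace_continuation P Y eps D B)
  (psi_laplace : forall s : R[i], 0 <= Re s -> psi s = laplace P V s)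
  (smith : smith_factorization D (Ffun A B) psi chi eps1)
  (C lambda : R) (C_gt0 : 0 < C) (lambda_gt0 : 0 < lambda)
  (A_bound : forall s : R[i],
     `|A s| < ((C * expR (lambda * Re `|s|))%:C)%C)
  (z : nat -> R[i]) (z_enum : enumerates_right_zeros (Ffun A B) z)
  (alpha beta : R) (alpha_gt0 : 0 < alpha)
  (Re_z : Re (z n) / Num.sqrt n%:R @[n --> \oo] --> (0 : R))
  (Im_z : Im (z n) - (2 * pi / alpha * n%:R + beta) @[n --> \oo] --> (0 : R)) :
  exists chi0 : R[i], forall s : R[i],
    exists2 p : R[i],
      infinite_product (fun k => quadratic_factor (z k) s) p
      & chi s = chi0 * cexp ((alpha%:C)%C * s / 2) * p.
Proof.
exists (chi 0) => s.
exists (chi s / chi 0 * cexp (- ((alpha / 2)%:C%C * s))).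
  exact: (chi_product X_ge0 Y_ge0 V_ge0 XY_indep VU_indep V_stationary eps_gt0 X_strip
    A_entire B_cont psi_laplace smith C_gt0 lambda_gt0 A_bound z_enum alpha_gt0 Re_z Im_z).
have c0 := chi0_neq0 smith.
have -> : (alpha%:C)%C * s / 2 = (alpha / 2)%:C%C * s.
  by rewrite RtoCM RtoCV RtoC_nat mulrAC.
by rewrite cexpN; field; rewrite cexp_neq0 c0.
Qed.
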